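(* Let $d\ge 2$, let $\Sigma\subseteq N_{\mathbb{R}}$ be a simplicial $d$-fan, $\omega:\Sigma(d)\rightarrow\mathbb{R}_{>0}$ a weight function, and $*\in\mathrm{Inn}(N_{\mathbb{R}})$ an inner product such that $\mathrm{Cub}(\Sigma,* )\neq\emptyset$. Suppose that the following two conditions are satisfied: (i) $\Sigma^\tau\setminus\{0\}$ is connected for any cone $\tau\in\Sigma(k)$ with $k\leq d-3$; (ii) the Hessian matrix of the quadratic polynomial $\mathrm{Vol}_{\Sigma^\tau,\omega^\tau,*^\tau}(z)$ has exactly one positive eigenvalue for any $\tau\in\Sigma(d-2)$. Then the triple $(\Sigma,\omega,* )$ is AF; that is, $\mathrm{Cub}(\Sigma,* )\ne\emptyset$ and $$\mathrm{MVol}_{\Sigma,\omega,*}(z_1,z_2,z_3,\dots,z_d)^2\geq\mathrm{MVol}_{\Sigma,\omega,*}(z_1,z_1,z_3,\dots,z_d)\,\mathrm{MVol}_{\Sigma,\omega,*}(z_2,z_2,z_3,\dots,z_d)$$ for all $z_1,\dots,z_d\in\mathrm{Cub}(\Sigma,* )$.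
   Context: **Fans.** $N_{\mathbb{R}}$ is a finite-dimensional real vector space. All fans are (finite) polyhedral fans that are pure (all maximal cones have the same dimension) and marked (a generator $0\neq u_\rho\in\rho$ is chosen for each ray $\rho$). A $d$-fan is such a fan of dimension $d$. $\Sigma(k)$ is the set of $k$-dimensional cones of $\Sigma$, $\sigma(k)$ the set of $k$-dimensional faces of a cone $\sigma$, $\preceq$ the face relation, $\sigma^\circ$ the relative interior, $N_{\sigma,\mathbb{R}}$ the linear span of $\sigma$. $\Sigma$ is simplicial if $\dim N_{\sigma,\mathbb{R}}=|\sigma(1)|$ for all $\sigma\in\Sigma$. $\mathrm{Inn}(N_{\mathbb{R}})$ is the set of inner products on $N_{\mathbb{R}}$. **Cubical values.** For $z\in\mathbb{R}^{\Sigma(1)}$ and $\sigma\in\Sigma$, $w_{\sigma,*}(z)\in N_{\sigma,\mathbb{R}}$ is the unique vector with $w_{\sigma,*}(z)*u_\rho=z_\rho$ for all $\rho\in\sigma(1)$. $\mathrm{Cub}(\Sigma,* )$ (cubical values) is the set of $z$ with $w_{\sigma,*}(z)\in\sigma^\circ$ for all $\sigma\in\Sigma$; $\overline{\mathrm{Cub}}(\Sigma,* )$ (pseudocubical values) is the set of $z$ with $w_{\sigma,*}(z)\in\sigma$ for all $\sigma\in\Sigma$. **(Mixed) volumes.** Let $P_{\sigma,*}(z)=\{v\in\sigma\mid v*u_\rho\le z_\rho\text{ for all }\rho\in\sigma(1)\}$. Let $M_\sigma\subseteq N_{\sigma,\mathbb{R}}$ be the lattice spanned by the basis dual to $\{u_\rho\mid\rho\in\sigma(1)\}$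 with respect to $*$, and let $\mathrm{Vol}_\sigma$ be the volume function on polytopes in $N_{\sigma,\mathbb{R}}$ normalized so that a fundamental simplex of $M_\sigma$ (the convex hull of $0$ and a lattice basis) has volume $1$. Let $\mathrm{MVol}_\sigma$ be the associated mixed volume of polytopes (the symmetric, Minkowski-multilinear function with $\mathrm{MVol}_\sigma(P,\dots,P)=\mathrm{Vol}_\sigma(P)$). For pseudocubical values, $$\mathrm{Vol}_{\Sigma,\omega,*}(z)=\sum_{\sigma\in\Sigma(d)}\omega(\sigma)\mathrm{Vol}_\sigma(P_{\sigma,*}(z)),$$ $$\mathrm{MVol}_{\Sigma,\omega,*}(z_1,\dots,z_d)=\sum_{\sigma\in\Sigma(d)}\omega(\sigma)\mathrm{MVol}_\sigma(P_{\sigma,*}(z_1),\dots,P_{\sigma,*}(z_d)).$$ When $\mathrm{Cub}(\Sigma,* )\neq\emptyset$, it is a nonempty open cone on which $\mathrm{Vol}_{\Sigma,\omega,*}$ agrees with a homogeneous polynomial of degree $d$ in $\mathbb{R}[z_\rho\mid\rho\in\Sigma(1)]$, and $\mathrm{Vol}_{\Sigma,\omega,*}$ is identified with this polynomial. **Stars.** For $\tau\in\Sigma$, let $N^\tau_{\mathbb{R}}=N_{\tau,\mathbb{R}}^\perp\subseteq N_{\mathbb{R}}$ (orthogonal complement for $*$), and let $\mathrm{pr}^\tau:N_{\mathbb{R}}\to N^\tau_{\mathbb{R}}$ be the orthogonal projection. The star $\Sigma^\tau$ is the fan in $N^\tau_{\mathbb{R}}$ with cones $\pi^\tau:=\mathrm{pr}^\tau(\pi)$,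 where $\pi$ ranges over the faces of cones $\sigma\in\Sigma$ with $\tau\preceq\sigma$. The map $\sigma\mapsto\sigma^\tau$ is a bijection from $\{\sigma\in\Sigma\mid\tau\preceq\sigma\}$ to $\Sigma^\tau$, and $\Sigma^\tau$ is a simplicial fan of pure dimension $d^\tau=d-\dim\tau$. Each ray $\eta\in\Sigma^\tau(1)$ is the projection of a unique ray $\hat\eta$ among the rays of these cones, and is marked by $u_\eta=\mathrm{pr}^\tau(u_{\hat\eta})$. $*^\tau$ is the restriction of $*$ to $N^\tau_{\mathbb{R}}$, and $\omega^\tau(\sigma^\tau)=\omega(\sigma)$ for $\sigma\in\Sigma(d)$ with $\tau\preceq\sigma$. If $\mathrm{Cub}(\Sigma,* )\ne\emptyset$ then $\mathrm{Cub}(\Sigma^\tau,*^\tau)\ne\emptyset$, so $\mathrm{Vol}_{\Sigma^\tau,\omega^\tau,*^\tau}$ is a polynomial of degree $d^\tau$ in the variables $z_\eta$, $\eta\in\Sigma^\tau(1)$. $\Sigma^\tau\setminus\{0\}$ denotes the union of all cones of $\Sigma^\tau$ with the origin removed, as a topological space. *)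

(* Defs.v *)
From HB Require Import structures.
From mathcomp Require Import all_boot all_order all_fingroup all_algebra.
From mathcomp Require Import all_classical all_reals all_analysis.
From mathcomp.multinomials Require mpoly.
(* the notations of mpoly clash with those of the analysis library *)
Import -(notations) mpoly.

Set Implicit Arguments.
Unset Strict Implicit.
Unset Printing Implicit Defensive.

Import Order.TTheory GRing.Theory Num.Theory.
Import numFieldNormedType.Exports.
Local Open Scope classical_set_scope.
Local Open Scope ring_scope.

(* A marked fan is encoded by its rays: [mark F i] is the chosen generator
   u_i of the ray of index [i], and a cone is represented by the set of
   indices of its rays, i.e. [s \in cones F] stands for the cone [cone F s]
   with s(1) = [s].  The index type [I] may contain indices that are not rays
   of [F] (see [star], which reuses the index type of the original fan); those
   that are rays form the set [rays F]. *)

Record fan_data (R : realType) (n : nat) (I : finType) := FanData {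
  mark : I -> 'rV[R]_n;
  cones : {set {set I}} }.

(* [l = 0] shows that a cone is a face of itself. *)
Definition face (R : realType) (n : nat) (A C : set 'rV[R]_n) : Prop :=
  exists l : {scalar 'rV[R]_n},
    (forall v, C v -> 0 <= l v) /\ A = [set v | C v /\ l v = 0].

Section Fan.
Variables (R : realType) (n : nat) (I : finType) (F : fan_data R n I).

Definition cone (s : {set I}) : set 'rV[R]_n :=
  [set v | exists a : I -> R,
     (forall i, 0 <= a i) /\ v = \sum_(i in s) a i *: mark F i].

Definition cspan (s : {set I}) : {vspace 'rV[R]_n} :=
  <<[seq mark F i | i in s]>>%VS.

Definition cdim (s : {set I}) : nat := \dim (cspan s).

Definition rays : {set I} := [set i | [set i] \in cones F]%SET.

(* [fan_rays] and [fan_inj] say that [s] is exactly the set of (indices of)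
   rays of [cone s]: the rays of a strongly convex cone are, up to scaling,
   among any set of generators of it. *)
Record is_fan : Prop := IsFan {
  fan_nonempty : cones F != finset.set0;
  fan_mark : forall i, i \in rays -> mark F i != 0;
  fan_inj : forall i j, i \in rays -> j \in rays ->
    cone [set i]%SET = cone [set j]%SET -> i = j;
  fan_pointed : forall s, s \in cones F ->
    forall v, cone s v -> cone s (- v) -> v = 0;
  fan_rays : forall s i, s \in cones F -> i \in s ->
    i \in rays /\ face (cone [set i]%SET) (cone s);
  fan_face : forall s A, s \in cones F -> face A (cone s) ->
    exists2 t, t \in cones F & A = cone t;
  fan_inter : forall s t, s \in cones F -> t \in cones F ->
    face (cone s `&` cone t) (cone s) /\ face (cone s `&` cone t) (cone t) }.

Definition is_dfan (d : nat) : Prop :=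
  is_fan /\
  forall s, s \in cones F ->
    (forall t, t \in cones F -> cone s `<=` cone t -> s = t) -> cdim s = d.

Definition simplicial : Prop := forall s, s \in cones F -> cdim s = #|s|.

Definition fan_support : set 'rV[R]_n :=
  [set v | exists2 s, s \in cones F & cone s v].

Definition relint (s : {set I}) : set 'rV[R]_n :=
  [set v | cone s v /\ \forall x \near v, x \in cspan s -> cone s x].

End Fan.

(* the k-fold product of the Lebesgue measure, as an iterated integral *)

Fixpoint lebesgueRn (R : realType) (k : nat) : set 'rV[R]_k -> \bar R :=
  match k with
  | 0 => fun A => (\1_A (0 : 'rV[R]_0))%:E
  | k'.+1 => fun A =>
      (\int[@lebesgue_measure R]_x
         lebesgueRn [set y : 'rV[R]_k' | A (row_mx (x : R)%:M y : 'rV[R]_k'.+1)])%E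
  end.

Section Normal_complex.
Variables (R : realType) (n : nat) (I : finType) (F : fan_data R n I).
Variable ip : {dot 'rV[R]_n for idfun}.

(* w_{s,*}(z); it exists and is unique when the generators of [s] are
   linearly independent. *)
Definition cubvec (z : I -> R) (s : {set I}) : 'rV[R]_n :=
  xget 0 [set w | w \in cspan F s /\
                  forall i, i \in s -> ip w (mark F i) = z i].

(* [z] is a vector indexed by [rays F]; its values at other indices are
   irrelevant here and below. *)
Definition Cub : set (I -> R) :=
  [set z | forall s, s \in cones F -> relint F s (cubvec z s)].

Definition ncone (z : I -> R) (s : {set I}) : set 'rV[R]_n :=
  [set v | cone F s v /\ forall i, i \in s -> ip v (mark F i) <= z i].

(* The coordinates of [v] in the basis dual to (u_i)_{i in s} are the numbers
   v * u_i, so that in these coordinates the lattice M_s is Z^k, k = #|s|,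
   whose fundamental simplices have Lebesgue measure 1 / k!. *)
Definition cvol (s : {set I}) (P : set 'rV[R]_n) : R :=
  (#|s| `!)%:R * fine (lebesgueRn
    [set (\row_(j < #|s|) ip v (mark F (enum_val j))) | v in P]).

(* A polytope is a nonempty bounded intersection of finitely many half-spaces
   of the span of [s]. *)
Definition polytope_in (s : {set I}) (P : set 'rV[R]_n) : Prop :=
  [/\ P !=set0,
      exists B : R, forall v, P v -> ip v v <= B &
      exists (m : nat) (a : 'I_m -> 'rV[R]_n) (b : 'I_m -> R),
        P = [set v | v \in cspan F s /\ forall j, ip v (a j) <= b j]].

(* The three properties that characterize the mixed volume of polytopes in the
   span of [s]; only the values of [M] at [d]-tuples of polytopes matter. *)
Record is_mixed_volume (d : nat) (s : {set I})
    (M : ('I_d -> set 'rV[R]_n) -> R) : Prop := IsMixedVolume {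
  mvol_diag : forall P, polytope_in s P -> M (fun=> P) = cvol s P;
  mvol_sym : forall (Ps : 'I_d -> set 'rV[R]_n) (g : 'S_d),
    (forall k, polytope_in s (Ps k)) -> M (fun k => Ps (g k)) = M Ps;
  mvol_linear : forall (Ps : 'I_d -> set 'rV[R]_n) (k : 'I_d) P Q (a b : R),
    (forall k, polytope_in s (Ps k)) -> polytope_in s P -> polytope_in s Q ->
    0 <= a -> 0 <= b ->
    M [eta Ps with k |-> [set a *: x + b *: y | x in P & y in Q]] =
    a * M [eta Ps with k |-> P] + b * M [eta Ps with k |-> Q] }.

Variable w : {set I} -> R.

Definition fanVol (d : nat) (z : I -> R) : R :=
  \sum_(s in cones F | cdim F s == d) w s * cvol s (ncone z s).

(* [M s] is the mixed volume of the cone [s] *)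
Definition fanMVol (d : nat) (M : {set I} -> ('I_d -> set 'rV[R]_n) -> R)
    (z : 'I_d -> I -> R) : R :=
  \sum_(s in cones F | cdim F s == d) w s * M s (fun k => ncone (z k) s).

(* the homogeneous polynomial of degree [d] in the variables z_i, i in
   [rays F], with which the volume function agrees on [Cub] *)
Definition fanVol_poly (d : nat) : mpoly #|rays F| R :=
  xget 0 [set p | p \is ishomog1 d mdeg /\
    forall z, Cub z -> meval (fun j => z (enum_val j)) p = fanVol d z].

(* The mixed volumes [M s] are determined, on polytopes, by
   [is_mixed_volume]; they exist by Minkowski's theorem. *)
Definition is_AF (d : nat) : Prop :=
  Cub !=set0 /\
  forall M : {set I} -> ('I_d -> set 'rV[R]_n) -> R,
    (forall s, s \in cones F -> cdim F s = d -> is_mixed_volume s (M s)) ->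
  forall (z1 z2 : I -> R) (zs : (d - 2).-tuple (I -> R)),
    Cub z1 -> Cub z2 -> (forall k, Cub (tnth zs k)) ->
    let MV x y := fanMVol M (fun k => nth x [:: x, y & zs] k) in
    MV z1 z1 * MV z2 z2 <= MV z1 z2 ^+ 2.

End Normal_complex.

Section Star.
Variables (R : realType) (n : nat) (I : finType) (F : fan_data R n I).
Variable ip : {dot 'rV[R]_n for idfun}.

Definition pr (t : {set I}) : 'rV[R]_n -> 'rV[R]_n :=
  daddv_pi (orthov ip (cspan F t)) (cspan F t).

(* The star is a fan in the orthogonal complement of the span of [t], viewed
   inside R^n, with the restriction of the inner product.  For cones of a fan,
   being a face amounts to inclusion of ray sets.  The cone pr^t(p) is
   generated by the images of the u_i, i in p, which vanish for i in t, and
   its rays are, for a simplicial fan, indexed by p minus t. *)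
Definition star (t : {set I}) : fan_data R n I :=
  FanData (fun i => pr t (mark F i))
    [set p :\: t | p in cones F &
       [exists s in cones F, (t \subset s) && (p \subset s)]]%SET.

(* s^t is represented by s minus t, where t is contained in s *)
Definition star_weight (w : {set I} -> R) (t s : {set I}) : R :=
  w (s :|: t)%SET.

End Star.

Definition hessian (R : realType) (m : nat) (p : mpoly m R)
    (x : 'I_m -> R) : 'M[R]_m :=
  \matrix_(i, j) meval x (mderiv j (mderiv i p)).

(* eigenvalues are counted with multiplicity *)
Definition one_positive_eigenvalue (R : realType) (m : nat) (A : 'M[R]_m) :
    Prop :=
  exists a : R, [/\ 0 < a, mup a (char_poly A) = 1%N &
    forall b, 0 < b -> eigenvalue A b -> b = a].

(* Main.v *)
Require Import Defs.
From HB Require Import structures.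
From mathcomp Require Import all_boot all_order all_algebra.
From mathcomp Require Import all_classical all_reals all_analysis.
From mathcomp.multinomials Require mpoly.
From mathcomp Require Import measurable_realfun perm zify ring lra complex spectral.

Set Implicit Arguments.
Unset Strict Implicit.
Unset Printing Implicit Defensive.

Import Order.TTheory GRing.Theory Num.Theory.
Import numFieldNormedType.Exports.
Local Open Scope classical_set_scope.
Local Open Scope ring_scope.

(* Cutting the polytopes of the normal complex into pyramids with apex 0 over
   their facets gives a recursion that expresses the mixed volume of the star of
   a cone t at (z, zs) as the sum, over the rays i of the star, of the value at i
   induced by z times the mixed volume at zs of the star of the cone spanned by t
   and i. The Alexandrov-Fenchel inequality is proved in all stars by induction
   on their dimension. In dimension 2, the Hessian of the volume polynomial is
   twice the matrix of the mixed volume, and a symmetric matrix with one positive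
   eigenvalue satisfies the reverse Cauchy-Schwarz inequality. In higher
   dimension, fix all arguments but two, one of them being c. By the recursion
   the mixed volume is a bilinear form, with symmetric matrix B, in the values
   induced by the two free arguments on the link. The off-diagonal entries of B
   are nonnegative, B is irreducible because the punctured star is connected, and
   B c = p is positive. The inequality in the stars of the rays reads
   y B y <= sum_i c_i/p_i (B y)_i^2, which forbids eigenvalues of diag(p/c)^-1 B in
   the interval (0, 1). By the Perron-Frobenius theorem 1 is its largest
   eigenvalue, with eigenspace spanned by c, hence B has one positive eigenvalue. *)

Definition upd (R : Type) (I : eqType) (z : I -> R) (i : I) (x : R) : I -> R :=
  fun k => if k == i then x else z k.

(* Coordinates are named by [I] rather than numbered, so that Fubini's theorem
   becomes invariance under permutations of [r]; those outside [r] are frozen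
   at [z]. *)
Fixpoint lebesgue_on (R : realType) (I : eqType) (r : seq I)
    (P : set (I -> R)) (z : I -> R) : \bar R :=
  match r with
  | [::] => (\1_P z)%:E
  | i :: r' => (\int[@lebesgue_measure R]_x lebesgue_on r' P (upd z i x))%E
  end.

Definition polyhedron (R : realType) (I : finType) (P : set (I -> R)) : Prop :=
  exists (m : nat) (b : 'I_m -> R) (c : 'I_m -> I -> R),
    P = [set z | forall j, 0 <= b j + \sum_i c j i * z i].

(** * Iterated Lebesgue integrals over polyhedra *)

Section LebesgueOn.
Variables (R : realType) (I : finType).
Implicit Types (r : seq I) (P : set (I -> R)) (z : I -> R) (x : R).
Local Notation mu := (@lebesgue_measure R).

Lemma lebesgue_on_ge0 r P z : (0 <= lebesgue_on r P z)%E.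
Proof.
elim: r z => [|i r IH] z /=; first by rewrite lee_fin indicE; case: (_ \in _).
by apply: integral_ge0.
Qed.

Lemma lebesgue_on_set0 r z : lebesgue_on r set0 z = 0%E.
Proof.
elim: r z => [|i r IH] z /=; first by rewrite indic0.
by rewrite (eq_integral (cst 0%E)) ?integral0// => x _; rewrite IH.
Qed.

Lemma measurable_lebesgue_on d (T : measurableType d) r P (z : T -> I -> R) :
  polyhedron P -> (forall i, measurable_fun [set: T] ((z ^~ i) : T -> R)) ->
  measurable_fun [set: T] ((fun t => lebesgue_on r P (z t)) : T -> \bar R).
Proof.
move=> polP; elim: r d T z => [|i r IH] d T z mz /=.
  apply/measurable_EFinP.
  have -> : (fun t => \1_P (z t) : R) = \1_(z @^-1` P).
    by apply/funext => t; rewrite !indicE; congr (_ %:R); apply/asboolP/asboolP.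
  apply: measurable_indic.
  have [m [b [c ->]]] := polP.
  have -> : z @^-1` [set v | forall j : 'I_m, 0 <= b j + \sum_k c j k * v k] =
     \bigcap_(j in [set: 'I_m]) [set t | 0 <= b (j : 'I_m) + \sum_k c j k * z t k].
    by apply/seteqP; split=> t /=; [move=> h j _; exact: h | move=> h j; exact: h].
  apply: fin_bigcap_measurable => // /= j _.
  rewrite -[X in measurable X]setTI.
  have mf : measurable_fun setT (fun t => b j + \sum_k c j k * z t k).
    apply: measurable_funD => //; apply: measurable_sum => k.
    by apply: measurable_funM.
  have := mf measurableT `[0, +oo[%classic (measurable_itv _).
  by congr (measurable (_ `&` _)); apply/seteqP; split=> t /=; rewrite in_itv/= andbT.
have H : measurable_fun [set: T * measurableTypeR R] (fun tx => lebesgue_on r P (upd (z tx.1) i tx.2)).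
  apply: (IH _ _ (fun tx : T * measurableTypeR R => upd (z tx.1) i tx.2)) => k.
  rewrite /upd; case: (k == i) => /=; first exact: measurable_snd.
  exact: (measurableT_comp (mz k) measurable_fst).
have H0 tx : (0 <= lebesgue_on r P (upd (z tx.1) i tx.2))%E by exact: lebesgue_on_ge0.
exact: (@measurable_fun_fubini_tonelli_F _ _ T (measurableTypeR R) R mu _ H H0).
Qed.

Lemma upd_comm z (i j : I) x y : i != j -> upd (upd z i x) j y = upd (upd z j y) i x.
Proof.
move=> ij; apply/funext => k; rewrite /upd.
case: (k =P j) => [->|//]; by rewrite eq_sym (negbTE ij).
Qed.

Lemma measurable_lebesgue_on_upd r P z i : polyhedron P ->
  measurable_fun [set: R] ((fun x => lebesgue_on r P (upd z i x)) : R -> \bar R).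
Proof.
move=> polP; apply: measurable_lebesgue_on => // k.
by rewrite /upd; case: (k == i).
Qed.

Lemma lebesgue_on_swap r P z i j : polyhedron P -> i != j ->
  lebesgue_on (i :: j :: r) P z = lebesgue_on (j :: i :: r) P z.
Proof.
move=> polP ij /=.
pose f (xy : measurableTypeR R * measurableTypeR R) := lebesgue_on r P (upd (upd z i xy.1) j xy.2).
have f0 xy : (0 <= f xy)%E by exact: lebesgue_on_ge0.
have mf : measurable_fun setT f.
  apply: measurable_lebesgue_on => // k; rewrite /upd.
  case: (k == j); first exact: measurable_snd.
  by case: (k == i) => //; exact: measurable_fst.
transitivity (\int[mu]_x \int[mu]_y f (x, y))%E; first by [].
rewrite (@fubini_tonelli _ _ (measurableTypeR R) (measurableTypeR R) R mu mu f mf f0).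
by apply: eq_integral => y _; apply: eq_integral => x _; rewrite /f /= upd_comm.
Qed.

Lemma lebesgue_on_perm r r' P z : polyhedron P -> uniq r -> perm_eq r r' ->
  lebesgue_on r P z = lebesgue_on r' P z.
Proof.
move=> polP; elim: r' r z => [|i r' IH] r z ur.
  by move/perm_nilP => ->.
move=> prr; have ir : i \in r by rewrite (perm_mem prr) mem_head.
case/splitPr: ir ur prr => r1 r2 ur prr.
have ir1 : i \notin r1.
  by move: ur; rewrite cat_uniq => /and3P[_ /norP[]].
have pr : perm_eq (r1 ++ i :: r2) (i :: r1 ++ r2).
  by rewrite -[i :: r2]cat1s -[i :: r1 ++ r2]cat1s perm_catCA.
have -> : lebesgue_on (r1 ++ i :: r2) P z = lebesgue_on (i :: r1 ++ r2) P z.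
  elim: r1 z ir1 {ur prr pr} => [//|j r1 IH1] z.
  rewrite inE negb_or => /andP[ij ir1].
  rewrite [RHS]lebesgue_on_swap //=.
  by apply: eq_integral => x _; rewrite IH1.
rewrite /=; apply: eq_integral => x _; apply: IH.
  by move: ur; rewrite (perm_uniq pr) => /andP[].
by rewrite -(perm_cons i) -(permPr prr) perm_sym.
Qed.

Lemma lebesgue_measure_affine (b c : R) (A : set R) : 0 < c ->
  measurable A -> (mu ((fun x => b + c * x)%R @^-1` A) * c%:E = mu A)%E.
Proof.
move=> c0 mA.
pose phi (x : measurableTypeR R) : measurableTypeR R := b + c * x.
have mphi : measurable_fun setT phi.
  by apply: measurable_funD => //; apply: measurable_funM.
have c0' : 0 <= c by exact: ltW.
pose nu0 := measure_function_pushforward__canonical__measure_function_Measure mu mphi.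
pose nu := mscale (NngNum c0') nu0.
suff -> : mu A = nu A by rewrite /nu /mscale /= muleC.
apply: (@lebesgue_measure_unique R nu) => // _ [[x y] _ <-].
have E : phi @^-1` `]x, y]%classic = `](x - b) / c, (y - b) / c]%classic.
  apply/seteqP; split => t /=; rewrite !in_itv/= ltr_pdivrMr// ler_pdivlMr// /phi;
  by rewrite ltrBlDl lerBrDl [t * c]mulrC.
rewrite [RHS](_ : _ = (c%:E * mu (phi @^-1` `]x, y]%classic))%E) // E !lebesgue_measure_itv /= !lte_fin.
rewrite ltr_pM2r ?invr_gt0 // ltrD2r; case: ifP => _; last by rewrite mule0.
rewrite -!EFinB -EFinM -mulrBl opprB addrA subrK mulrCA divff ?mulr1 //.
by rewrite gt_eqF.
Qed.

Lemma ge0_integral_affine (b c : R) (f : R -> \bar R) : 0 < c ->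
  measurable_fun [set: R] f -> (forall x, 0 <= f x)%E ->
  (\int[mu]_x f x = c%:E * \int[mu]_x f (b + c * x)%R)%E.
Proof.
move=> c0 mf f0.
pose phi (x : measurableTypeR R) : measurableTypeR R := b + c * x.
have mphi : measurable_fun setT phi.
  by apply: measurable_funD => //; apply: measurable_funM.
have c0' : 0 <= c by exact: ltW.
pose nu0 := measure_function_pushforward__canonical__measure_function_Measure mu mphi.
rewrite -[X in (_ * X)%E](@ge0_integral_pushforward _ _ _ _ R phi mphi mu setT f) //.
rewrite -(@ge0_integral_mscale _ _ R nu0 setT measurableT (NngNum c0')) //.
apply: eq_measure_integral => A mA _.
by rewrite /mscale /= /mscale /= muleC; apply/esym/lebesgue_measure_affine.
Qed.

Lemma polyhedron_affine P (b : I -> R) c : polyhedron P ->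
  polyhedron (fun v => P (fun k => b k + c * v k)).
Proof.
move=> [m [b' [c' ->]]]; exists m, (fun j => b' j + \sum_k c' j k * b k), (fun j k => c' j k * c).
have E v j : b' j + \sum_k c' j k * b k + \sum_i c' j i * c * v i =
    b' j + \sum_i c' j i * (b i + c * v i).
  rewrite -addrA -big_split /=; congr (_ + _); apply: eq_bigr => i _.
  by rewrite mulrDr mulrA.
by apply/seteqP; split => v /= H j; have := H j; rewrite E.
Qed.

Lemma lebesgue_on_affine r P z (b : I -> R) c : 0 < c -> polyhedron P ->
  lebesgue_on r P (fun k => b k + c * z k) =
  ((c ^+ size r)%:E * lebesgue_on r (fun v => P (fun k => (b k + c * v k)%R)) z)%E.
Proof.
move=> c0 polP; elim: r z => [|i r IH] z /=.
  by rewrite expr0 mul1e !indicE.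
pose f x := lebesgue_on r P (upd (fun k => b k + c * z k) i x).
rewrite (ge0_integral_affine (b i) c0); first last.
- by move=> x; exact: lebesgue_on_ge0.
- exact: measurable_lebesgue_on_upd.
under eq_integral => x _.
  have -> : upd (fun k => b k + c * z k) i (b i + c * x) = (fun k => b k + c * upd z i x k).
    by apply/funext => k; rewrite /upd; case: eqP => [->|].
  rewrite IH.
  over.
rewrite ge0_integralZl //; first last.
- by rewrite lee_fin exprn_ge0 // ltW.
- by move=> x _; exact: lebesgue_on_ge0.
- apply: measurable_lebesgue_on_upd; exact: polyhedron_affine.
by rewrite muleA -EFinM exprS.
Qed.

Lemma lebesgue_on_le r P z (C : R) : polyhedron P -> 0 <= C -> uniq r ->
  (forall v, (forall k, k \notin r -> v k = z k) -> P v -> forall i, i \in r -> `|v i| <= C) ->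
  (lebesgue_on r P z <= ((C *+ 2) ^+ size r)%:E)%E.
Proof.
move=> polP C0; elim: r z => [|i r IH] z /=.
  by rewrite expr0 lee_fin indicE; case: (_ \in _).
move=> /andP[ir ur] H.
have le1 x : (lebesgue_on r P (upd z i x) <= ((C *+ 2) ^+ size r)%:E * (\1_`[-C, C] x)%:E)%E.
  rewrite indicE; case: (boolP (x \in _)) => [_|].
    rewrite mule1; apply: IH => // v vz Pv k kr; apply: H; rewrite ?inE ?kr ?orbT //.
    by move=> j; rewrite inE negb_or => /andP[ji jr]; rewrite vz // /upd (negbTE ji).
  move=> /negP; rewrite inE /= in_itv /= -ler_norml => xC; rewrite mule0 le_eqVlt; apply/orP; left.
  apply/eqP.
  have : forall v, (forall k, k \notin r -> v k = upd z i x k) -> ~ P v.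
    move=> v vE Pv; apply: xC.
    have := H v _ Pv i (mem_head _ _); rewrite vE // /upd eqxx; apply.
    by move=> k; rewrite inE negb_or => /andP[ki kr]; rewrite vE // /upd (negbTE ki).
  elim: {IH ur H ir} r (upd z i x) => [|j r IH] v Hv /=.
    by rewrite indicE memNset //; apply: Hv => k.
  rewrite (eq_integral (cst 0%E)) ?integral0 // => y _; apply: IH => v' v'E.
  apply: Hv => k; rewrite inE negb_or => /andP[kj kr]; rewrite v'E // /upd (negbTE kj) //.
apply: le_trans (_ : \int[mu]_x (((C *+ 2) ^+ size r)%:E * (\1_`[-C, C] x)%:E) <= _)%E.
  apply: ge0_le_integral => //.
- by move=> x _; exact: lebesgue_on_ge0.
- exact: measurable_lebesgue_on_upd.
- by apply: measurable_funeM; apply/measurable_EFinP.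
rewrite ge0_integralZl //; first last.
- by rewrite lee_fin exprn_ge0 // mulrn_wge0.
- by apply/measurable_EFinP; exact: measurable_indic.
rewrite integral_indic // setIT -[X in (_ * X)%E]/(mu `[-C, C]%classic).
rewrite lebesgue_measure_itv /= lte_fin; case: ifP => _.
  by rewrite -EFinB -EFinM opprK exprSr mulr2n.
by rewrite mule0 lee_fin exprn_ge0 // mulrn_wge0.
Qed.

Lemma eq_lebesgue_on r P Q z :
  (forall v, (forall k, k \notin r -> v k = z k) -> P v <-> Q v) ->
  lebesgue_on r P z = lebesgue_on r Q z.
Proof.
elim: r z => [|i r IH] z PQ /=.
  have {}PQ : P z <-> Q z by apply: PQ.
  have e : (P : set _) z = Q z by apply/propext.
  by rewrite !indicE /in_mem /= /in_set e.
apply: eq_integral => x _; apply: IH => v vz; apply: PQ => k.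
by rewrite inE negb_or => /andP[ki kr]; rewrite vz // /upd (negbTE ki).
Qed.

Lemma polyhedronT : polyhedron [set: I -> R].
Proof.
exists 0%N, (fun=> 0), (fun _ _ => 0); apply/seteqP; split=> // v _ j /=.
by rewrite add0r sumr_ge0 // => i _; rewrite mul0r.
Qed.

Lemma polyhedron_halfspace (b : R) (c : I -> R) :
  polyhedron [set v | 0 <= b + \sum_i c i * v i].
Proof.
exists 1%N, (fun=> b), (fun=> c); apply/seteqP; split=> v /=; first by [].
by move=> /(_ ord0).
Qed.

Lemma polyhedronI P Q : polyhedron P -> polyhedron Q -> polyhedron (P `&` Q).
Proof.
move=> [m [b [c ->]]] [m' [b' [c' ->]]].
exists (m + m')%N, (fun j => match fintype.split j with inl k => b k | inr k => b' k end),
  (fun j => match fintype.split j with inl k => c k | inr k => c' k end).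
apply/seteqP; split=> v /=.
  by move=> [h h'] j; case: (fintype.split j) => k.
move=> h; split=> j.
  by have := h (lshift m' j); rewrite (unsplitK (inl j)).
by have := h (rshift m j); rewrite (unsplitK (inr j)).
Qed.

Lemma polyhedron_all r (P : I -> set (I -> R)) : (forall j, polyhedron (P j)) ->
  polyhedron [set v | forall j, j \in r -> P j v].
Proof.
move=> polP; elim: r => [|i r IH].
  have -> : [set v | forall j, j \in [::] -> P j v] = setT by apply/seteqP; split.
  exact: polyhedronT.
have -> : [set v | forall j, j \in i :: r -> P j v] =
    P i `&` [set v | forall j, j \in r -> P j v].
  apply/seteqP; split=> v /= => [h|[h1 h2] j].
    by split=> [|j jr]; apply: h; rewrite inE ?eqxx ?jr ?orbT.
  by rewrite inE => /orP[/eqP->//|]; exact: h2.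
exact: polyhedronI.
Qed.

Fixpoint overwrite r z : 'rV[R]_(size r) -> I -> R :=
  match r with
  | [::] => fun=> z
  | i :: r' => fun y => overwrite (upd z i (y ord0 ord0)) (@rsubmx R 1 1 (size r') y)
  end.

Lemma lebesgueRn_lebesgue_on r P z :
  lebesgueRn [set y | P (@overwrite r z y)] = lebesgue_on r P z.
Proof.
elim: r z => [|i r IH] z /=; first by rewrite !indicE.
apply: eq_integral => x _; rewrite -IH.
congr lebesgueRn; apply/funext => y /=.
have -> : (row_mx x%:M y : 'rV_(1 + size r)) ord0 ord0 = x.
  by rewrite mxE; case: splitP => // j _; rewrite mxE (ord1 j) mulr1n.
by rewrite row_mxKr.
Qed.

Lemma overwrite_notin r z (y : 'rV[R]_(size r)) i : i \notin r -> overwrite z y i = z i.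
Proof.
elim: r z y => //= k r IH z y; rewrite inE negb_or => /andP[ik ir].
by rewrite IH // /upd (negbTE ik).
Qed.

Lemma overwrite_nth r z (y : 'rV[R]_(size r)) i0 (j : 'I_(size r)) : uniq r ->
  overwrite z y (nth i0 r j) = y ord0 j.
Proof.
elim: r z y j => [|k r IH] z y j /=; first by case: j.
move=> /andP[kr ur]; case: j => -[|j] jr /=.
  by rewrite overwrite_notin // /upd eqxx; congr (y _ _); apply/val_inj.
rewrite (IH _ _ (Ordinal (jr : (j < size r)%N))) // mxE.
by congr (y _ _); apply/val_inj.
Qed.

End LebesgueOn.

(** * Dual bases and cubical values of a simplicial cone *)

Section Simplex.
Variables (R : realType) (n : nat) (I : finType) (F : fan_data R n I).
Variable ip : {dot 'rV[R]_n for idfun}.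
Implicit Types (s t : {set I}) (z : I -> R) (v : 'rV[R]_n).
Local Notation u := (mark F).

Lemma ipC v v' : ip v v' = ip v' v.
Proof. by have := hermC ip v v'; rewrite /= expr0 mul1r. Qed.

Lemma ipDl v1 v2 v : ip (v1 + v2) v = ip v1 v + ip v2 v.
Proof. exact: linearDl. Qed.

Lemma ipZl a v1 v : ip (a *: v1) v = a * ip v1 v.
Proof. exact: linearZl_LR. Qed.

Lemma ip0l v : ip 0 v = 0.
Proof. exact: linear0l. Qed.

Lemma ipBl v1 v2 v : ip (v1 - v2) v = ip v1 v - ip v2 v.
Proof. by rewrite ipDl -scaleN1r ipZl mulN1r. Qed.

Lemma ipDr v v1 v2 : ip v (v1 + v2) = ip v v1 + ip v v2.
Proof. by rewrite ipC ipDl !(ipC v). Qed.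

Lemma ipZr a v1 v : ip v (a *: v1) = a * ip v v1.
Proof. by rewrite ipC ipZl ipC. Qed.

Lemma ip0r v : ip v 0 = 0.
Proof. by rewrite ipC ip0l. Qed.

Lemma ipBr v v1 v2 : ip v (v1 - v2) = ip v v1 - ip v v2.
Proof. by rewrite ipC ipBl !(ipC v). Qed.

Lemma ip_suml (P : pred I) (f : I -> 'rV[R]_n) v :
  ip (\sum_(i | P i) f i) v = \sum_(i | P i) ip (f i) v.
Proof. by apply: (big_morph (ip ^~ v)) => [x y|]; rewrite ?ipDl ?ip0l. Qed.

Lemma ip_sumr (P : pred I) (f : I -> 'rV[R]_n) v :
  ip v (\sum_(i | P i) f i) = \sum_(i | P i) ip v (f i).
Proof. by rewrite ipC ip_suml; apply: eq_bigr => i _; rewrite ipC. Qed.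

Lemma ip_gt0 v : v != 0 -> 0 < ip v v.
Proof. exact: neq0_dnorm_gt0. Qed.

Lemma ip_ge0 v : 0 <= ip v v.
Proof. by have [->|/ip_gt0/ltW//] := eqVneq v 0; rewrite ip0l. Qed.

Lemma ip_eq0 v : (ip v v == 0) = (v == 0).
Proof.
by apply/eqP/eqP => [|->]; [apply: contra_eq => /ip_gt0/gt_eqF-> | rewrite ip0l].
Qed.

Lemma cspanP s v : reflect (exists a : I -> R, v = \sum_(i in s) a i *: u i)
  (v \in cspan F s).
Proof.
have -> : cspan F s = (\sum_(i in s) <[u i]>)%VS.
  by rewrite /cspan span_def big_map big_enum.
apply: (iffP memv_sumP) => [[vs vsP ->]|[a ->]].
  have H i : exists a, i \in s -> vs i = a *: u i.
    by case: (boolP (i \in s)) => [/vsP/vlineP[a ->]|_]; [exists a|exists 0].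
  have [a aP] := choice H; exists a.
  by apply: eq_bigr => i /aP.
by exists (fun i => a i *: u i) => // i _; apply/vlineP; exists (a i).
Qed.

Lemma mem_cspan s i : i \in s -> u i \in cspan F s.
Proof. by move=> si; apply: memv_span; apply/fintype.imageP; exists i. Qed.

Lemma cspanS s t : s \subset t -> {subset cspan F s <= cspan F t}.
Proof.
move=> st v /cspanP[a ->]; apply: memv_suml => i si.
by apply/memvZ/mem_cspan/(fintype.subsetP st).
Qed.

Lemma cspan_orth s v v' : (forall i, i \in s -> ip v (u i) = 0) ->
  v' \in cspan F s -> ip v v' = 0.
Proof.
move=> vs /cspanP[a ->]; rewrite ip_sumr big1 // => i si.
by rewrite ipZr vs // mulr0.
Qed.

Lemma orth_decomp (X : seq 'rV[R]_n) v : exists2 p, p \in <<X>>%VS &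
  forall x, x \in <<X>>%VS -> ip (v - p) x = 0.
Proof.
elim: X v => [|x X IH] v.
  exists 0; first exact: mem0v.
  by move=> x; rewrite span_nil memv0 => /eqP->; rewrite ip0r.
have [px pxX pxP] := IH x; have [pv pvX pvP] := IH v.
set x' := x - px in pxP.
have sX y : y \in <<X>>%VS -> y \in <<x :: X>>%VS.
  by apply/subvP; apply: sub_span => y'; rewrite inE => ->; rewrite orbT.
have x'X : x' \in <<x :: X>>%VS.
  by apply: memvB; [apply: memv_span; rewrite mem_head | exact: sX].
exists (pv + (ip v x' / ip x' x') *: x').
  by apply: memvD; [exact: sX | exact: memvZ].
have H0 : ip (v - (pv + (ip v x' / ip x' x') *: x')) x' = 0.
  rewrite opprD addrA ipBl ipBl ipZl (ipC pv) pxP // subr0.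
  have [->|x'0] := eqVneq x' 0; first by rewrite !ip0r mulr0 subr0.
  by rewrite divfK ?subrr // ip_eq0.
have HX y : y \in <<X>>%VS -> ip (v - (pv + (ip v x' / ip x' x') *: x')) y = 0.
  by move=> yX; rewrite opprD addrA ipBl pvP // ipZl (pxP y) // mulr0 subr0.
move=> y; rewrite span_cons => /memv_addP[_ /vlineP[k ->]] [y' y'X ->].
rewrite ipDr (HX y') // addr0 ipZr -(subrK px x) ipDr (HX px) // addr0.
by rewrite -/x' H0 mulr0.
Qed.

Lemma orthov_cap s : (orthov ip (cspan F s) :&: cspan F s = 0)%VS.
Proof.
apply/eqP; rewrite -subv0; apply/subvP => v; rewrite memv_cap memv0.
by move=> /andP[/mem_orthovP vs /vs]; move/eqP; rewrite ip_eq0.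
Qed.

Lemma orthov_add s v : v \in (orthov ip (cspan F s) + cspan F s)%VS.
Proof.
have [p ps pP] := orth_decomp [seq u i | i in s] v.
rewrite -(subrK p v); apply: memv_add => //.
by apply/mem_orthovP => x xs; exact: pP.
Qed.

Lemma pr_orth s v v' : v' \in cspan F s -> ip (pr F ip s v) v' = 0.
Proof. exact: (mem_orthovP (memv_pi _ _ _)). Qed.

Lemma pr_sub s v : v - pr F ip s v \in cspan F s.
Proof.
rewrite -{1}(daddv_pi_add (orthov_cap s) (orthov_add s v)) addrC addKr.
exact: memv_pi.
Qed.

Lemma pr_uniq s v p : (forall i, i \in s -> ip p (u i) = 0) ->
  v - p \in cspan F s -> pr F ip s v = p.
Proof.
move=> p1 p2; apply/eqP; rewrite -subr_eq0 -ip_eq0; apply/eqP.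
have : pr F ip s v - p \in cspan F s.
  have -> : pr F ip s v - p = (v - p) - (v - pr F ip s v).
    by rewrite opprB [RHS]addrC addrA subrK.
  by rewrite memvB // pr_sub.
by move=> h; rewrite ipBl pr_orth // (cspan_orth p1) // subr0.
Qed.

Definition indep s := forall a : I -> R,
  \sum_(i in s) a i *: u i = 0 -> forall i, i \in s -> a i = 0.

Lemma indep_cdim s : cdim F s = #|s| -> indep s.
Proof.
move=> ds a a0 i si; apply/eqP; apply: contraT => ai.
have : (cspan F s <= cspan F (s :\ i))%VS.
  apply/span_subvP => _ /fintype.imageP[j sj ->].
  have [->{j sj}|ji] := eqVneq j i; last by rewrite mem_cspan // !inE ji.
  have -> : u i = - (a i)^-1 *: \sum_(j in s :\ i) a j *: u j.
    move: a0; rewrite (big_setD1 i) //= => /eqP; rewrite addr_eq0 => /eqP e.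
    by rewrite scaleNr -scalerN -e scalerA mulVf // scale1r.
  apply: memvZ; apply: memv_suml => j jsi; apply: memvZ.
  exact: mem_cspan.
move=> /dimvS; rewrite -[X in (X <= _)%N]/(cdim F s) ds.
move=> /leq_trans/(_ (dim_span _)); rewrite size_map -cardE.
by rewrite (cardsD1 i s) si ltnn.
Qed.

Lemma indepS s t : t \subset s -> indep s -> indep t.
Proof.
move=> ts si a a0 i ti.
have := si (fun j => if j \in t then a j else 0) _ i (fintype.subsetP ts i ti).
rewrite ti; apply; rewrite -[RHS]a0 [LHS](big_setID t) /= (finset.setIidPr ts).
rewrite [X in _ + X]big1 => [|j]; last by rewrite inE => /andP[/negbTE-> _]; rewrite scale0r.
by rewrite addr0; apply: eq_bigr => j ->.
Qed.

(* The basis of the span of [s] dual to (u_i)_{i in s}: the component of u_i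
   orthogonal to the other generators, normalized. *)
Definition dual s i : 'rV[R]_n :=
  (ip (pr F ip (s :\ i) (u i)) (u i))^-1 *: pr F ip (s :\ i) (u i).

Lemma pr_ip s v : ip (pr F ip s v) v = ip (pr F ip s v) (pr F ip s v).
Proof.
apply/eqP; rewrite -subr_eq0 -ipBr; apply/eqP/pr_orth; exact: pr_sub.
Qed.

Lemma pr_neq0 s i : indep (i |: s) -> i \notin s -> pr F ip s (u i) != 0.
Proof.
move=> si nsi; apply/eqP => p0.
have := pr_sub s (u i); rewrite p0 subr0 => /cspanP[a ua].
have := si (fun j => if j == i then 1 else - a j) _ i (setU11 _ _).
rewrite eqxx => h; have /eqP := oner_eq0 R; apply; apply: h.
rewrite big_setU1 //= eqxx scale1r ua -big_split big1 // => j js /=.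
case: eqP => [ji|_]; first by rewrite -ji js in nsi.
by rewrite scaleNr subrr.
Qed.

Lemma dualE s i j : indep s -> i \in s -> j \in s -> ip (dual s i) (u j) = (i == j)%:R.
Proof.
move=> si is_ js; rewrite /dual ipZl.
have [<-|ij] := eqVneq i j.
  rewrite mulVf // pr_ip ip_eq0 pr_neq0 ?finset.setD1K // ?inE ?eqxx //.
have -> : ip (pr F ip (s :\ i) (u i)) (u j) = 0; last by rewrite mulr0.
apply/pr_orth/mem_cspan; by rewrite !inE eq_sym ij.
Qed.

Lemma dual_cspan s i : i \in s -> dual s i \in cspan F s.
Proof.
move=> is_; apply: memvZ.
rewrite -(memvN _ (pr _ _ _ _)) -(addKr (u i) (- _)) memvD ?memvN ?mem_cspan //.
by apply: (cspanS (finset.subsetDl _ [set i])); exact: pr_sub.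
Qed.

Lemma coordE s (a : I -> R) i : indep s -> i \in s ->
  ip (\sum_(j in s) a j *: u j) (dual s i) = a i.
Proof.
move=> si is_; rewrite ip_suml (bigD1 i) //= ipZl ipC dualE // eqxx mulr1.
rewrite big1 ?addr0 // => j /andP[js ji].
by rewrite ipZl ipC dualE // eq_sym (negbTE ji) mulr0.
Qed.

Lemma coordP s v : indep s -> v \in cspan F s ->
  v = \sum_(i in s) ip v (dual s i) *: u i.
Proof.
by move=> si /cspanP[a ->]; apply: eq_bigr => i is_; rewrite coordE.
Qed.

Lemma cspan_inj s v v' : v \in cspan F s -> v' \in cspan F s ->
  (forall i, i \in s -> ip v (u i) = ip v' (u i)) -> v = v'.
Proof.
move=> vs v's e; apply/eqP; rewrite -subr_eq0 -ip_eq0; apply/eqP.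
apply: (@cspan_orth s); last exact: memvB.
by move=> i is_; rewrite ipBl e // subrr.
Qed.

Lemma sum_dualE s z i : indep s -> i \in s ->
  ip (\sum_(j in s) z j *: dual s j) (u i) = z i.
Proof.
move=> si is_; rewrite ip_suml (bigD1 i) //= ipZl dualE // eqxx mulr1.
rewrite big1 ?addr0 // => j /andP[js ji].
by rewrite ipZl dualE // (negbTE ji) mulr0.
Qed.

Lemma cubvecE s z : indep s -> cubvec F ip z s = \sum_(i in s) z i *: dual s i.
Proof.
move=> si; rewrite /cubvec; case: xgetP => [w _ [ws wz]|/(_ (\sum_(i in s) z i *: dual s i))].
  apply: (@cspan_inj s) => //; first by apply: memv_suml => i is_; apply/memvZ/dual_cspan.
  by move=> i is_; rewrite wz // sum_dualE.
case; split; first by apply: memv_suml => i is_; apply/memvZ/dual_cspan.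
by move=> i is_; rewrite sum_dualE.
Qed.

Lemma cubvec_cspan s z : indep s -> cubvec F ip z s \in cspan F s.
Proof.
by move=> si; rewrite cubvecE //; apply: memv_suml => i is_; apply/memvZ/dual_cspan.
Qed.

Lemma cubvec_ip s z i : indep s -> i \in s -> ip (cubvec F ip z s) (u i) = z i.
Proof. by move=> si is_; rewrite cubvecE // sum_dualE. Qed.

Lemma cubvec_uniq s z v : indep s -> v \in cspan F s ->
  (forall i, i \in s -> ip v (u i) = z i) -> cubvec F ip z s = v.
Proof.
move=> si vs vz; apply: (@cspan_inj s) => //; first exact: cubvec_cspan.
by move=> i is_; rewrite cubvec_ip // vz.
Qed.

Lemma coneP s v : indep s ->
  cone F s v <-> v \in cspan F s /\ forall i, i \in s -> 0 <= ip v (dual s i).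
Proof.
move=> si; split => [[a [a0 ->]]|[vs v0]].
  by split=> [|i is_]; [apply/cspanP; exists a | rewrite coordE].
exists (fun i => if i \in s then ip v (dual s i) else 0); split.
  by move=> i; case: ifP => // /v0.
by rewrite {1}(coordP si vs); apply: eq_bigr => i ->.
Qed.

Lemma ip_continuous v : continuous (fun x : 'rV[R]_n => ip x v).
Proof.
have -> : (fun x : 'rV[R]_n => ip x v) = (fun x : 'rV[R]_n => \sum_(j < n) x ord0 j * ip (delta_mx ord0 j) v).
  apply/funext => x; rewrite {1}(row_sum_delta x).
  by rewrite (big_morph (ip ^~ v) (id1 := 0) (op1 := +%R)) => [|y y'|]; rewrite ?ipDl ?ip0l //;
    apply: eq_bigr => j _; rewrite ipZl.
apply: (@continuous_big R _ +%R 0 xpredT); first exact: add_continuous.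
move=> j _ x.
  apply: (@continuousM R _ (fun x0 : 'rV[R]_n => x0 ord0 j) (cst (ip (delta_mx ord0 j) v))); first exact: coord_continuous.
exact: cst_continuous.
Qed.

Lemma relintP s v : indep s ->
  relint F s v <-> v \in cspan F s /\ forall i, i \in s -> 0 < ip v (dual s i).
Proof.
move=> si; split=> [[/(coneP _ si)[vs v0] nv]|[vs v0]].
  split=> // i is_.
  have cv : (v - e *: u i) @[e --> (0 : R)^'+] --> v.
    rewrite -[X in _ --> X]subr0 -(scale0r (u i)); apply: cvg_at_right_filter.
    by apply: cvgB; [exact: cvg_cst | apply: cvgZr_tmp; exact: cvg_id].
  have : \forall e \near (0 : R)^'+, 0 < e /\ cone F s (v - e *: u i).
    near=> e; split; first by near: e; exact: nbhs_right_gt.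
    suff : v - e *: u i \in cspan F s -> cone F s (v - e *: u i).
      by apply; rewrite memvB // memvZ // mem_cspan.
    by near: e; exact: (cv _ nv).
  move=> /filter_ex[e [e0 /(coneP _ si)[_ /(_ _ is_)]]].
  by rewrite ipBl ipZl (ipC (u i)) dualE // eqxx mulr1 subr_ge0; exact: lt_le_trans.
split; first by apply/coneP => //; split=> // i /v0/ltW.
near=> x => xs; apply/coneP => //; split=> //.
near: x; apply: filter_forall => i.
have [is_|_] := boolP (i \in s); last by near=> x.
have H : \forall x \near nbhs v, 0 < ip x (dual s i).
  exact: (@ip_continuous (dual s i) v _ (lt_nbhsr (v0 i is_))).
by near=> x => _; apply/ltW; near: x; exact: H.
Unshelve. all: by end_near. Qed.

(* The value at the ray [i] that [z] induces on the star of [t]. *)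
Definition ell t i z := z i - ip (cubvec F ip z t) (u i).

Lemma cubvecU t i z : indep (i |: t) -> i \notin t ->
  cubvec F ip z (i |: t) = cubvec F ip z t + ell t i z *: dual (i |: t) i.
Proof.
move=> ii nti; have ti : indep t by apply: indepS ii; exact: finset.subsetUr.
apply: cubvec_uniq => //.
  apply: memvD; first by apply: (cspanS (finset.subsetUr _ t)); exact: cubvec_cspan.
  by apply/memvZ/dual_cspan; rewrite setU11.
move=> j jit; rewrite ipDl ipZl dualE ?setU11 //.
have [->|ij] := eqVneq i j; first by rewrite mulr1 /ell addrC subrK.
rewrite mulr0 addr0 cubvec_ip //; move: jit; rewrite !inE => /orP[/eqP ji|//].
by rewrite ji eqxx in ij.
Qed.

Lemma ellU t i j z : indep (i |: t) -> i \notin t ->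
  ell (i |: t) j z = ell t j z - ell t i z * ip (dual (i |: t) i) (u j).
Proof.
by move=> ii nti; rewrite /ell cubvecU // ipDl ipZl opprD addrA.
Qed.

Lemma cubvecD t a b z1 z2 : indep t ->
  cubvec F ip (fun i => a * z1 i + b * z2 i) t = a *: cubvec F ip z1 t + b *: cubvec F ip z2 t.
Proof.
move=> ti; rewrite !cubvecE // !scaler_sumr -big_split /=; apply: eq_bigr => i _.
by rewrite scalerDl !scalerA.
Qed.

Lemma ellD t i a b z1 z2 : indep t ->
  ell t i (fun i => a * z1 i + b * z2 i) = a * ell t i z1 + b * ell t i z2.
Proof.
by move=> ti; rewrite /ell cubvecD // ipDl !ipZl; ring.
Qed.

(* [dual t i] reads the u_i-coordinate, so this says that w_{t,*}(z) lies in
   the relative interior of [cone F t] for every face [t] of [s]. *)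
Definition cubical s z := forall t i, t \subset s -> i \in t ->
  0 < ip (cubvec F ip z t) (dual t i).

Lemma dual_neq0 s i : indep s -> i \in s -> dual s i != 0.
Proof.
move=> si is_; apply/eqP => d0; have := dualE si is_ is_.
by rewrite d0 ip0l eqxx => /eqP; rewrite eq_sym oner_eq0.
Qed.

Lemma ell_gt0 s t i z : indep s -> cubical s z -> i |: t \subset s -> i \notin t ->
  0 < ell t i z.
Proof.
move=> si cz its nti; have ii := indepS its si.
have := cz _ i its (setU11 _ _); rewrite cubvecU // ipDl ipZl.
rewrite (ipC (cubvec _ _ _ _)) (@cspan_orth t) ?add0r; first last.
- by apply/cubvec_cspan/indepS/ii/finset.subsetUr.
- move=> j tj; rewrite dualE ?setU11 ?inE ?tj ?orbT //.
  by case: eqP nti => // ->; rewrite tj.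
by rewrite pmulr_lgt0 // ip_gt0 // dual_neq0 ?setU11.
Qed.


(* Ray shooting from the vertex [cubvec t] through [v] reaches a smaller face. *)
Lemma cubvec_hull t (k : {set I}) z v : (forall i, i \in t -> i \notin k) -> indep (t :|: k) ->
  v \in cspan F (t :|: k) ->
  (forall i, i \in t -> ip v (u i) = z i) ->
  (forall i, i \in k -> ip v (u i) <= z i) ->
  (forall i, i \in k -> 0 <= ip v (dual (t :|: k) i)) ->
  exists l : {set I} -> R,
    [/\ forall t', 0 <= l t', \sum_t' l t' = 1,
     forall t', l t' != 0 -> t \subset t' /\ t' \subset t :|: k &
     v = \sum_t' l t' *: cubvec F ip z t'].
Proof.
elim: {k}#|k| {-2}k (erefl #|k|) t v => [|m IH] k km t v dtk itk vs vt vk v0.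
  move/eqP: km; rewrite cards_eq0 => /eqP k0; rewrite k0 finset.setU0 in itk vs *.
  exists (fun t' => (t' == t)%:R); split=> [t'|||].
  - by case: (_ == _).
  - by rewrite (bigD1 t) //= eqxx big1 ?addr0 // => t' /negbTE->.
  - by move=> t'; have [->|_] := eqVneq t' t; rewrite /= ?eqxx.
  - rewrite (bigD1 t) //= eqxx scale1r big1 ?addr0 => [|t' /negbTE->]; last by rewrite scale0r.
    exact/esym/cubvec_uniq.
have ti : indep t by apply: indepS itk; exact: finset.subsetUl.
set w := cubvec F ip z t.
have wt : w \in cspan F (t :|: k) by apply: (cspanS (finset.subsetUl t k)); exact: cubvec_cspan.
have [vw|vw] := eqVneq v w.
  exists (fun t' => (t' == t)%:R); split=> [t'|||].
  - by case: (_ == _).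
  - by rewrite (bigD1 t) //= eqxx big1 ?addr0 // => t' /negbTE->.
  - by move=> t'; have [->|_] := eqVneq t' t; rewrite /= ?eqxx // finset.subsetUl.
  - by rewrite (bigD1 t) //= eqxx scale1r big1 ?addr0 => [//|t' /negbTE->]; rewrite scale0r.
pose y := v - w.
have yt i : i \in t -> ip y (u i) = 0 by move=> it_; rewrite ipBl vt // cubvec_ip // subrr.
have ys : y \in cspan F (t :|: k) by exact: memvB.
have w0 i : i \in k -> ip w (dual (t :|: k) i) = 0.
  move=> ik; rewrite ipC; apply: (@cspan_orth t); last exact: cubvec_cspan.
  move=> j jt; rewrite dualE ?inE ?ik ?jt ?orbT //.
  by case: eqP ik => // -> jk; rewrite (negbTE (dtk j jt)) in jk.
have y0 i : i \in k -> ip y (dual (t :|: k) i) = ip v (dual (t :|: k) i).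
  by move=> ik; rewrite ipBl w0 // subr0.
have yy : ip y y = \sum_(i in k) ip v (dual (t :|: k) i) * ip y (u i).
  rewrite {2}(coordP itk ys) ip_sumr.
  rewrite (bigID (mem t)) /= big1 ?add0r => [|i /andP[_ it_]]; last by rewrite ipZr yt // mulr0.
  apply: eq_big => [i|i]; rewrite !inE; last first.
    by move=> /andP[/orP[-> //|ik] _]; rewrite ipZr y0.
  by case: (boolP (i \in t)) => [/dtk/negbTE->|]; rewrite ?andbF ?andbT.
have [k1 k1k k1P] : exists2 i, i \in k & 0 < ip y (u i).
  apply/exists_inP; apply: contraT; rewrite negb_exists_in => /forall_inP h.
  have : ip y y <= 0.
    rewrite yy; apply: sumr_le0 => i ik; rewrite mulr_ge0_le0 ?v0 //.
    by rewrite leNgt h.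
  by rewrite leNgt ip_gt0 // subr_eq0.
pose q i := (z i - ip w (u i)) / ip y (u i).
pose K := [pred i | (i \in k) && (0 < ip y (u i))].
have Kk1 : K k1 by rewrite /K /= k1k.
case: (arg_minP q Kk1) => i0 /andP[i0k i0y] i0min.
set c := q i0 in i0min.
have c1 : 1 <= c by rewrite /c /q ler_pdivlMr // mul1r ipBl lerD2r vk.
have c0 : 0 < c by exact: lt_le_trans c1.
pose v' := w + c *: y.
have ti0k : i0 |: t :|: k :\ i0 = t :|: k.
  apply/setP => j; rewrite !inE; have [->|_] := eqVneq j i0; rewrite ?i0k ?orbT //.
have [l [l0 l1 lt lv]] : exists l : {set I} -> R,
    [/\ forall t', 0 <= l t', \sum_t' l t' = 1,
     forall t', l t' != 0 -> i0 |: t \subset t' /\ t' \subset (i0 |: t) :|: k :\ i0 &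
     v' = \sum_t' l t' *: cubvec F ip z t'].
  apply: IH.
  - by move: km; rewrite (cardsD1 i0) i0k => -[].
  - by move=> j; rewrite !inE => /orP[->//|/dtk/negbTE ->]; rewrite andbF.
  - by rewrite ti0k.
  - by rewrite ti0k memvD // memvZ.
  - move=> i; rewrite !inE ipDl ipZl => /orP[/eqP->|it_].
      by rewrite /c /q divfK ?gt_eqF // addrC subrK.
    by rewrite yt // mulr0 addr0 cubvec_ip.
  - move=> i; rewrite !inE ipDl ipZl => /andP[_ ik].
    have [yi|yi] := ltP 0 (ip y (u i)).
      have := i0min i; rewrite /K /= ik yi => /(_ isT).
      by rewrite {1}/q ler_pdivlMr // lerBrDl.
    have wv : ip w (u i) = ip v (u i) - ip y (u i) by rewrite ipBl subKr.
    rewrite wv -addrA; apply: (le_trans _ (vk _ ik)).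
    rewrite gerDl -mulN1r -mulrDl mulr_ge0_le0 // addrC subr_ge0 //.
  - move=> i; rewrite ti0k !inE ipDl ipZl => /andP[_ ik].
    by rewrite w0 // y0 // add0r mulr_ge0 ?v0 // ltW.
exists (fun t' => c^-1 * l t' + (1 - c^-1) * (t' == t)%:R); split.
- move=> t'; apply: addr_ge0; apply: mulr_ge0 => //; first by rewrite invr_ge0 ltW.
  by rewrite subr_ge0 invf_le1.
- rewrite big_split /= -!mulr_sumr l1 mulr1 (bigD1 t) //= eqxx big1 ?addr0 => [|? /negbTE->//].
  by rewrite mulr1 addrC subrK.
- move=> t'; have [->|tt'] := eqVneq t' t; first by rewrite subxx finset.subsetUl.
  rewrite mulr0 addr0 mulf_eq0 negb_or => /andP[_ /lt[h1 h2]].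
  rewrite -ti0k h2; split=> //; apply: fintype.subset_trans h1; exact: finset.subsetUr.
- under eq_bigr do rewrite scalerDl -!scalerA.
  rewrite big_split /= -!scaler_sumr -lv (bigD1 t) //= eqxx scale1r big1 => [|? /negbTE->]; last by rewrite scale0r.
  rewrite addr0 -/w scalerDr scalerA mulVf ?gt_eqF // scale1r scalerBl scale1r.
  by rewrite (addrC _ y) [w - _]addrC addrA addrK /y subrK.
Qed.

End Simplex.

(** * Mixed volumes of normal complexes *)

Section MixedVolume.
Variables (R : realType) (n : nat) (I : finType) (F : fan_data R n I).
Variable ip : {dot 'rV[R]_n for idfun}.
Implicit Types (s t : {set I}) (z : I -> R).
Local Notation ell := (ell F ip).
Local Notation dual := (dual F ip).

(* The mixed volume of the star of [t] at the values induced by [zs]: a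
   polytope of the normal complex is the union of the pyramids with apex 0 over
   its facets, which are polytopes of the stars of the rays. *)
Fixpoint cmv (C : {set {set I}}) (wt : {set I} -> R) t (zs : seq (I -> R)) : R :=
  match zs with
  | [::] => wt t
  | z :: zs' => \sum_(i | (i \notin t) && (i |: t \in C)) ell t i z * cmv C wt (i |: t) zs'
  end.

Variables (C : {set {set I}}) (wt : {set I} -> R).
Hypothesis C_sub : forall s t, s \in C -> t \subset s -> t \in C.
Hypothesis C_indep : forall s, s \in C -> indep F s.
Local Notation mv := (cmv C wt).

Lemma mvD t a b z1 z2 zs : t \in C ->
  mv t ((fun i => a * z1 i + b * z2 i) :: zs) = a * mv t (z1 :: zs) + b * mv t (z2 :: zs).
Proof.
move=> tC /=; rewrite !mulr_sumr -big_split /=; apply: eq_bigr => i _.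
by rewrite ellD; [ring | exact: C_indep].
Qed.

Lemma mv_swap t x y zs : mv t (x :: y :: zs) = mv t (y :: x :: zs).
Proof.
have H x' y' : mv t (x' :: y' :: zs) =
   \sum_i \sum_j
      (if [&& i \notin t, j \notin t, i != j & i |: (j |: t) \in C] then
        ell t i x' * (ell t j y' - ell t i y' * ip (dual (i |: t) i) (mark F j)) * mv (j |: (i |: t)) zs
       else 0).
  rewrite /= big_mkcond /=; apply: eq_bigr => i _.
  case: (boolP (i \notin t)) => [nit|_] /=; last by rewrite big1.
  case: ifP => itC; last first.
    rewrite big1 // => j _; case: ifP => // /and3P[_ _ ijtC].
    by rewrite (C_sub ijtC) // in itC; apply: finset.setUS; exact: finset.subsetUr.
  rewrite mulr_sumr big_mkcond /=; apply: eq_bigr => j _.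
  rewrite finset.setUCA !inE negb_or (eq_sym j i).
  case: (i == j); case: (j \in t) => //=; case: ifP => // _.
  by rewrite ellU ?mulrA //; exact: C_indep.
pose c i j := [&& i \notin t, j \notin t, i != j & i |: (j |: t) \in C].
pose S x' y' := \sum_i \sum_j (if c i j then
  ell t i x' * ell t j y' * mv (j |: (i |: t)) zs else 0).
pose D x' y' := \sum_i \sum_j (if c i j then
  ell t i x' * ell t i y' * ip (dual (i |: t) i) (mark F j) * mv (j |: (i |: t)) zs else 0).
have HSD x' y' : mv t (x' :: y' :: zs) = S x' y' - D x' y'.
  rewrite H -sumrB; apply: eq_bigr => i _; rewrite -sumrB; apply: eq_bigr => j _.
  by rewrite /c; case: ifP => _; ring.
rewrite !HSD; congr (_ - _); last first.
  by apply: eq_bigr => i _; apply: eq_bigr => j _; rewrite (mulrC (ell t i x)).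
rewrite /S exchange_big /=; apply: eq_bigr => i _; apply: eq_bigr => j _.
rewrite /c finset.setUCA (eq_sym j i) [in RHS]finset.setUCA.
case: (i \notin t); case: (j \notin t) => //=; case: (i != j) => //=.
by rewrite (finset.setUCA [set i]) (mulrC (ell t j x)).
Qed.

Lemma mv_swap_cat t xs x y zs : mv t (xs ++ x :: y :: zs) = mv t (xs ++ y :: x :: zs).
Proof.
elim: xs t => [|x' xs IH] t; first exact: mv_swap.
by rewrite /=; apply: eq_bigr => i _; rewrite IH.
Qed.

Lemma mv_gt0 d t zs :
  (forall s, s \in C -> #|s| = d -> 0 < wt s) ->
  (forall s, s \in C -> (#|s| < d)%N -> exists i, (i \notin s) && (i |: s \in C)) ->
  (forall s i z, z \in zs -> i |: s \in C -> i \notin s -> 0 < ell s i z) ->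
  t \in C -> (#|t| + size zs)%N = d -> 0 < mv t zs.
Proof.
move=> wt0 ext; elim: zs t => [|z zs IH] t ell0 tC.
  by rewrite addn0 => td; exact: wt0.
move=> td /=; have [i it] : exists i, (i \notin t) && (i |: t \in C).
  by apply: ext => //; rewrite -td /= addnS ltnS leq_addr.
have H j : (j \notin t) && (j |: t \in C) -> 0 < ell t j z * mv (j |: t) zs.
  move=> /andP[njt jtC]; rewrite mulr_gt0 ?ell0 ?mem_head // IH //.
    by move=> s i' z' z'zs; apply: ell0; rewrite inE z'zs orbT.
  by rewrite cardsU1 njt add1n addSnnS.
rewrite (bigD1 i) //= ltr_pwDl ?H // sumr_ge0 // => j /andP[jt _].
by rewrite ltW // H.
Qed.

Lemma mv_ind t i zs : indep F t -> i \notin t -> i |: t \in C ->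
  mv t ((fun k => (k == i)%:R) :: zs) = mv (i |: t) zs.
Proof.
move=> ti nit itC; have H j : j \notin t -> ell t j (fun k => (k == i)%:R) = (j == i)%:R.
  move=> njt; rewrite /ell cubvecE // big1 ?ip0l ?subr0 // => k kt.
  by case: eqP kt nit => [-> ->//|_ _ _]; rewrite scale0r.
rewrite /= (bigD1 i) ?nit //= H // eqxx mul1r big1 ?addr0 // => j /andP[/andP[njt _] ji].
by rewrite H // (negbTE ji) mul0r.
Qed.

Lemma mv_scale t z z' c k :
  (forall t' j, t \subset t' -> j |: t' \in C -> ell t' j z' = c * ell t' j z) ->
  mv t (nseq k z') = c ^+ k * mv t (nseq k z).
Proof.
elim: k t => [|k IH] t H /=; first by rewrite expr0 mul1r.
rewrite exprS mulr_sumr; apply: eq_bigr => i /andP[_ itC].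
rewrite H // IH; first by ring.
by move=> t' j itt'; apply: H; apply: fintype.subset_trans itt'; exact: finset.subsetUr.
Qed.

Definition line z e (x : R) : I -> R := fun i => 1 * z i + x * e i.

Lemma mv_line t z e k : t \in C -> exists p : {poly R},
  (forall x, p.[x] = mv t (nseq k (line z e x))) /\
  (forall x, p^`().[x] = k%:R * mv t (e :: nseq k.-1 (line z e x))).
Proof.
elim: k t => [|k IH] t tC.
  exists (wt t)%:P; split=> x; first by rewrite hornerC.
  by rewrite derivC horner0 mul0r.
have H i : exists p : {poly R}, i |: t \in C ->
    (forall x, p.[x] = mv (i |: t) (nseq k (line z e x))) /\
    (forall x, p^`().[x] = k%:R * mv (i |: t) (e :: nseq k.-1 (line z e x))).
  case: (boolP (i |: t \in C)) => [/IH[p pP]|_]; last by exists 0.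
  by exists p.
have [p pP] := choice H.
exists (\sum_(i | (i \notin t) && (i |: t \in C)) ((ell t i z)%:P + ell t i e *: 'X) * p i).
split=> x.
  rewrite horner_sum; apply: eq_bigr => i /andP[_ itC].
  rewrite !hornerE (proj1 (pP i itC)) /line ellD ?mul1r; last exact: C_indep.
  by congr (_ * _); ring.
rewrite raddf_sum horner_sum /=.
transitivity (mv t (e :: nseq k (line z e x)) + k%:R * mv t (line z e x :: e :: nseq k.-1 (line z e x))).
  rewrite /= mulr_sumr -big_split; apply: eq_bigr => i /andP[nit itC] /=.
  rewrite derivM derivD derivC derivZ derivX add0r !hornerE (proj1 (pP i itC)) (proj2 (pP i itC)) /=.
  rewrite /line (@ellD _ _ _ _ _ t) ?mul1r; last exact: C_indep.
  ring.
rewrite mv_swap; case: k {IH H p pP} => [|k]; first by rewrite mul0r addr0 mul1r.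
by rewrite [in RHS]mulrS mulrDl mul1r.
Qed.

Lemma mv_decomp t zs : t \in C ->
  mv t zs = \sum_(s in C | (#|s| == #|t| + size zs)%N && (t \subset s))
     wt s * cmv (powerset s) (fun=> 1) t zs.
Proof.
elim: zs t => [|z zs IH] t tC /=.
  rewrite (bigD1 t) /= ?addn0 ?eqxx ?subxx ?andbT // mulr1 big1 ?addr0 //.
  move=> s /andP[/and3P[sC /eqP st ts] nst]; case/eqP: nst; apply/esym/eqP.
  by rewrite eqEcard ts st leqnn.
rewrite (eq_bigr (fun i => \sum_(s in C | (#|s| == #|t| + (size zs).+1)%N && (i |: t \subset s))
    ell t i z * (wt s * cmv (powerset s) (fun=> 1) (i |: t) zs))); last first.
  move=> i /andP[nit itC]; rewrite IH // mulr_sumr; apply: eq_bigl => s.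
  by rewrite cardsU1 nit add1n addnS addSn.
rewrite (exchange_big_dep (fun s => (s \in C) && ((#|s| == #|t| + (size zs).+1)%N && (t \subset s)))) /=; last first.
  move=> i s _ /and3P[-> -> its] /=; apply: fintype.subset_trans its; exact: finset.subsetUr.
apply: eq_bigr => s /and3P[sC st ts]; rewrite mulr_sumr.
apply: eq_big => [i|i _]; last by rewrite mulrCA.
rewrite powersetE sC st /=; case: (i \notin t) => //=.
by apply/andP/idP => [[//]|its]; split=> //; exact: C_sub its.
Qed.
End MixedVolume.

Section Volume.
Variables (R : realType) (n : nat) (I : finType) (F : fan_data R n I).
Variable ip : {dot 'rV[R]_n for idfun}.
Variable s : {set I}.
Hypothesis s_indep : indep F s.
Implicit Types (t : {set I}) (r : seq I) (z v : I -> R).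
Local Notation u := (mark F).
Local Notation ell := (ell F ip).
Local Notation coord v i := (ip (cubvec F ip v s) (dual F ip s i)).
Local Notation mvs := (cmv F ip (powerset s) (fun=> 1)).
Local Notation mu := (@lebesgue_measure R).

(* In this section a point x of the span of [s] is encoded by the function
   v i = x * u_i, whence [coord v i] is its u_i-coordinate. *)
Definition box r z : set (I -> R) :=
  [set v | (forall j, j \in r -> v j <= z j) /\ (forall j, j \in r -> 0 <= coord v j)].

Definition boxvol r z : \bar R := lebesgue_on r (box r z) z.

Definition splits t r :=
  [/\ uniq r, s = t :|: [set i in r] & forall i, i \in t -> i \notin r].

Lemma coord_sum v i : coord v i = \sum_(j in s) ip (dual F ip s j) (dual F ip s i) * v j.
Proof.
rewrite cubvecE // ip_suml; apply: eq_bigr => j _; by rewrite ipZl mulrC.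
Qed.

Lemma polyhedron_coord r : polyhedron [set v | forall j, j \in r -> 0 <= coord v j].
Proof.
apply: polyhedron_all => j.
pose c k := if k \in s then ip (dual F ip s k) (dual F ip s j) else 0.
rewrite (_ : (fun v => _) = [set v | 0 <= 0 + \sum_k c k * v k]).
  exact: polyhedron_halfspace.
apply/funext => v /=; rewrite add0r coord_sum big_mkcond /=.
congr (is_true (0 <= _)); apply: eq_bigr => k _; rewrite /c.
by case: ifP; rewrite ?mul0r.
Qed.

Lemma polyhedron_le r z : polyhedron [set v | forall j, j \in r -> v j <= z j].
Proof.
apply: polyhedron_all => j.
rewrite (_ : (fun v => _) = [set v | 0 <= z j + \sum_k (- (k == j)%:R) * v k]); last first.
  apply/seteqP; split=> v /=; rewrite (bigD1 j) //= big1 ?eqxx => [|k /negbTE->]; 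
   by rewrite ?oppr0 ?mul0r // addr0 mulN1r subr_ge0.
exact: polyhedron_halfspace.
Qed.

Lemma polyhedron_box r z : polyhedron (box r z).
Proof. exact: polyhedronI (polyhedron_le r z) (polyhedron_coord r). Qed.

Lemma box_perm r r' z : perm_eq r r' -> box r z = box r' z.
Proof.
move=> /perm_mem rr'; apply/seteqP; split=> v [h1 h2]; split=> j jr.
- by apply: h1; rewrite rr'. - by apply: h2; rewrite rr'.
- by apply: h1; rewrite -rr'. - by apply: h2; rewrite -rr'.
Qed.

Lemma boxvol_perm r r' z : uniq r -> perm_eq r r' -> boxvol r z = boxvol r' z.
Proof.
move=> ur rr'; rewrite /boxvol (box_perm _ rr'); apply: lebesgue_on_perm => //.
exact: polyhedron_box.
Qed.

Lemma box_hull t r z v : splits t r -> cubical F ip s z ->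
  (forall i, i \in t -> v i = z i) -> box r z v ->
  exists l : {set I} -> R,
    [/\ forall t', 0 <= l t', \sum_t' l t' = 1,
     forall t', l t' != 0 -> t \subset t' /\ t' \subset s &
     cubvec F ip v s = \sum_t' l t' *: cubvec F ip z t'].
Proof.
move=> [ur st tr] cz vt [vr v0].
rewrite {1}st; apply: cubvec_hull; rewrite -?st //.
- by move=> i /tr; rewrite inE.
- exact: cubvec_cspan.
- by move=> i it_; rewrite cubvec_ip ?vt // st inE it_.
- by move=> i; rewrite inE => ir; rewrite cubvec_ip ?vr // st !inE ir orbT.
- by move=> i; rewrite inE; exact: v0.
Qed.

Lemma cubvec_coord_ge0 t z i : cubical F ip s z -> t \subset s -> i \in s ->
  0 <= ip (cubvec F ip z t) (dual F ip s i).
Proof.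
move=> cz ts is_; have ti := indepS ts s_indep.
have [it_|it_] := boolP (i \in t).
  rewrite {1}(coordP ip ti (cubvec_cspan ip z ti)); rewrite ip_suml sumr_ge0 // => j jt.
  rewrite ipZl (ipC ip (u j)) dualE ?(fintype.subsetP ts) //.
  by rewrite mulr_ge0 ?ler0n // ltW // cz.
rewrite ipC (@cspan_orth _ _ _ F ip t) //; last exact: cubvec_cspan.
move=> j jt; rewrite dualE // ?(fintype.subsetP ts _ jt) //.
by case: eqP => // ij; rewrite ij jt in it_.
Qed.

Lemma box_coord_ge0 t r z v i : splits t r -> cubical F ip s z ->
  (forall i, i \in t -> v i = z i) -> box r z v -> i \in s -> 0 <= coord v i.
Proof.
move=> st cz vt vb is_; have [l [l0 l1 lt ->]] := box_hull st cz vt vb.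
rewrite (big_morph (ip ^~ _) (id1 := 0) (op1 := +%R)) => [|x y|]; rewrite ?ipDl ?ip0l //.
rewrite sumr_ge0 // => t' _; rewrite ipZl.
have [->|/lt[_ t's]] := eqVneq (l t') 0; first by rewrite mul0r.
by rewrite mulr_ge0 // cubvec_coord_ge0.
Qed.

Lemma boxvol_finite t r z : splits t r -> cubical F ip s z ->
  boxvol r z \is a fin_num.
Proof.
move=> st cz; have [ur sE tr] := st.
pose C i := \sum_(t' : {set I}) `|ip (cubvec F ip z t') (u i)|.
have C0 i : 0 <= C i by rewrite sumr_ge0.
rewrite ge0_fin_numE ?lebesgue_on_ge0 //.
apply: le_lt_trans (ltry (((\sum_i C i) *+ 2) ^+ size r)).
apply: lebesgue_on_le => //; first exact: polyhedron_box.
  by rewrite sumr_ge0.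
move=> v vz vb i ir.
have is_ : i \in s by rewrite sE !inE ir orbT.
rewrite -(cubvec_ip ip v s_indep is_).
have [|l [l0 l1 lt ->]] := box_hull st cz _ vb.
  by move=> j /tr jr; exact: vz.
rewrite (big_morph (ip ^~ _) (id1 := 0) (op1 := +%R)) => [|x y|]; rewrite ?ipDl ?ip0l //.
apply: (le_trans (ler_norm_sum _ _ _)).
apply: (@le_trans _ _ (C i)); last first.
  by rewrite [leRHS](bigD1 i) //= lerDl sumr_ge0.
apply: ler_sum => t' _; rewrite ipZl normrM ger0_norm // ler_piMl //.
by rewrite -l1 (bigD1 t') //= lerDl sumr_ge0.
Qed.

(* By cubicality, the inequality [0 <= coord v i] is redundant on this slice. *)
Lemma boxvol_slice t i r z x : splits t (i :: r) -> cubical F ip s (upd z i x) ->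
  lebesgue_on r [set v | (forall j, j \in r -> v j <= z j) /\
                         (forall j, j \in i :: r -> 0 <= coord v j)] (upd z i x) =
  boxvol r (upd z i x).
Proof.
move=> [/= /andP[ir ur] sE tr] cz; apply: eq_lebesgue_on => v vz.
have st : splits (i |: t) r.
  split=> //; first by rewrite sE; apply/setP => j; rewrite !inE orbCA orbA.
  by move=> j; rewrite !inE => /orP[/eqP->//|/tr]; rewrite inE negb_or => /andP[].
have zr j : j \in r -> upd z i x j = z j.
  by rewrite /upd; case: eqP => // -> jr; rewrite jr in ir.
split=> /= [[h1 h2]|vb].
  by split=> j jr; [rewrite zr // h1 | rewrite h2 // inE jr orbT].
have [h1 h2] := vb; split=> j jr; first by rewrite -zr // h1.
apply: (box_coord_ge0 st cz) => //; last by rewrite sE !inE -in_cons jr orbT.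
by case: st => _ _ tr' k /tr'; exact: vz.
Qed.

Lemma upd_upd z i x y : upd (upd z i x) i y = upd z i y.
Proof. by apply/funext => k; rewrite /upd; case: (k == i). Qed.

Lemma upd_id z i : upd z i (z i) = z.
Proof. by apply/funext => k; rewrite /upd; case: (k =P i) => [->|]. Qed.

Lemma powerset_sub t t' : t \in powerset s -> t' \subset t -> t' \in powerset s.
Proof. by rewrite !powersetE => ts t't; exact: fintype.subset_trans t't ts. Qed.

Lemma powerset_indep t : t \in powerset s -> indep F t.
Proof. by rewrite powersetE => ts; exact: indepS ts s_indep. Qed.

Lemma integral_horner_deriv (p : {poly R}) a b : a < b ->
  (\int[mu]_(x in `[a, b]) (p^`().[x])%:E = (p.[b] - p.[a])%:E)%E.
Proof.
move=> ab; rewrite (@continuous_FTC2 R (horner p^`()) (horner p)) ?EFinB //.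
- by apply: continuous_subspaceT; exact: continuous_horner.
- split.
  + by move=> x _; exact: derivable_horner.
  + by apply: cvg_at_right_filter; exact: continuous_horner.
  + by apply: cvg_at_left_filter; exact: continuous_horner.
- by move=> x _; rewrite derivE.
Qed.

Lemma boxvol_diff t i r z x0 : splits t (i :: r) -> x0 < z i ->
  (forall x, x0 <= x <= z i -> cubical F ip s (upd z i x)) ->
  (forall w, cubical F ip s w ->
     boxvol r w = (mvs (i |: t) (nseq (size r) w) / (size r)`!%:R)%:E) ->
  boxvol (i :: r) z = (boxvol (i :: r) (upd z i x0) +
    ((mvs t (nseq (size r).+1 z) - mvs t (nseq (size r).+1 (upd z i x0)))
      / ((size r).+1)`!%:R)%:E)%E.
Proof.
move=> st xz cz IH; have [/= /andP[ir ur] sE tr] := st.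
pose P' : set (I -> R) := [set v | (forall j, j \in r -> v j <= z j) /\
                         (forall j, j \in i :: r -> 0 <= coord v j)].
pose h (x : R) : \bar R := lebesgue_on r P' (upd z i x).
have polP' : polyhedron P' := polyhedronI (polyhedron_le r z) (polyhedron_coord (i :: r)).
have mh : measurable_fun [set: R] h by exact: measurable_lebesgue_on_upd.
have h0 x : (0 <= h x)%E by exact: lebesgue_on_ge0.
have E1 y : boxvol (i :: r) (upd z i y) = (\int[mu]_(x in `]-oo, y]) h x)%E.
  rewrite integral_mkcond /boxvol /=; apply: eq_integral => x _.
  rewrite upd_upd patchE; case: ifPn => xy.
    move: xy; rewrite inE /= in_itv /= => xy.
    apply: eq_lebesgue_on => v vz; rewrite /box /P' /=.
    split=> -[h1 h2]; split=> // j jr.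
      have := h1 j; rewrite inE jr orbT /upd => /(_ isT).
      by case: eqP => // ji; rewrite -ji jr in ir.
    move: jr; rewrite inE => /orP[/eqP->|jr]; first by rewrite vz // /upd eqxx.
    rewrite /upd; case: eqP => [ji|_]; first by rewrite -ji jr in ir.
    exact: h1.
  rewrite -[RHS](lebesgue_on_set0 r (upd z i x)); apply: eq_lebesgue_on => v vz.
  split=> //= -[h1 _]; have := h1 i; rewrite inE eqxx vz // /upd eqxx => /(_ isT) xy'.
  by case/negP: xy; rewrite inE /= in_itv.
have E2 : [set` `]-oo, z i]] = [set` `]-oo, x0]] `|` [set` `]x0, z i]].
  by apply/seteqP; split=> x /=; rewrite !in_itv /=; lra.
rewrite -{1}(upd_id z i) !E1 E2 ge0_integral_setU //; first last.
- by apply/disj_set2P/seteqP; split=> x //=; rewrite !in_itv /=; lra.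
- exact: measurable_funTS.
congr (_ + _)%E.
rewrite integral_itv_obnd_cbnd; last exact: measurable_funTS.
pose e : I -> R := fun k => (k == i)%:R.
have lineE x : line (upd z i 0) e x = upd z i x.
  by apply/funext => k; rewrite /line /e /upd mul1r; case: (k == i); rewrite ?mulr1 ?add0r // mulr0 addr0.
have tP : t \in powerset s by rewrite powersetE sE finset.subsetUl.
have itP : i |: t \in powerset s.
  by rewrite powersetE sE; apply/fintype.subsetP => j; rewrite !inE => /orP[->|->]; rewrite ?orbT.
have nit : i \notin t by apply/negP => /tr; rewrite inE eqxx.
have [p [pE pE']] := mv_line ip (fun=> 1) powerset_sub powerset_indep (upd z i 0) e (size r).+1 tP.
have pE1 x : p.[x] = mvs t (nseq (size r).+1 (upd z i x)) by rewrite pE lineE.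
have pE2 x : p^`().[x] = (size r).+1%:R * mvs (i |: t) (nseq (size r) (upd z i x)).
  by rewrite pE' mv_ind ?lineE //; exact: powerset_indep.
transitivity (\int[mu]_(x in `[x0, z i]) ((((size r).+1)`!%:R^-1 *: p)^`().[x])%:E)%E.
  apply: eq_integral => x; rewrite inE /= in_itv /= => xzi.
  rewrite /h (boxvol_slice st (cz _ xzi)) IH; last exact: cz.
  rewrite derivZ hornerZ pE2; congr (_%:E).
  rewrite factS natrM; field.
  by rewrite nat1r !pnatr_eq0 -lt0n fact_gt0.
rewrite integral_horner_deriv // !hornerZ !pE1 upd_id -mulrBr.
by rewrite [in RHS]mulrC.
Qed.

Lemma cubvec_coord_continuous z (e : R) t i : indep F t -> 0 < e -> exists2 d : R, 0 < d &
  forall z', (forall k, k \in t -> `|z' k - z k| <= d) ->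
    `|ip (cubvec F ip z' t) (dual F ip t i) - ip (cubvec F ip z t) (dual F ip t i)| < e.
Proof.
move=> ti e0; pose c k := ip (dual F ip t k) (dual F ip t i).
pose S := 1 + \sum_(k in t) `|c k|.
have S0 : 0 < S by rewrite ltr_pwDl // sumr_ge0.
exists (e / S / 2) => [|z' zz]; first by rewrite !divr_gt0.
rewrite !cubvecE // !ip_suml -sumrB.
apply: (le_lt_trans (ler_norm_sum _ _ _)).
apply: (@le_lt_trans _ _ (\sum_(k in t) (e / S / 2) * `|c k|)).
  apply: ler_sum => k kt; rewrite (ipZl ip (z' k)) (ipZl ip (z k)) -mulrBl normrM.
  by apply: ler_pM => //; exact: zz.
rewrite -mulr_sumr mulrAC; set T := \sum_(k in t) _.
have T0 : 0 <= e / S * T by rewrite mulr_ge0 ?sumr_ge0 // ltW // divr_gt0.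
have eE : e = e / S + e / S * T.
  by rewrite -[X in _ = X + _]mulr1 -mulrDr divfK ?gt_eqF.
have e1 : 0 < e / S by rewrite divr_gt0.
by rewrite [ltRHS]eE; lra.
Qed.

Lemma cubical_open z : cubical F ip s z -> exists2 d : R, 0 < d &
  forall z', (forall k, k \in s -> `|z' k - z k| <= d) -> cubical F ip s z'.
Proof.
move=> cz.
have H (q : {set I} * I) : exists d : R, (0 < d) /\ (q.1 \subset s -> q.2 \in q.1 ->
   forall z', (forall k, k \in s -> `|z' k - z k| <= d) ->
   0 < ip (cubvec F ip z' q.1) (dual F ip q.1 q.2)).
  case: q => t i /=.
  have [ts|] := boolP (t \subset s); last by exists 1.
  have [it_|] := boolP (i \in t); last by exists 1.
  have ti := indepS ts s_indep.
  have [d d0 dP] := @cubvec_coord_continuous z _ t i ti (cz _ _ ts it_).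
  exists d; split=> // _ _ z' zz'.
  have := dP z' (fun k kt => zz' k (fintype.subsetP ts k kt)).
  by rewrite ltr_norml => /andP[+ _]; rewrite ltrBrDr addNr.
have [d dP] := choice H.
exists (\big[Num.min/1]_q d q).
  by apply: (big_ind (fun x => 0 < x)) => // [x y x0 y0|q _]; [rewrite lt_min x0 | case: (dP q)].
move=> z' zz' t i ts it_; apply: (proj2 (dP (t, i))) => //= k ks.
apply: (le_trans (zz' k ks)).
exact: (@bigmin_le_cond _ _ _ 1 (t, i)).
Qed.

Lemma boxvol_move t i r z x0 : splits t r -> i \in r -> x0 < z i ->
  (forall x, x0 <= x <= z i -> cubical F ip s (upd z i x)) ->
  (forall t' r' w, splits t' r' -> size r = (size r').+1 -> cubical F ip s w ->
     boxvol r' w = (mvs t' (nseq (size r') w) / (size r')`!%:R)%:E) ->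
  fine (boxvol r z) - mvs t (nseq (size r) z) / (size r)`!%:R =
  fine (boxvol r (upd z i x0)) - mvs t (nseq (size r) (upd z i x0)) / (size r)`!%:R.
Proof.
move=> st ir xz cz IH; have [ur sE tr] := st.
have pr : perm_eq r (i :: rem i r) := perm_to_rem ir.
have sz : size r = (size (rem i r)).+1 by rewrite (perm_size pr).
have st' : splits t (i :: rem i r).
  split; first by rewrite -(perm_uniq pr).
    by rewrite sE; apply/setP => j; rewrite !inE (perm_mem pr) inE.
  by move=> j /tr; rewrite (perm_mem pr).
have st2 : splits (i |: t) (rem i r).
  have [/= /andP[ir' ur'] sE' tr'] := st'; split=> //.
    by rewrite sE'; apply/setP => j; rewrite !inE orbCA orbA.
  by move=> j; rewrite !inE => /orP[/eqP->//|/tr']; rewrite inE negb_or => /andP[].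
have cz0 : cubical F ip s (upd z i x0) by apply: cz; rewrite lexx ltW.
have fin0 := boxvol_finite st' cz0.
rewrite !(boxvol_perm _ ur pr) (boxvol_diff st' xz cz); last by move=> w; exact: IH.
rewrite -sz fineD // [fine _%:E](_ : _ =
  (mvs t (nseq (size r) z) - mvs t (nseq (size r) (upd z i x0))) / (size r)`!%:R) //.
by ring.
Qed.

(* Values, and points, after the homothety of ratio [c] centred at the vertex
   [cubvec t]. *)
Definition shrink t c z : I -> R := fun k =>
  (1 - c) * (if k \in s then ip (cubvec F ip z t) (u k) else z k) + c * z k.

Lemma boxvol_scale t r z (c : R) : splits t r -> 0 < c ->
  [/\ forall k, k \in r -> shrink t c z k = z k - (1 - c) * ell t k z,
    forall k, k \notin r -> shrink t c z k = z k,
    boxvol r (shrink t c z) = ((c ^+ size r)%:E * boxvol r z)%E &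
    mvs t (nseq (size r) (shrink t c z)) = c ^+ size r * mvs t (nseq (size r) z)].
Proof.
move=> [ur sE tr] c0; set z' := shrink t c z; have ts : t \subset s by rewrite sE finset.subsetUl.
have rs j : j \in r -> j \in s by move=> jr; rewrite sE !inE jr orbT.
have ti := indepS ts s_indep.
have z'r k : k \in r -> z' k = z k - (1 - c) * ell t k z.
  by move=> kr; rewrite /z' /shrink rs // /ell; ring.
have z'n k : k \notin r -> z' k = z k.
  move=> kr; rewrite /z' /shrink; case: ifP => ks; last by ring.
  rewrite cubvec_ip //; first by ring.
  by move: ks; rewrite sE !inE (negbTE kr) orbF.
have cub' t' : t \subset t' -> t' \subset s ->
    forall v, cubvec F ip (fun k => (1 - c) * (if k \in s then ip (cubvec F ip z t) (u k) else z k) + c * v k) t' =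
      (1 - c) *: cubvec F ip z t + c *: cubvec F ip v t'.
  move=> tt' t's v; have t'i := indepS t's s_indep.
  rewrite cubvecD //; congr (_ *: _ + _); apply: cubvec_uniq => //.
    by apply: (cspanS tt'); exact: cubvec_cspan.
  by move=> i it'; rewrite (fintype.subsetP t's).
split=> //.
- rewrite /boxvol /z' /shrink lebesgue_on_affine //; last exact: polyhedron_box.
  congr (_ * lebesgue_on _ _ _)%E; apply/seteqP.
  have E v j : j \in r -> coord (fun k => (1 - c) * (if k \in s then ip (cubvec F ip z t) (u k) else z k) + c * v k) j = c * coord v j.
    move=> jr; rewrite cub' // ipDl !ipZl (ipC ip (cubvec F ip z t)).
    rewrite (@cspan_orth _ _ _ F ip t) ?mulr0 ?add0r //; last exact: cubvec_cspan.
    move=> i it_; rewrite dualE ?(rs _ jr) ?(fintype.subsetP ts _ it_) //.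
    by case: eqP => // ij; have := tr _ it_; rewrite -ij jr.
  split=> v /= [h1 h2]; split=> j jr.
  + by have := h1 j jr; rewrite lerD2l ler_pM2l.
  + by have := h2 j jr; rewrite E // pmulr_rge0.
  + by rewrite lerD2l ler_pM2l // h1.
  + by rewrite E // pmulr_rge0 // h2.
- apply: mv_scale => t' j tt'; rewrite powersetE => t's.
  have t's' : t' \subset s by apply: fintype.subset_trans t's; exact: finset.subsetUr.
  have js : j \in s by apply: (fintype.subsetP t's); rewrite setU11.
  rewrite /ell /z' /shrink cub' // js ipDl !ipZl; by ring.
Qed.

Theorem boxvolE t r z : splits t r -> cubical F ip s z ->
  boxvol r z = (mvs t (nseq (size r) z) / (size r)`!%:R)%:E.
Proof.
move: {2}(size r) (erefl (size r)) => k; elim: k t r z => [|k IH] t r z rk st cz.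
  move/size0nil: rk => ->; rewrite /boxvol /= indicE mem_set ?divr1 //.
rewrite -[LHS]fineK ?(boxvol_finite st cz) //; congr (_%:E).
apply/eqP; rewrite -subr_eq0; apply/eqP.
set G := LHS; have [ur sE tr] := st.
have rs j : j \in r -> j \in s by move=> jr; rewrite sE !inE jr orbT.
have ellr j : j \in r -> 0 < ell t j z.
  move=> jr; apply: (ell_gt0 s_indep cz).
    by rewrite sE; apply/fintype.subsetP => i; rewrite !inE => /orP[/eqP->|->]; rewrite ?jr ?orbT.
  by apply/negP => /tr; rewrite jr.
have [d d0 dP] := cubical_open cz.
pose S := 1 + \sum_(j <- r) ell t j z.
have S1 : 1 <= S by rewrite lerDl big_seq sumr_ge0 // => j /ellr/ltW.
have S0 : 0 < S by exact: lt_le_trans S1.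
pose a := Num.min (2^-1) (d / S).
have a0 : 0 < a by rewrite lt_min invr_gt0 ltr0n divr_gt0.
have a1 : a < 1 by rewrite gt_min invf_lt1 ?ltr0n ?ltr1n.
have aS j : j \in r -> a * ell t j z <= d.
  move=> jr; apply: (@le_trans _ _ (a * S)).
    rewrite ler_pM2l // /S (big_rem j) //= addrCA lerDl addr_ge0 //.
    by rewrite big_seq sumr_ge0 // => i /mem_rem/ellr/ltW.
  by rewrite -ler_pdivlMr // ge_min lexx orbT.
have a1' : 0 < 1 - a by rewrite subr_gt0.
have [z'r z'n z'L z'M] := boxvol_scale z st a1'.
set z' := shrink t (1 - a) z in z'r z'n z'L z'M.
have {}z'r j : j \in r -> z' j = z j - a * ell t j z by move=> /z'r ->; rewrite subKr.
pose zq (q : seq I) : I -> R := fun j => if j \in q then z' j else z j.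
have H q : uniq q -> {subset q <= r} ->
    G = fine (boxvol r (zq q)) - mvs t (nseq (size r) (zq q)) / (size r)`!%:R.
  elim: q => [_ _|j q IHq /= /andP[jq uq] qr].
    by rewrite (_ : zq [::] = z) //; apply/funext.
  rewrite IHq //; last by move=> i iq; rewrite qr // inE iq orbT.
  have jr : j \in r by rewrite qr // mem_head.
  have -> : zq (j :: q) = upd (zq q) j (z' j).
    apply/funext => i; rewrite /zq /upd inE.
    by case: eqP => [->|].
  have zqj : zq q j = z j by rewrite /zq (negbTE jq).
  apply: boxvol_move => //.
  - by rewrite zqj z'r // ltrBlDr ltrDl mulr_gt0 // ellr.
  - move=> x; rewrite zqj z'r // => /andP[x1 x2]; apply: dP => i is_.
    rewrite /upd; case: eqP => [->|_].
      by rewrite ler_norml; have := aS _ jr; move: x1 x2; lra.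
    rewrite /zq; case: ifP => iq; last by rewrite subrr normr0 ltW.
    have ir : i \in r by rewrite qr // inE iq orbT.
    by rewrite z'r // addrC addKr normrN ger0_norm ?aS // mulr_ge0 ?ltW ?ellr.
  - by move=> t' r' w st' sr'; apply: IH => //; apply: succn_inj; rewrite -sr'.
have zqr : zq r = z'.
  by apply/funext => j; rewrite /zq; case: ifPn => // /z'n.
have := H r ur (fun _ => id); rewrite zqr z'L z'M fineM ?(boxvol_finite st cz) //=.
rewrite -mulrA -mulrBr -/G => GE.
have : (1 - (1 - a) ^+ size r) * G = 0 by rewrite mulrBl mul1r {1}GE subrr.
move/eqP; rewrite mulf_eq0 => /orP[|/eqP//].
rewrite subr_eq0 eq_sym lt_eqF // rk exprn_ilt1 //; lra.
Qed.

Lemma cvol_ncone z : cubical F ip s z ->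
  cvol F ip s (ncone F ip z s) = mvs finset.set0 (nseq #|s| z).
Proof.
move=> cz.
have st : splits finset.set0 (enum s).
  split; first exact: enum_uniq.
    by apply/setP => i; rewrite !inE mem_enum.
  by move=> i; rewrite inE.
have sz : #|s| = size (enum s) by rewrite cardE.
have cast m (e : m = #|s|) :
    lebesgueRn [set (\row_(j < #|s|) ip v (u (enum_val j))) | v in ncone F ip z s] =
    lebesgueRn [set (\row_(j < m) ip v (u (enum_val (cast_ord e j)))) | v in ncone F ip z s].
  subst m; congr lebesgueRn; apply/seteqP; split=> _ [v vP <-]; exists v => //;
  by apply/rowP => j; rewrite !mxE cast_ord_id.
have ovE (y : 'rV[R]_(size (enum s))) j :
    overwrite z y (enum_val (cast_ord (esym sz) j)) = y ord0 j.
  have i0 := enum_val (cast_ord (esym sz) j).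
  by rewrite (enum_val_nth i0) /= overwrite_nth // enum_uniq.
have jP i : i \in s -> exists j : 'I_(size (enum s)), i = enum_val (cast_ord (esym sz) j).
  move=> is_; exists (cast_ord sz (enum_rank_in is_ i)).
  by rewrite cast_ordK enum_rankK_in.
have E : lebesgueRn [set (\row_(j < #|s|) ip v (u (enum_val j))) | v in ncone F ip z s] =
    boxvol (enum s) z.
  rewrite /boxvol -lebesgueRn_lebesgue_on (cast _ (esym sz)).
  congr lebesgueRn; apply/seteqP; split => [_ /= [v [/(coneP ip v s_indep)[vs v0] vz] <-]|y /= [h1 h2]].
    have E i : i \in s -> overwrite z (\row_j ip v (u (enum_val (cast_ord (esym sz) j)))) i = ip v (u i).
      by move=> /jP[j ->]; rewrite ovE mxE.
    split=> i; rewrite mem_enum => is_; first by rewrite E // vz.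
    rewrite (@cubvec_uniq _ _ _ _ _ _ _ v) //; first exact: v0.
    by move=> k ks; rewrite E.
  exists (cubvec F ip (overwrite z y) s).
    split; last by move=> i is_; rewrite cubvec_ip // h1 // mem_enum.
    apply/(coneP ip) => //; split; first exact: cubvec_cspan.
    by move=> i is_; apply: h2; rewrite mem_enum.
  by apply/rowP => j; rewrite mxE cubvec_ip ?enum_valP // ovE ord1.
by rewrite /cvol E (boxvolE st cz) /= -sz mulrC divfK // pnatr_eq0 -lt0n fact_gt0.
Qed.

End Volume.

(** * Quadratic forms with one positive eigenvalue *)

Section Spectral.
Variables (R : realType) (n : nat).
Implicit Types (A : 'M[R]_n) (x y f : 'rV[R]_n).

Definition bform A x y : R := (x *m A *m y^T) ord0 ord0.

Lemma bformDl A a x1 b x2 y : bform A (a *: x1 + b *: x2) y = a * bform A x1 y + b * bform A x2 y.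
Proof. by rewrite /bform !mulmxDl -!scalemxAl !mxE. Qed.

Lemma bformC A x y : A^T = A -> bform A x y = bform A y x.
Proof.
by move=> At; rewrite /bform -{1}[x *m A *m y^T]trmxK mxE !trmx_mul trmxK At mulmxA.
Qed.

Lemma char_poly_conj (K : fieldType) m (P D : 'M[K]_m) : P \in unitmx ->
  char_poly (invmx P *m D *m P) = char_poly D.
Proof.
move=> Pu; rewrite /char_poly /char_poly_mx.
have -> : 'X%:M - map_mx polyC (invmx P *m D *m P) =
   map_mx polyC (invmx P) *m ('X%:M - map_mx polyC D) *m map_mx polyC P.
  rewrite mulmxBr mulmxBl !map_mxM; congr (_ - _).
  by rewrite mul_mx_scalar -scalemxAl -map_mxM mulVmx // map_mx1 scalemx1.
rewrite !det_mulmx mulrAC -det_mulmx -map_mxM mulVmx // map_mx1 det1 mul1r //.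
Qed.

Lemma mup_prod_XsubC (a : R) (l : 'I_n -> R) :
  mup a (\prod_i ('X - (l i)%:P)) = (\sum_i (l i == a))%N.
Proof.
have [] : (\prod_i ('X - (l i)%:P) != 0) /\ mup a (\prod_i ('X - (l i)%:P)) = (\sum_i (l i == a))%N; last by [].
apply: (big_rec2 (fun (p : {poly R}) m => p != 0 /\ mup a p = m)).
  by rewrite oner_neq0 mupNroot // root1.
move=> i p m _ [p0 <-]; split; first by rewrite mulf_neq0 // polyXsubC_eq0.
rewrite mupM // ?polyXsubC_eq0 //; congr (_ + _)%N.
by have := mup_XsubCX 1 a (l i); rewrite expr1 => ->; rewrite eq_sym; case: (_ == _).
Qed.

Local Notation C := (complex R).
Local Notation cx := (real_complex R).
Local Notation cRe := (@complex.Re R).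
Local Notation cIm := (@complex.Im R).
Local Notation adj P := (map_mx Num.conj P^T).

Lemma spectral_real A : A^T = A -> exists (P : 'M[C]_n) (l : 'I_n -> R),
  [/\ P \is unitarymx, P *m map_mx cx A = diag_mx (\row_i cx (l i)) *m P &
    char_poly A = \prod_i ('X - (l i)%:P)].
Proof.
move=> At; pose A' : 'M[C]_n := map_mx cx A.
have Ah : A' \is hermsymmx.
  apply: realsym_hermsym.
    by apply/is_hermitianmxP; rewrite expr0 scale1r map_mx_id // /A' map_trmx At.
  by apply/mxOverP => i j; rewrite mxE; apply/complex_realP; exists (A i j).
have /orthomx_spectralP := hermitian_normalmx Ah.
set P := spectralmx A'; set d := spectral_diag A' => A'E.
have Pu : P \in unitmx by exact: spectral_unit.
have dr i j : d i j \is Num.real by exact: (mxOverP (hermitian_spectral_diag_real Ah)).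
have PU : P \is unitarymx by exact: spectral_unitarymx.
clearbody P d.
have PA : P *m A' = diag_mx d *m P by rewrite A'E !mulmxA (mulmxV Pu) mul1mx.
exists P, (fun i => cRe (d ord0 i)).
have dE : \row_i cx (cRe (d ord0 i)) = d.
  by apply/rowP => i; rewrite mxE; apply: RRe_real; exact: dr.
split; [exact: PU | by rewrite dE; exact: PA |].
apply: (map_inj_poly (f := cx)) => //.
  exact: complexI.
rewrite map_char_poly -/A' A'E char_poly_conj // char_poly_trig ?diag_mx_is_trig //.
rewrite rmorph_prod /=; apply: eq_bigr => i _.
rewrite rmorphB /= map_polyX map_polyC /= !mxE eqxx mulr1n.
by rewrite -[in LHS]dE mxE.
Qed.

Lemma cReD (a b : C) : cRe (a + b) = cRe a + cRe b.
Proof. by case: a b => [? ?] [? ?]. Qed.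

Lemma cImD (a b : C) : cIm (a + b) = cIm a + cIm b.
Proof. by case: a b => [? ?] [? ?]. Qed.

Lemma cReM (a : C) (b : R) : cRe (a * cx b) = cRe a * b.
Proof. by case: a => [? ?] /=; rewrite mulr0 subr0. Qed.

Lemma cImM (a : C) (b : R) : cIm (a * cx b) = cIm a * b.
Proof. by case: a => [? ?] /=; rewrite mulr0 add0r. Qed.

Lemma eigen_ReIm A (e : 'rV[C]_n) (l : R) : e *m map_mx cx A = cx l *: e ->
  map_mx cRe e *m A = l *: map_mx cRe e /\
  map_mx cIm e *m A = l *: map_mx cIm e.
Proof.
move=> eA; split; apply/rowP => j.
  have := congr1 (fun v : 'rV[C]_n => cRe (v ord0 j)) eA; rewrite !mxE mulrC cReM mulrC => <-.
  rewrite (big_morph _ cReD (erefl (cRe 0))).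
  by apply: eq_bigr => i _; rewrite !mxE cReM.
have := congr1 (fun v : 'rV[C]_n => cIm (v ord0 j)) eA; rewrite !mxE mulrC cImM mulrC => <-.
rewrite (big_morph _ cImD (erefl (cIm 0))).
by apply: eq_bigr => i _; rewrite !mxE cImM.
Qed.

Lemma bform_le0 A y : A^T = A ->
  (forall f l, 0 < l -> f *m A = l *: f -> (y *m f^T) ord0 ord0 = 0) ->
  bform A y y <= 0.
Proof.
move=> At yf; have [P [l [PU PA _]]] := spectral_real At.
pose y' : 'rV[C]_n := map_mx cx y.
pose w := y' *m adj P.
have PtP : adj P *m P = 1%:M.
  by rewrite -invmx_unitary // mulVmx // unitarymx_unit.
have y'E : y' = w *m P by rewrite -mulmxA PtP mulmx1.
have y't : y'^T = adj y'.
  by apply/matrixP => i j; rewrite !mxE; apply/esym/CrealP/complex_realP; eexists.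
have E : cx (bform A y y) = \sum_i cx (l i) * (w ord0 i * Num.conj (w ord0 i)).
  have -> : cx (bform A y y) = (y' *m map_mx cx A *m y'^T) ord0 ord0.
    by rewrite /bform map_trmx -!map_mxM [RHS]mxE.
  rewrite y't {1}y'E -[w *m P *m _]mulmxA PA mulmxA y'E trmx_mul map_mxM mulmxA.
  rewrite -[w *m _ *m P *m _]mulmxA (unitarymxP PU) mulmx1 mxE.
  apply: eq_bigr => i _; rewrite mul_mx_diag !mxE; by rewrite mulrAC mulrC mulrA.
rewrite -lecR E; apply: sumr_le0 => i _.
have [li|li] := leP (l i) 0.
  by rewrite mulr_le0_ge0 ?mul_conjC_ge0 // -[0](rmorph0 cx) lecR.
suff -> : w ord0 i = 0 by rewrite mul0r mulr0.
have eA : row i P *m map_mx cx A = cx (l i) *: row i P.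
  rewrite -row_mul PA; apply/rowP => j; rewrite mxE mul_diag_mx !mxE //.
have [e1 e2] := eigen_ReIm eA.
have h1 := yf _ _ li e1; have h2 := yf _ _ li e2; rewrite !mxE in h1 h2.
have wE : w ord0 i = \sum_j Num.conj (P i j) * cx (y ord0 j).
  by rewrite mxE; apply: eq_bigr => j _; rewrite !mxE mulrC.
have Rw : cRe (w ord0 i) = 0.
  rewrite wE (big_morph _ cReD (erefl (cRe 0))) -[RHS]h1; apply: eq_bigr => j _.
  by rewrite cReM !mxE mulrC; case: (P i j).
have Iw : cIm (w ord0 i) = 0.
  rewrite wE (big_morph _ cImD (erefl (cIm 0))) -[RHS]oppr0 -h2 -sumrN; apply: eq_bigr => j _.
  by rewrite cImM !mxE mulrC -mulrN; case: (P i j).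
by apply/eqP; rewrite eq_complex Rw Iw /= !eqxx.
Qed.

Lemma reverse_CS A (f0 x y : 'rV[R]_n) : A^T = A ->
  (forall f l, 0 < l -> f *m A = l *: f -> exists k, f = k *: f0) ->
  0 < bform A x x -> bform A x x * bform A y y <= bform A x y ^+ 2.
Proof.
move=> At Af0 xx.
have dotZ (v : 'rV[R]_n) (k : R) : (v *m (k *: f0)^T) ord0 ord0 = k * (v *m f0^T) ord0 ord0.
  by rewrite linearZ /= -scalemxAr mxE.
set a := (x *m f0^T) ord0 ord0; set b := (y *m f0^T) ord0 ord0.
have a0 : a != 0.
  apply/eqP => a0; move: xx; rewrite ltNge bform_le0 // => f l l0 /(Af0 _ _ l0)[k ->].
  by rewrite dotZ -/a a0 mulr0.
pose s := - (b / a).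
have H : bform A (1 *: y + s *: x) (1 *: y + s *: x) <= 0.
  apply: bform_le0 => // f l l0 /(Af0 _ _ l0)[k ->].
  rewrite dotZ mulmxDl -!scalemxAl mxE [X in X + _]mxE [X in _ + X]mxE -/a -/b.
  by rewrite /s mulNr divfK // mul1r subrr mulr0.
move: H; rewrite bformDl !(bformC _ (1 *: y + s *: x)) // !bformDl (bformC y x) //.
set Q := bform A x x in xx *; set B := bform A x y; set Y := bform A y y => H.
have : Q * Y <= Q * (- s * B *+ 2 - s ^+ 2 * Q).
  by rewrite ler_pM2l //; move: H; lra.
have := sqr_ge0 (B + s * Q); nra.
Qed.

Lemma one_positive_eigenline A : A^T = A -> one_positive_eigenvalue A ->
  exists f0, forall f l, 0 < l -> f *m A = l *: f -> exists k, f = k *: f0.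
Proof.
move=> At [a [a0 ma ua]].
have [[f0 [f00 f0A]]|nf0] := pselect (exists f0 : 'rV[R]_n, f0 != 0 /\ f0 *m A = a *: f0); last first.
  exists 0 => f l l0 fA; exists 0; rewrite scale0r; apply/eqP; apply: contraT => fn0.
  have la : l = a by apply: ua => //; apply/eigenvalueP; exists f.
  by case: nf0; exists f; rewrite -la.
exists f0 => f l l0 fA; have [->|fn0] := eqVneq f 0; first by exists 0; rewrite scale0r.
have {l l0 fA} fA : f *m A = a *: f.
  by rewrite -(ua l) //; apply/eigenvalueP; exists f.
have [P [l [PU PA chA]]] := spectral_real At.
move: ma; rewrite chA mup_prod_XsubC => ma.
have [i0 i0P] : exists i0, forall i, i != i0 -> l i != a.
  have [i0 /eqP li0] : exists i, l i == a.
    apply/existsP; apply: contraT; rewrite negb_exists => /forallP h.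
    by move: ma; rewrite big1 // => i _; rewrite (negbTE (h i)).
  exists i0 => i ii0; apply/eqP => lia.
  by move: ma; rewrite (bigD1 i0) //= (bigD1 i) //= li0 lia eqxx.
have PtP : adj P *m P = 1%:M.
  by rewrite -invmx_unitary // mulVmx // unitarymx_unit.
have H g : g *m A = a *: g -> map_mx cx g = (map_mx cx g *m adj P) ord0 i0 *: row i0 P.
  move=> gA; set g' := map_mx cx g; pose w := g' *m adj P.
  have g'A : g' *m map_mx cx A = cx a *: g' by rewrite -map_mxM gA map_mxZ.
  have g'E : g' = w *m P by rewrite -mulmxA PtP mulmx1.
  have wE : w *m diag_mx (\row_i cx (l i)) = cx a *: w.
    have : w *m (P *m map_mx cx A) *m adj P = cx a *: w.
      by rewrite mulmxA -g'E g'A -scalemxAl.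
    by rewrite PA mulmxA -[_ *m P *m _]mulmxA (unitarymxP PU) mulmx1.
  have w0 i : i != i0 -> w ord0 i = 0.
    move=> /i0P lia; have := congr1 (fun v : 'rV[C]_n => v ord0 i) wE.
    rewrite mul_mx_diag !mxE mulrC => /eqP; rewrite -subr_eq0 -mulrBl mulf_eq0.
    rewrite -rmorphB /= => /orP[|/eqP-> //].
    rewrite -(rmorph0 cx) (inj_eq (@complexI R)) subr_eq0; by rewrite (negbTE lia).
  rewrite -/w {1}g'E; apply/rowP => j; rewrite mxE [in RHS]mxE [row _ _ _ _]mxE.
  rewrite (bigD1 i0) //= big1 ?addr0 // => i ii0.
  by rewrite w0 // mul0r.
have Hf := H _ fA; have Hf0 := H _ f0A.
move: Hf Hf0; set wf := (_ ord0 i0); set w0 := (_ *m _) ord0 i0; set e := row i0 P => Hf Hf0.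
have w00 : w0 != 0.
  apply: contraNneq f00 => w00; move: Hf0; rewrite w00 scale0r => /matrixP h.
  by apply/eqP/rowP => j; have := h ord0 j; rewrite !mxE -(rmorph0 cx) => /complexI.
have [j f0j] : exists j, f0 ord0 j != 0.
  by apply/existsP; apply: contraNT f00; rewrite negb_exists => /forallP h;
    apply/eqP/rowP => j; rewrite mxE; apply/eqP; have := h j; rewrite negbK.
have fE : map_mx cx f = (wf / w0) *: map_mx cx f0.
  by rewrite Hf Hf0 scalerA divfK.
have wE : wf / w0 = cx (f ord0 j / f0 ord0 j).
  have := congr1 (fun v : 'rV[C]_n => v ord0 j) fE; rewrite !mxE => h.
  by rewrite fmorph_div /= h mulfK // -(rmorph0 cx) (inj_eq (@complexI R)).
exists (f ord0 j / f0 ord0 j); apply/rowP => i; apply: (@complexI R).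
by have := congr1 (fun v : 'rV[C]_n => v ord0 i) fE; rewrite !mxE wE -rmorphM.
Qed.

End Spectral.

Section Bochner.
Variables (R : realType) (m : nat) (B : 'M[R]_m) (c p : 'I_m -> R).
Hypothesis B_sym : B^T = B.
Hypothesis c_gt0 : forall i, 0 < c i.
Hypothesis p_gt0 : forall i, 0 < p i.
Hypothesis Bc : forall i, p i = \sum_j B i j * c j.
Hypothesis B_ge0 : forall i j, i != j -> 0 <= B i j.
Hypothesis B_irr : forall X : {set 'I_m}, X != finset.set0 -> X != finset.setT ->
  exists i j, [/\ i \in X, j \notin X & B i j != 0].
Hypothesis B_bochner : forall y : 'rV[R]_m,
  bform B y y <= \sum_i c i / p i * (\sum_j B i j * y ord0 j) ^+ 2.

Lemma bformE (A : 'M[R]_m) x y : bform A x y = \sum_i \sum_j A i j * (x ord0 i * y ord0 j).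
Proof.
rewrite /bform mxE exchange_big /=; apply: eq_bigr => j _.
rewrite !mxE mulr_suml; apply: eq_bigr => i _; ring.
Qed.

Lemma perron_identity g : \sum_i g i ^+ 2 * (p i / c i) - \sum_i \sum_j B i j * (g i * g j) =
  2^-1 * \sum_i \sum_j B i j * (c i * c j) * (g i / c i - g j / c j) ^+ 2.
Proof.
have Bs i j : B i j = B j i by rewrite -{1}B_sym mxE.
have E1 : \sum_i g i ^+ 2 * (p i / c i) = \sum_i \sum_j B i j * (g i ^+ 2 * c j / c i).
  apply: eq_bigr => i _; rewrite Bc !(mulr_suml, mulr_sumr); apply: eq_bigr => j _.
  by field; rewrite gt_eqF.
have E2 : \sum_i g i ^+ 2 * (p i / c i) = \sum_i \sum_j B i j * (g j ^+ 2 * c i / c j).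
  by rewrite E1 exchange_big /=; apply: eq_bigr => i _; apply: eq_bigr => j _; rewrite Bs.
have -> : \sum_i \sum_j B i j * (c i * c j) * (g i / c i - g j / c j) ^+ 2 =
  \sum_i g i ^+ 2 * (p i / c i) + \sum_i g i ^+ 2 * (p i / c i) -
   2 * \sum_i \sum_j B i j * (g i * g j).
  rewrite {1}E1 {1}E2 mulr_sumr -!sumrN -!big_split /=; apply: eq_bigr => i _.
  rewrite mulr_sumr -!sumrN -!big_split /=; apply: eq_bigr => j _.
  by field; rewrite !gt_eqF.
by field.
Qed.

(* Let D = diag(p/c). In the coordinates sqrt(D) y, [B_bochner] bounds B by its
   square, so every eigenvalue of D^-1 B that is positive is at least 1; by
   [perron_identity] 1 is the largest one, and its eigenspace is spanned by c. *)
Lemma bochner x y : 0 < bform B x x -> bform B x x * bform B y y <= bform B x y ^+ 2.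
Proof.
pose D i := Num.sqrt (p i / c i).
have D0 i : 0 < D i by rewrite sqrtr_gt0 divr_gt0.
have D2 i : D i ^+ 2 = p i / c i by rewrite sqr_sqrtr // ltW // divr_gt0.
pose A : 'M[R]_m := \matrix_(i, j) (B i j / (D i * D j)).
pose tl (v : 'rV[R]_m) : 'rV[R]_m := \row_i (v ord0 i * D i).
have AB v v' : bform B v v' = bform A (tl v) (tl v').
  rewrite !bformE; apply: eq_bigr => i _; apply: eq_bigr => j _; rewrite !mxE.
  by field; rewrite !gt_eqF.
rewrite !AB; apply: (reverse_CS (f0 := \row_i (c i * D i))).
  by apply/matrixP => i j; rewrite !mxE mulrC [in RHS]mulrC -{1}B_sym mxE [D i * _]mulrC.
move=> f l l0 fA; pose g i := f ord0 i / D i.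
have Bg i : \sum_j B i j * g j = l * (g i * (p i / c i)).
  have := congr1 (fun v : 'rV[R]_m => v ord0 i * D i) fA; rewrite !mxE -D2 => fAi.
  transitivity (l * f ord0 i * D i); last by rewrite /g; field; rewrite gt_eqF.
  rewrite -fAi mulr_suml; apply: eq_bigr => j _; rewrite !mxE -{1}B_sym mxE /g.
  by field; rewrite !gt_eqF.
pose N := \sum_i g i ^+ 2 * (p i / c i).
have N0 : 0 <= N by rewrite sumr_ge0 // => i _; rewrite mulr_ge0 ?sqr_ge0 // ltW // divr_gt0.
have gBg : \sum_i \sum_j B i j * (g i * g j) = l * N.
  rewrite mulr_sumr; apply: eq_bigr => i _.
  transitivity (g i * \sum_j B i j * g j); last by rewrite Bg; ring.
  by rewrite mulr_sumr; apply: eq_bigr => j _; ring.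
have lN : l * N <= l ^+ 2 * N.
  have := B_bochner (\row_i g i); rewrite bformE.
  under eq_bigr do under eq_bigr do rewrite !mxE.
  rewrite gBg => /le_trans; apply; rewrite mulr_sumr; apply: ler_sum => i _.
  under eq_bigr do rewrite mxE.
  rewrite Bg le_eqVlt; apply/orP; left; apply/eqP.
  by field; rewrite !gt_eqF.
have [N00|N00] := eqVneq N 0.
  exists 0; rewrite scale0r; apply/rowP => i; rewrite mxE.
  move/eqP: N00; rewrite psumr_eq0 => [/allP/(_ i (mem_index_enum _))|j _]; last first.
    by rewrite mulr_ge0 ?sqr_ge0 // ltW // divr_gt0.
  rewrite /= mulf_eq0 (gt_eqF (divr_gt0 (p_gt0 i) (c_gt0 i))) orbF sqrf_eq0 mulf_eq0.
  by rewrite invr_eq0 (gt_eqF (D0 i)) orbF => /eqP.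
have {}N0 : 0 < N by rewrite lt_def N00 N0.
have l1 : 1 <= l by move: lN; rewrite ler_pM2r // expr2 -[leLHS]mulr1 ler_pM2l.
have id := perron_identity g; rewrite gBg -/N in id.
pose T i j := B i j * (c i * c j) * (g i / c i - g j / c j) ^+ 2.
have T0 i j : 0 <= T i j.
  rewrite /T; have [->|ij] := eqVneq i j; first by rewrite subrr expr0n mulr0.
  by rewrite mulr_ge0 ?sqr_ge0 // mulr_ge0 ?B_ge0 // mulr_ge0 // ltW.
have TT0 i j : T i j = 0.
  have : \sum_i \sum_j T i j <= 0.
    have : N - l * N <= 0 by rewrite subr_le0 ler_peMl // ltW.
    by rewrite id pmulr_rle0 // invr_gt0 ltr0n.
  rewrite (bigD1 i) //= (bigD1 j) //= => h; apply/eqP; rewrite eq_le T0 andbT.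
  apply: le_trans h; rewrite -addrA lerDl addr_ge0 ?sumr_ge0 // => k _.
  by rewrite sumr_ge0.
have [i0 _] : exists i0 : 'I_m, true.
  apply/existsP; apply: contraNT N00; rewrite negb_exists => /forallP h.
  by rewrite /N big1 // => i; have := h i.
pose h := g i0 / c i0; pose X : {set 'I_m} := [set i | g i / c i == h]%SET.
have XT : X = finset.setT.
  apply/eqP; apply: contraT => XT; have X0 : X != finset.set0.
    by apply/set0Pn; exists i0; rewrite inE.
  have [i [j [iX jX Bij]]] := B_irr X0 XT.
  have := TT0 i j; rewrite /T => /eqP; rewrite !mulf_eq0 (negbTE Bij).
  rewrite !(gt_eqF (c_gt0 _)) /= orbb subr_eq0 => /eqP e.
  by move: iX jX; rewrite !inE -e => ->.
exists h; apply/rowP => i; rewrite !mxE.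
have : i \in X by rewrite XT inE.
by rewrite inE => /eqP <-; rewrite /g; field; rewrite !gt_eqF.
Qed.

End Bochner.

(** * Polarization and Minkowski sums *)

Section Polarization.
Variables (R : realType) (I : finType) (d : nat).
Variables (K : (I -> R) -> Prop) (H : seq (I -> R) -> R).
Let good (zs : seq (I -> R)) := size zs = d /\ forall z, z \in zs -> K z.
Hypothesis K_line : forall x y a, K x -> K y -> 0 <= a -> K (line x y a).
Hypothesis H_swap : forall xs x y zs, good (xs ++ x :: y :: zs) ->
  H (xs ++ x :: y :: zs) = H (xs ++ y :: x :: zs).
Hypothesis H_line : forall x y a zs, good (x :: zs) -> K y -> 0 <= a ->
  H (line x y a :: zs) = H (x :: zs) + a * H (y :: zs).
Hypothesis H_diag : forall x, K x -> H (nseq d x) = 0.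

Lemma good_perm zs zs' : perm_eq zs zs' -> good zs -> good zs'.
Proof.
move=> zz' [sz Kz]; split; first by rewrite -(perm_size zz').
by move=> z; rewrite -(perm_mem zz'); exact: Kz.
Qed.

Lemma H_move xs x s r : good (xs ++ x :: s ++ r) ->
  H (xs ++ x :: s ++ r) = H (xs ++ s ++ x :: r).
Proof.
elim: s xs => [//|y s IH] xs g /=.
rewrite H_swap // -cat_rcons IH ?cat_rcons //.
apply: good_perm g; rewrite perm_cat2l /= -[x :: y :: _]cat1s -[x :: s ++ r]cat1s.
by rewrite -[y :: s ++ r]cat1s -[y :: [:: x] ++ s ++ r]cat1s perm_catCA.
Qed.

Lemma poly_nat_eq0 (p : {poly R}) : (forall n : nat, p.[n%:R] = 0) -> p = 0.
Proof.
move=> p0; apply/eqP; apply: contraT => pn0.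
have := max_poly_roots pn0 (rs := [seq n%:R | n <- iota 0 (size p)]).
rewrite size_map size_iota ltnn; apply.
  by apply/allP => _ /mapP[n _ ->]; rewrite rootE p0.
rewrite map_inj_uniq ?iota_uniq // => m n /eqP; by rewrite eqr_nat => /eqP.
Qed.

Lemma H_polar k rest : (k.+1 + size rest)%N = d -> (forall z, z \in rest -> K z) ->
  (forall x, K x -> H (nseq k.+1 x ++ rest) = 0) ->
  forall x y, K x -> K y -> H (nseq k x ++ y :: rest) = 0.
Proof.
move=> kd Kr H0 x y Kx Ky.
(* [H] vanishes on the powers of x + n y, which are polynomial in n; the
coefficient of n is a multiple of H(x^k, y). *)
pose h b := H (nseq b y ++ nseq (k.+1 - b) x ++ rest).
have Kw n : K (line x y n%:R) by exact: K_line.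
have gd a b c n : (a + b + c)%N = k.+1 ->
    good (nseq a (line x y n%:R) ++ nseq b y ++ nseq c x ++ rest).
  move=> abc; split; first by rewrite !size_cat !size_nseq !addnA abc.
  move=> z; rewrite !mem_cat !mem_nseq => /or4P[/andP[_ /eqP->]|/andP[_ /eqP->]|/andP[_ /eqP->]|/Kr] //.
have main a : forall b c, (a + b + c)%N = k.+1 -> exists p : {poly R},
    [/\ forall n : nat, p.[n%:R] = H (nseq a (line x y n%:R) ++ nseq b y ++ nseq c x ++ rest),
     p`_0 = h b & p`_1 = a%:R * h b.+1].
  elim: a => [|a IH] b c abc.
    exists (h b)%:P; rewrite !coefC mul0r; split=> // n.
    by rewrite hornerC /h -abc add0n addKn.
  have [p [pE p0 p1]] := IH b c.+1 ltac:(by rewrite addnS -abc !addSn).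
  have [q [qE q0 q1]] := IH b.+1 c ltac:(by rewrite addnS addSn -abc !addSn).
  exists (p + q * 'X); split.
  - move=> n; rewrite hornerD hornerMX pE qE.
    pose S := nseq a (line x y n%:R) ++ nseq b y ++ nseq c x ++ rest.
    rewrite -[RHS]/(H (line x y n%:R :: S)).
    have gS z : K z -> good (z :: S).
      move=> Kz; split; first by rewrite /= !size_cat !size_nseq -kd -abc !addSn !addnA.
      move=> z'; rewrite inE !mem_cat !mem_nseq => /orP[/eqP->//|].
      by move=> /or4P[/andP[_ /eqP->]|/andP[_ /eqP->]|/andP[_ /eqP->]|/Kr].
    rewrite H_line //; last exact: gS.
    have e1 : x :: S = [::] ++ x :: (nseq a (line x y n%:R) ++ nseq b y) ++ nseq c x ++ rest.
      by rewrite -catA.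
    have e2 : y :: S = [::] ++ y :: nseq a (line x y n%:R) ++ nseq b y ++ nseq c x ++ rest by [].
    rewrite e1 H_move -?e1; last exact: gS.
    rewrite e2 H_move -?e2; last exact: gS.
    by rewrite /= -catA mulrC.
  - by rewrite coefD coefMX p0 addr0.
  - by rewrite coefD coefMX p1 /= q0 mulrS mulrDl mul1r addrC.
have [p [pE p0 p1]] := main k.+1 0%N 0%N ltac:(by rewrite !addn0).
have pz : p = 0 by apply: poly_nat_eq0 => n; rewrite pE /= H0.
move: p1; rewrite pz coef0 => /esym/eqP; rewrite mulf_eq0 pnatr_eq0 /= => /eqP.
rewrite /h subSS subn0 /= => <-; apply/esym; apply: (@H_move [::]) => /=.
have := gd 0%N 1%N k 0%N; rewrite /=; apply; by rewrite add0n add1n.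
Qed.

Lemma polarization zs : (0 < d)%N -> good zs -> H zs = 0.
Proof.
move=> d0.
suff main m : (m <= d)%N -> forall rest, (d - m + size rest)%N = d ->
    (forall z, z \in rest -> K z) -> forall x, K x -> H (nseq (d - m) x ++ rest) = 0.
  case: zs => [|z zs] g; first by move: d0; case: g => /= <-.
  have [sz Kz] := g; have := @main d (leqnn d) (z :: zs).
  by rewrite subnn => h; apply: (h _ _ z) => //; apply: Kz; rewrite mem_head.
elim: m => [|m IH] md rest rd Kr x Kx.
  have : size rest = 0%N by move: rd; rewrite subn0; lia.
  by move/size0nil => ->; rewrite subn0 cats0 H_diag.
case: rest rd Kr => [|y rest] rd Kr; first by move: rd => /=; lia.
apply: H_polar => //.
- by move: rd => /=; lia.
- by move=> z zr; apply: Kr; rewrite inE zr orbT.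
- move=> x' Kx'; rewrite (_ : (d - m.+1).+1 = (d - m)%N); last by lia.
  apply: IH => //; first by lia.
    by move: rd => /=; lia.
  by move=> z zr; apply: Kr; rewrite inE zr orbT.
- by apply: Kr; rewrite mem_head.
Qed.

End Polarization.

Section MixedVolumeBox.
Variables (R : realType) (n : nat) (I : finType) (F : fan_data R n I).
Variable ip : {dot 'rV[R]_n for idfun}.
Variable s : {set I}.
Hypothesis s_indep : indep F s.
Implicit Types (z : I -> R).
Local Notation u := (mark F).

Lemma cubvec_ncone z (t : {set I}) : cubical F ip s z -> t \subset s -> ncone F ip z s (cubvec F ip z t).
Proof.
move=> cz ts; have ti := indepS ts s_indep; split.
  apply/(coneP ip) => //; split; first by apply: (cspanS ts); exact: cubvec_cspan.
  by move=> i is_; exact: cubvec_coord_ge0.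
move=> i is_; have [it_|it_] := boolP (i \in t); first by rewrite cubvec_ip.
rewrite -subr_ge0 ltW //; apply: (ell_gt0 s_indep cz) => //.
by apply/fintype.subsetP => j; rewrite !inE => /orP[/eqP->//|]; exact: (fintype.subsetP ts).
Qed.

Lemma ncone_hull z v : ncone F ip z s v -> exists l : {set I} -> R,
  [/\ forall t, 0 <= l t, \sum_t l t = 1, forall t, l t != 0 -> t \subset s &
   v = \sum_t l t *: cubvec F ip z t].
Proof.
move=> [/(coneP ip _ s_indep)[vs v0] vz].
have [||||||l [l0 l1 lt lv]] := @cubvec_hull _ _ _ F ip finset.set0 s z v; rewrite ?finset.set0U //.
- by move=> i; rewrite inE.
- by move=> i; rewrite inE.
by exists l; split=> // t /lt[_]; rewrite finset.set0U.
Qed.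

Lemma ncone_convex z (l : {set I} -> R) (f : {set I} -> 'rV[R]_n) :
  (forall t, 0 <= l t) -> \sum_t l t = 1 ->
  (forall t, l t != 0 -> ncone F ip z s (f t)) -> ncone F ip z s (\sum_t l t *: f t).
Proof.
move=> l0 l1 fP.
have ipE v : ip (\sum_t l t *: f t) v = \sum_t l t * ip (f t) v.
  rewrite (big_morph (ip ^~ v) (id1 := 0) (op1 := +%R)) => [|x y|]; rewrite ?ipDl ?ip0l //.
  by apply: eq_bigr => t _; rewrite ipZl.
split.
  apply/(coneP ip) => //; split.
    apply: memv_suml => t _; have [->|/fP[/(coneP ip _ s_indep)[ft _] _]] := eqVneq (l t) 0.
      by rewrite scale0r mem0v.
    exact: memvZ.
  move=> i is_; rewrite ipE sumr_ge0 // => t _.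
  have [->|/fP[/(coneP ip _ s_indep)[_ /(_ i is_) ft] _]] := eqVneq (l t) 0.
    by rewrite mul0r.
  exact: mulr_ge0.
move=> i is_; rewrite ipE -[leRHS]mul1r -l1 mulr_suml ler_sum // => t _.
have [->|/fP[_ /(_ i is_) ft]] := eqVneq (l t) 0; first by rewrite !mul0r.
exact: ler_wpM2l.
Qed.

Lemma ncone_line z1 z2 (a : R) : cubical F ip s z1 -> cubical F ip s z2 -> 0 <= a ->
  ncone F ip (line z1 z2 a) s =
  [set 1 *: x + a *: y | x in ncone F ip z1 s & y in ncone F ip z2 s].
Proof.
move=> c1 c2 a0; apply/seteqP; split=> v.
  move=> /ncone_hull[l [l0 l1 lt ->]].
  exists (\sum_t l t *: cubvec F ip z1 t).
    by apply: ncone_convex => // t /lt; exact: cubvec_ncone.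
  exists (\sum_t l t *: cubvec F ip z2 t).
    by apply: ncone_convex => // t /lt; exact: cubvec_ncone.
  rewrite !scaler_sumr -big_split /=; apply: eq_bigr => t _.
  have [->|/lt ts] := eqVneq (l t) 0; first by rewrite !scale0r !scaler0 addr0.
  rewrite /line cubvecD ?scalerDr ?scalerA 1?(mulrC _ (l t)) 1?(mulrC a) //.
  exact: indepS ts s_indep.
move=> [x [/(coneP ip _ s_indep)[xs x0] xz] [y [/(coneP ip _ s_indep)[ys y0] yz] <-]].
split.
  apply/(coneP ip) => //; split; first by rewrite memvD // memvZ.
  by move=> i is_; rewrite ipDl !ipZl addr_ge0 // mulr_ge0 // ?x0 ?y0.
by move=> i is_; rewrite ipDl !ipZl /line lerD // ler_wpM2l // ?xz ?yz.
Qed.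

Lemma cubical_line z1 z2 (a : R) : cubical F ip s z1 -> cubical F ip s z2 -> 0 <= a ->
  cubical F ip s (line z1 z2 a).
Proof.
move=> c1 c2 a0 t i ts it_; rewrite /line cubvecD; last exact: indepS ts s_indep.
by rewrite ipDl !ipZl mul1r ltr_pwDl ?c1 // mulr_ge0 // ltW // c2.
Qed.

Lemma polytope_ncone z : cubical F ip s z -> polytope_in F ip s (ncone F ip z s).
Proof.
move=> cz; split.
- by exists (cubvec F ip z finset.set0); apply: cubvec_ncone => //; exact: finset.sub0set.
- exists (\sum_(t : {set I}) ip (cubvec F ip z t) (cubvec F ip z t)).
  move=> v /ncone_hull[l [l0 l1 lt vE]].
  have h : 0 <= \sum_t l t * ip (cubvec F ip z t - v) (cubvec F ip z t - v).
    by rewrite sumr_ge0 // => t _; rewrite mulr_ge0 // ip_ge0.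
  have e : \sum_t l t * ip (cubvec F ip z t) v = ip v v.
    rewrite {2}vE (big_morph (ip ^~ v) (id1 := 0) (op1 := +%R)) => [|x y|]; rewrite ?ipDl ?ip0l //.
    by apply: eq_bigr => t _; rewrite ipZl.
  have : ip v v <= \sum_t l t * ip (cubvec F ip z t) (cubvec F ip z t).
    rewrite -subr_ge0; apply: (le_trans h); rewrite le_eqVlt; apply/orP; left; apply/eqP.
    transitivity (\sum_t (l t * ip (cubvec F ip z t) (cubvec F ip z t) - 2 * (l t * ip (cubvec F ip z t) v) + l t * ip v v)).
      apply: eq_bigr => t _; rewrite ipBl !ipBr (ipC ip v (cubvec _ _ _ _)); ring.
    by rewrite big_split /= -mulr_suml l1 sumrB -mulr_sumr e; ring.
  move=> /le_trans; apply; apply: ler_sum => t _; rewrite ler_piMl ?ip_ge0 //.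
  by rewrite -l1 (bigD1 t) //= lerDl sumr_ge0.
- pose a (q : I * bool) := if q.1 \in s then (if q.2 then u q.1 else - dual F ip s q.1) else 0.
  pose b (q : I * bool) := if (q.1 \in s) && q.2 then z q.1 else 0.
  exists #|{: I * bool}|, (fun j => a (enum_val j)), (fun j => b (enum_val j)).
  apply/seteqP; split=> v.
    move=> [/(coneP ip _ s_indep)[vs v0] vz]; split=> // j.
    case: (enum_val j) => i [] /=; rewrite /a /b /=; case: ifP => is_ /=; rewrite ?ip0r ?vz //.
    by rewrite -scaleN1r ipZr mulN1r oppr_le0 v0.
  move=> [vs h]; split.
    apply/(coneP ip) => //; split=> // i is_.
    have := h (enum_rank (i, false)); rewrite enum_rankK /a /b /= is_ /=.
    by rewrite -scaleN1r ipZr mulN1r oppr_le0.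
  move=> i is_; have := h (enum_rank (i, true)).
  by rewrite enum_rankK /a /b /= is_.
Qed.

Theorem mixed_volume_ncone m (M : ('I_m.+1 -> set 'rV[R]_n) -> R) zs :
  #|s| = m.+1 -> is_mixed_volume F ip s M -> size zs = m.+1 ->
  (forall z, z \in zs -> cubical F ip s z) ->
  M (fun k => ncone F ip (nth (fun=> 0) zs k) s) =
  cmv F ip (powerset s) (fun=> 1) finset.set0 zs.
Proof.
move=> sm [Mdiag Msym Mlin] sz Kz; apply/eqP; rewrite -subr_eq0; apply/eqP.
pose P z := ncone F ip z s.
pose N zs := M (fun k => P (nth (fun=> 0) zs k)).
apply: (@polarization _ _ m.+1 (cubical F ip s)
  (fun zs => N zs - cmv F ip (powerset s) (fun=> 1) finset.set0 zs)) => //.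
- by move=> x y a cx cy a0; exact: cubical_line.
- move=> xs x y ys [sxy Kxy]; rewrite mv_swap_cat; last 2 first.
  + exact: powerset_sub.
  + exact: powerset_indep.
  congr (_ - _).
  have i1 : (size xs < m.+1)%N by move: sxy; rewrite size_cat /=; lia.
  have i2 : ((size xs).+1 < m.+1)%N by move: sxy; rewrite size_cat /=; lia.
  have nth0' w w' : nth (fun=> 0) (xs ++ w :: w' :: ys) (size xs) = w.
    by rewrite nth_cat ltnn subnn.
  have nthS w w' : nth (fun=> 0) (xs ++ w :: w' :: ys) (size xs).+1 = w'.
    by rewrite nth_cat ltnNge leqnSn /= subSnn.
  rewrite /N -(Msym _ (tperm (Ordinal i1) (Ordinal i2))); last first.
    by move=> k; apply/polytope_ncone/Kxy/mem_nth; rewrite sxy.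
  congr M; apply/funext => k; congr P.
  case: tpermP => [->|->|/eqP k1 /eqP k2] /=.
  + by rewrite nth0' nthS.
  + by rewrite nth0' nthS.
  + rewrite !nth_cat; case: ltnP => // ks.
    have [k' ->] : exists k', (k - size xs)%N = k'.+2.
      exists (k - size xs).-2; move: k1 k2; rewrite -!val_eqE /=; lia.
    by [].
- move=> x y a ys [sxy Kxy] Ky a0; have cx : cubical F ip s x by apply: Kxy; rewrite mem_head.
  rewrite /line (@mvD _ _ _ F ip _ _ (@powerset_indep _ _ _ _ _ s_indep)); last by rewrite powersetE finset.sub0set.
  have -> : N (line x y a :: ys) = 1 * N (x :: ys) + a * N (y :: ys).
    pose Ps (k : 'I_m.+1) := P (nth (fun=> 0) (x :: ys) k).
    have E w : N (w :: ys) = M [eta Ps with ord0 |-> P w].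
      by congr M; apply/funext => -[[|k] km] /=; rewrite /Ps /=.
    rewrite !E -Mlin //.
    + by rewrite /P ncone_line.
    + by move=> k; apply/polytope_ncone/Kxy/mem_nth; rewrite sxy.
    + exact: polytope_ncone.
    + exact: polytope_ncone.
  by rewrite /line; ring.
- move=> x cx; rewrite -sm -(cvol_ncone s_indep cx) -(Mdiag _ (polytope_ncone cx)).
  apply/eqP; rewrite subr_eq0; apply/eqP; congr M; apply/funext => k.
  by rewrite nth_nseq sm ltn_ord.
Qed.

End MixedVolumeBox.

(** * Simplicial fans and their stars *)

Section FanCombinatorics.
Variables (R : realType) (n d : nat) (I : finType) (F : fan_data R n I).
Variable ip : {dot 'rV[R]_n for idfun}.
Hypothesis (hF : is_dfan F d) (hsimpl : simplicial F).
Implicit Types (s t r : {set I}) (z : I -> R).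
Local Notation u := (mark F).
Let fanF := proj1 hF.

Lemma cones_indep s : s \in cones F -> indep F s.
Proof. by move=> /hsimpl; exact: indep_cdim. Qed.

Lemma mark_cone s i : i \in s -> cone F s (u i).
Proof.
move=> is_; exists (fun k => (k == i)%:R); split; first by move=> k; case: (_ == _).
rewrite (bigD1 i) //= eqxx scale1r big1 ?addr0 // => k /andP[_ /negbTE->].
by rewrite scale0r.
Qed.

Lemma coneS s t : s \subset t -> cone F s `<=` cone F t.
Proof.
move=> st v [a [a0 ->]]; exists (fun i => if i \in s then a i else 0); split.
  by move=> i; case: ifP.
rewrite [in RHS](big_setID s) /= (finset.setIidPr st) [X in _ + X]big1 ?addr0.
  by apply: eq_bigr => i ->.
by move=> i; rewrite inE => /andP[/negbTE-> _]; rewrite scale0r.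
Qed.

Lemma cone1P i v : cone F [set i]%SET v <-> exists2 c, 0 <= c & v = c *: u i.
Proof.
split=> [[a [a0 ->]]|[c c0 ->]]; first by exists (a i); rewrite ?big_set1.
by exists (fun=> c); split=> //; rewrite big_set1.
Qed.

Lemma cone_rays_sub s t :
  (forall i, i \in s -> i \in rays F /\ face (cone F [set i]%SET) (cone F s)) ->
  (forall i, i \in t -> i \in rays F) -> cone F s = cone F t -> s \subset t.
Proof.
move=> sr tr st; apply/fintype.subsetP => i is_.
have [ir [l [l0 lE]]] := sr _ is_; rewrite st in l0 lE.
have ui0 := fan_mark fanF ir.
have : cone F t (u i) by rewrite -st; exact: mark_cone.
move=> [a [a0 uE]].
have li : l (u i) = 0.
  have : cone F [set i]%SET (u i) by apply: mark_cone; rewrite inE.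
  by rewrite lE => -[].
have [k kt ak] : exists2 k, k \in t & a k != 0.
  apply/exists_inP; apply: contraNT ui0; rewrite negb_exists_in => /forall_inP h.
  rewrite uE big1 // => k /h; rewrite negbK => /eqP->; exact: scale0r.
have lk : l (u k) = 0.
  have : \sum_(j in t) a j * l (u j) = 0.
    rewrite -[RHS]li [in RHS]uE linear_sum; apply: eq_bigr => j _; by rewrite linearZ.
  move/eqP; rewrite psumr_eq0 => [/allP/(_ k (mem_index_enum _))|j jt].
    by rewrite kt /= mulf_eq0 (negbTE ak) => /eqP.
  by rewrite mulr_ge0 // l0 //; exact: mark_cone.
have : cone F [set i]%SET (u k) by rewrite lE; split=> //; exact: mark_cone.
move=> /cone1P[c c0 uk].
have uk0 := fan_mark fanF (tr _ kt).
have cn0 : c != 0 by apply: contraNneq uk0 => c00; rewrite uk c00 scale0r.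
suff -> : i = k by [].
apply: (fan_inj fanF ir (tr _ kt)); apply/seteqP; split=> v /cone1P[b b0 ->]; apply/cone1P.
  by exists (b / c); [exact: divr_ge0 | rewrite uk scalerA divfK].
by exists (b * c); [exact: mulr_ge0 | rewrite uk scalerA].
Qed.

Lemma cones_rays s i : s \in cones F -> i \in s ->
  i \in rays F /\ face (cone F [set i]%SET) (cone F s).
Proof. exact: (fan_rays fanF). Qed.

Lemma sub_cones_rays s t i : s \in cones F -> t \subset s -> i \in t ->
  i \in rays F /\ face (cone F [set i]%SET) (cone F t).
Proof.
move=> sC ts it_; have [ir [l [l0 lE]]] := cones_rays sC (fintype.subsetP ts _ it_).
split=> //; exists l; split=> [v /(coneS ts)/l0//|].
apply/seteqP; split=> v /=.
  move=> vi; split; first by apply: coneS vi; rewrite finset.sub1set.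
  by move: vi; rewrite lE => -[].
by move=> [/(coneS ts) vs lv]; rewrite lE.
Qed.

Lemma cones_cone_inj s t t' : s \in cones F -> t \subset s -> t' \in cones F ->
  cone F t' = cone F t -> t' = t.
Proof.
move=> sC ts t'C tt'; apply/eqP; rewrite finset.eqEsubset; apply/andP; split.
  apply: cone_rays_sub => // i; first exact: cones_rays.
  by move=> /(sub_cones_rays sC ts)[].
apply: cone_rays_sub => // i; first exact: (sub_cones_rays sC ts).
by move=> /(cones_rays t'C)[].
Qed.

Lemma cones_sub s t : s \in cones F -> t \subset s -> t \in cones F.
Proof.
move=> sC ts; have si := cones_indep sC.
pose w : 'rV[R]_n := \sum_(k in s :\: t) dual F ip s k.
pose f (v : 'rV[R]_n) : R := ip v w.
have fl : scalar f by move=> a v v'; rewrite /f ipDl ipZl.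
pose l : {scalar 'rV[R]_n} := HB.pack f (GRing.isLinear.Build _ _ _ _ f fl).
have lE v : l v = \sum_(k in s :\: t) ip v (dual F ip s k) by rewrite /= /f /w ip_sumr.
have : face (cone F t) (cone F s).
  exists l; split=> [v /(coneP ip _ si)[_ v0]|].
    by rewrite lE sumr_ge0 // => k; rewrite inE => /andP[_ /v0].
  apply/seteqP; split=> v /=.
    move=> [a [a0 ->]]; split.
      by apply: (coneS ts); exists a.
    rewrite -[LHS]/(l _) lE big1 // => k; rewrite inE => /andP[kt ks].
    rewrite ip_suml big1 // => j jt; rewrite ipZl (ipC ip (u j)).
    rewrite dualE // ?(fintype.subsetP ts _ jt) //.
    by case: eqP => [kj|_]; rewrite ?mulr0 //; rewrite kj jt in kt.
  move=> [/(coneP ip _ si)[vs v0] lv].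
  have vk k : k \in s -> k \notin t -> ip v (dual F ip s k) = 0.
    move=> ks kt; move: lv; rewrite -[f v]/(l v) lE => /eqP.
    rewrite psumr_eq0 => [/allP/(_ k (mem_index_enum _))|j]; rewrite inE ?kt ?ks /=.
      by move=> /eqP.
    by move=> /andP[_ /v0].
  exists (fun i => if i \in t then ip v (dual F ip s i) else 0); split.
    by move=> i; case: ifP => // it_; apply/v0/(fintype.subsetP ts).
  rewrite {1}(coordP ip si vs) (big_setID t) /= (finset.setIidPr ts) [X in _ + X]big1 ?addr0.
    by apply: eq_bigr => i ->.
  by move=> i; rewrite inE => /andP[it_ is_]; rewrite vk // scale0r.
move=> /(fan_face fanF sC)[t' t'C tt'].
by rewrite -(cones_cone_inj sC ts t'C (esym tt')).
Qed.

Lemma set0_cones : finset.set0 \in cones F.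
Proof.
have /set0Pn[s sC] := fan_nonempty fanF.
by apply: cones_sub sC _; exact: finset.sub0set.
Qed.

Lemma face_sub s (A : set 'rV[R]_n) : s \in cones F -> face A (cone F s) ->
  exists2 r : {set I}, r \subset s & A = cone F r.
Proof.
move=> sC [l [l0 ->]]; exists [set k in s | l (u k) == 0]%SET.
  by apply/fintype.subsetP => k; rewrite inE => /andP[].
apply/seteqP; split=> v /=.
  move=> [[a [a0 ->]]]; rewrite linear_sum => /eqP.
  have H j : j \in s -> 0 <= a j * l (u j) by move=> js; rewrite mulr_ge0 // l0 //; exact: mark_cone.
  under eq_bigr do rewrite linearZ /=.
  rewrite psumr_eq0 // => /allP h.
  exists (fun i => if i \in [set k in s | l (u k) == 0]%SET then a i else 0); split.
    by move=> i; case: ifP.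
  rewrite [LHS](bigID (fun k => l (u k) == 0)) /= [X in _ + X]big1 ?addr0.
    apply: eq_big => k; first by rewrite inE.
    by rewrite inE => ->.
  move=> k /andP[ks lk]; have := h k (mem_index_enum _).
  by rewrite ks /= mulf_eq0 (negbTE lk) orbF => /eqP->; rewrite scale0r.
move=> [a [a0 ->]]; split.
  apply: (@coneS [set k in s | l (u k) == 0]%SET); last by exists a.
  by apply/fintype.subsetP => k; rewrite inE => /andP[].
rewrite linear_sum big1 // => k; rewrite inE => /andP[_ /eqP lk].
by rewrite linearZ /= lk mulr0.
Qed.

Lemma coneI s t : s \in cones F -> t \in cones F ->
  cone F s `&` cone F t `<=` cone F (s :&: t).
Proof.
move=> sC tC; have [fs ft] := fan_inter fanF sC tC.
have [r rs rE] := face_sub sC fs; have [r' r't r'E] := face_sub tC ft.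
have rr' : r = r'.
  by apply: (cones_cone_inj tC r't (cones_sub sC rs)); rewrite -rE r'E.
rewrite rE; apply: coneS; rewrite finset.subsetI rs rr' //.
Qed.

Lemma cone_sub s t : s \in cones F -> t \in cones F -> cone F s `<=` cone F t -> s \subset t.
Proof.
move=> sC tC st; have [_ ft] := fan_inter fanF sC tC.
have [r rt rE] := face_sub tC ft.
rewrite (cones_cone_inj tC rt sC) // -rE.
by apply/seteqP; split=> v; [move=> vs; split=> //; exact: st | case].
Qed.

Lemma cones_max s : s \in cones F -> exists t, [/\ t \in cones F, s \subset t & #|t| = d].
Proof.
move=> sC; pose P t := (t \in cones F) && (s \subset t).
have Ps : P s by rewrite /P sC subxx.
case: (arg_maxnP (fun t : {set I} => #|t|) Ps) => t /andP[tC st] tmax.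
exists t; split=> //; rewrite -(hsimpl tC); apply: (proj2 hF) => // t' t'C tt'.
have {}tt' := cone_sub tC t'C tt'.
apply/eqP; rewrite eqEcard tt' /=; apply: tmax.
by rewrite /P t'C; exact: fintype.subset_trans st tt'.
Qed.

Lemma cones_extend s : s \in cones F -> (#|s| < d)%N ->
  exists i, (i \notin s) && (i |: s \in cones F).
Proof.
move=> sC sd; have [t [tC st td]] := cones_max sC.
have ts0 : t :\: s != finset.set0.
  apply: contraTneq sd => /eqP; rewrite finset.setD_eq0 => /subset_leq_card.
  by rewrite td -leqNgt.
case/set0Pn: ts0 => i; rewrite inE => /andP[is_ it_]; exists i; rewrite is_ /=.
apply: cones_sub tC _.
by apply/fintype.subsetP => j; rewrite !inE => /orP[/eqP->//|]; exact: (fintype.subsetP st).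
Qed.

End FanCombinatorics.

Section Quadratic.
Variables (R : realType) (m : nat).
Import -(notations) mpoly.

Lemma mderiv_var (a i : 'I_m) :
  mderiv i (mpolyX R (mnm1 a)) = (a == i)%:R *: (1 : mpoly m R).
Proof.
rewrite mderivX mnm1E; case: eqP => [->|_]; last by rewrite !scale0r.
by rewrite -mpolyX0; congr (_ *: mpolyX _ _); apply/mnmP => j; rewrite mnmBE subnn mnm0E.
Qed.

Lemma mdeg2 (k : multinom m) : mdeg k = 2%N -> exists a b, k = mnm_add (mnm1 a) (mnm1 b).
Proof.
move=> k2; have [a ka] : exists a, (0 < k a)%N.
  apply/existsP; apply: contraPT k2; rewrite negb_exists => /forallP h.
  rewrite mdegE big1 // => i _; apply/eqP; by have := h i; rewrite -eqn0Ngt.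
have kE : k = mnm_add (mnm_sub k (mnm1 a)) (mnm1 a).
  by apply/mnmP => i; rewrite mnmDE mnmBE mnm1E; case: eqP => [<-|_]; rewrite ?subn0 ?addn0 ?subnK.
have := congr1 (@mdeg m) kE.
rewrite mdegD mdeg1 k2 addn1 => -[] /esym/eqP/mdeg1P[b /eqP kb].
by exists b, a; rewrite -kb.
Qed.

Lemma hessianE (p : mpoly m R) x : p \is ishomog1 2 mdeg ->
  meval x p = 2^-1 * \sum_i \sum_j hessian p (fun=> 0) i j * (x i * x j).
Proof.
move=> /dhomogP hp.
pose h (q : mpoly m R) := 2^-1 * \sum_i \sum_j hessian q (fun=> 0) i j * (x i * x j).
rewrite -[RHS]/(h p).
have hD : {morph h : q r / q + r}.
  move=> q r; rewrite /h -mulrDr -big_split; congr (_ * _); apply: eq_bigr => k _ /=.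
  rewrite -big_split; apply: eq_bigr => l _ /=.
  by rewrite !mxE !mderivD mevalD mulrDl.
have h0 : h 0 = 0.
  rewrite /h big1 ?mulr0 // => k _; rewrite big1 // => l _.
  by rewrite mxE !mderiv0 meval0 mul0r.
have hZ (c : R) (q : mpoly m R) : h (c *: q) = c * h q.
  rewrite /h mulrCA; congr (_ * _); rewrite mulr_sumr; apply: eq_bigr => k _.
  rewrite mulr_sumr; apply: eq_bigr => l _.
  have -> : hessian (c *: q) (fun=> 0) k l = c * hessian q (fun=> 0) k l; last exact/esym/mulrA.
  rewrite !mxE (mderivZ k c q) (mderivZ l c (mderiv k q)).
  exact: mevalZ.
rewrite (mpolyE p) raddf_sum (big_morph h hD h0) /= big_seq [RHS]big_seq.
apply: eq_bigr => k /hp /mdeg2[a [b ->]].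
rewrite hZ mevalZ; congr (_ * _).
rewrite mpolyXD mevalM !mevalXU /h.
transitivity (2^-1 * \sum_i \sum_j ((a == i)%:R * (b == j)%:R + (a == j)%:R * (b == i)%:R) * (x i * x j)).
  under eq_bigr do under eq_bigr do rewrite mulrDl.
  under eq_bigr do rewrite big_split.
  rewrite big_split /=.
  have H (c d : 'I_m) : \sum_i \sum_j (c == i)%:R * (d == j)%:R * (x i * x j) = x c * x d.
    rewrite (bigD1 c) //= (bigD1 d) //= !eqxx !mul1r.
    rewrite [X in _ + X + _]big1 => [|j /negbTE]; last by rewrite eq_sym => ->; rewrite mulr0 mul0r.
    rewrite big1 => [|i' /negbTE]; first by rewrite !addr0.
    by rewrite eq_sym => ->; rewrite big1 // => j _; rewrite !mul0r.
  rewrite H (eq_bigr (fun i => \sum_j (b == i)%:R * (a == j)%:R * (x i * x j))) => [|k' _].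
    by rewrite H; field.
  by apply: eq_bigr => l _; rewrite (mulrC (a == l)%:R).
congr (_ * _); apply: eq_bigr => k' _; apply: eq_bigr => l _; congr (_ * _).
rewrite mxE mderivM !mderiv_var -!scalerAl -!scalerAr mul1r mulr1 mderivD !mderivZ !mderiv_var.
have ZZ (c d : R) : meval (fun=> 0) (c *: (d *: (1 : mpoly m R))) = c * d.
  by apply: etrans (mevalZ _ _ _) _; congr (_ * _); apply: etrans (mevalZ _ _ _) _; rewrite meval1 mulr1.
apply/esym/(etrans (mevalD _ _ _)); rewrite addrC; apply: etrans (congr2 +%R (ZZ _ _) (ZZ _ _)) _.
by rewrite addrC (mulrC (b == k')%:R).
Qed.


Lemma form_eq0 (B : 'M[R]_m) (x0 : 'I_m -> R) (e : R) : B^T = B -> 0 < e ->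
  (forall x, (forall i, `|x i - x0 i| <= e) -> \sum_i \sum_j B i j * (x i * x j) = 0) ->
  B = 0.
Proof.
move=> Bs e0 H.
pose Q (x y : 'I_m -> R) := \sum_i \sum_j B i j * (x i * y j).
have QC x y : Q x y = Q y x.
  rewrite /Q exchange_big; apply: eq_bigr => i _; apply: eq_bigr => j _ /=.
  by rewrite -{1}Bs mxE (mulrC (x _)).
have QD x y (a b : R) z : Q (fun i => a * x i + b * y i) z = a * Q x z + b * Q y z.
  rewrite /Q !mulr_sumr -big_split; apply: eq_bigr => i _ /=.
  rewrite !mulr_sumr -big_split; apply: eq_bigr => j _ /=; ring.
have QQ x y (a b : R) : Q (fun i => a * x i + b * y i) (fun i => a * x i + b * y i) =
    a * (a * Q x x + b * Q x y) + b * (a * Q x y + b * Q y y).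
  by rewrite QD QC QD [X in _ + _ * X]QC QD (QC y x).
have Q0 y : (forall i, `|y i| <= 1) -> Q y y = 0.
  move=> y1; have h0 : Q x0 x0 = 0 by apply: H => i; rewrite subrr normr0 ltW.
  have h (c : R) : `|c| <= e -> Q (fun i => 1 * x0 i + c * y i) (fun i => 1 * x0 i + c * y i) = 0.
    move=> ce; apply: H => i; rewrite mul1r addrC addKr normrM -[e]mulr1; exact: ler_pM.
  have h1 := h e ltac:(by rewrite gtr0_norm).
  have h2 := h (- e) ltac:(by rewrite normrN gtr0_norm).
  move: h1 h2; rewrite !QQ h0 => h1 h2.
  have : (e * e) * Q y y = 0 by move: h1 h2; lra.
  by move/eqP; rewrite !mulf_eq0 gt_eqF //= => /eqP.
pose d (k : 'I_m) : 'I_m -> R := fun i => (i == k)%:R.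
have Qd k l : Q (d k) (d l) = B k l.
  rewrite /Q (bigD1 k) //= (bigD1 l) //= /d !eqxx !mulr1.
  rewrite [X in _ + X + _]big1 => [|j /negbTE->]; last by rewrite !mulr0.
  rewrite big1 ?addr0 // => i /negbTE ik; rewrite big1 // => j _.
  by rewrite ik mul0r mulr0.
have dN k i : `|d k i| <= 1 by rewrite /d; case: (_ == _); rewrite ?normr0 ?normr1.
apply/matrixP => k l; rewrite mxE -Qd.
have [->|kl] := eqVneq k l; first by apply: Q0.
have := Q0 (fun i => 1 * d k i + 1 * d l i).
rewrite QQ (Q0 (d k)) // (Q0 (d l)) // => h.
suff /h : forall i, `|1 * d k i + 1 * d l i| <= 1 by lra.
move=> i; rewrite !mul1r /d; have [->|ik] := eqVneq i k; first by rewrite (negbTE kl) addr0 normr1.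
by rewrite add0r; case: (_ == _); rewrite ?normr0 ?normr1.
Qed.

Lemma quadratic_hessian (p : mpoly m R) (B : 'M[R]_m) (x0 : 'I_m -> R) (e : R) :
  B^T = B -> 0 < e -> p \is ishomog1 2 mdeg ->
  (forall x, (forall i, `|x i - x0 i| <= e) ->
    meval x p = \sum_i \sum_j B i j * (x i * x j)) ->
  hessian p (fun=> 0) = 2 *: B.
Proof.
move=> Bs e0 ph H.
suff : 2^-1 *: hessian p (fun=> 0) - B = 0.
  move/eqP; rewrite subr_eq0 => /eqP <-; by rewrite scalerA divff ?scale1r.
apply: (@form_eq0 _ x0 e) => //.
  rewrite linearB linearZ /= Bs; congr (_ *: _ - _).
  by apply/matrixP => i j; rewrite !mxE mderiv_comm.
move=> x hx; rewrite (eq_bigr (fun i => 2^-1 * (\sum_j hessian p (fun=> 0) i j * (x i * x j)) - \sum_j B i j * (x i * x j))).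
  rewrite sumrB -mulr_sumr -hessianE // H // subrr //.
move=> i _; rewrite mulr_sumr -sumrB; apply: eq_bigr => j _.
by rewrite !mxE; ring.
Qed.

Lemma quadratic_poly (B : 'M[R]_m) : exists2 p : mpoly m R, p \is ishomog1 2 mdeg &
  forall x, meval x p = \sum_i \sum_j B i j * (x i * x j).
Proof.
exists (\sum_i \sum_j B i j *: (mpolyX R (mnm1 i) * mpolyX R (mnm1 j))).
  apply: rpred_sum => i _; apply: rpred_sum => j _; apply: rpredZ.
  rewrite -mpolyXD dhomogX; apply/eqP; exact: (etrans (mdegD _ _) (congr2 addn (mdeg1 _) (mdeg1 _))).
move=> x; rewrite raddf_sum; apply: eq_bigr => i _; rewrite raddf_sum; apply: eq_bigr => j _ /=.
by rewrite mevalZ mevalM !mevalXU.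
Qed.

End Quadratic.

Section SimplicialVolume.
Import -(notations) mpoly.
Variables (R : realType) (n : nat) (I : finType) (F : fan_data R n I).
Variable ip : {dot 'rV[R]_n for idfun}.
Variable w : {set I} -> R.
Hypothesis C_sub : forall s t : {set I}, s \in cones F -> t \subset s -> t \in cones F.
Hypothesis C_indep : forall s : {set I}, s \in cones F -> indep F s.
Hypothesis s0C : finset.set0 \in cones F.
Implicit Types (s t : {set I}) (z : I -> R).
Local Notation u := (mark F).
Local Notation mv := (cmv F ip (cones F) w).

Lemma cdim_indep s : indep F s -> cdim F s = #|s|.
Proof.
move=> si; suff : free (image_tuple u (mem s)) by rewrite /free size_tuple => /eqP.
apply/freeP => k k0 j.
have jm : enum_val j \in s := enum_valP j.
pose a i := if [pick l | enum_val l == i] is Some l then k l else 0.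
have aE (l : 'I_#|s|) : a (enum_val l) = k l.
  rewrite /a; case: pickP => [l'|/(_ l)]; last by rewrite eqxx.
  by move=> /eqP/enum_val_inj->.
rewrite -aE; apply: si => //; rewrite -[RHS]k0 big_enum_val; apply: eq_bigr => l _.
by rewrite aE nth_image.
Qed.

Lemma CubP z : Cub F ip z <-> forall s, s \in cones F -> cubical F ip s z.
Proof.
split=> [cz s sC t i ts it_|cz s sC].
  have tC := C_sub sC ts.
  by have /(relintP ip _ (C_indep tC))[_ ->] := cz t tC.
apply/(relintP ip _ (C_indep sC)); split; first by apply/cubvec_cspan/C_indep.
by move=> i is_; exact: (cz s sC s i (subxx _) is_).
Qed.

Lemma mem_rays s i : s \in cones F -> i \in s -> i \in rays F.
Proof. by move=> sC is_; rewrite inE; apply: C_sub sC _; rewrite finset.sub1set. Qed.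

Lemma Cub_open z : Cub F ip z -> exists2 e : R, 0 < e &
  forall z', (forall k, k \in rays F -> `|z' k - z k| <= e) -> Cub F ip z'.
Proof.
move=> /CubP cz.
have H s : exists e : R, 0 < e /\ (s \in cones F ->
    forall z', (forall k, k \in rays F -> `|z' k - z k| <= e) -> cubical F ip s z').
  have [sC|_] := boolP (s \in cones F); last by exists 1.
  have [e e0 eP] := cubical_open (C_indep sC) (cz s sC).
  by exists e; split=> // _ z' h; apply: eP => k ks; apply: h; exact: mem_rays ks.
have [e eP] := choice H; exists (\big[Num.min/1]_s e s).
  by apply: (big_ind (fun x => 0 < x)) => // [x y x0 y0|s _]; [rewrite lt_min x0 | case: (eP s)].
move=> z' h; apply/CubP => s sC; apply: (proj2 (eP s)) => // k /h/le_trans; apply.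
exact: (@bigmin_le_cond _ _ _ 1 s).
Qed.

Lemma fanVolE d z : Cub F ip z -> fanVol F ip w d z = mv finset.set0 (nseq d z).
Proof.
move=> /CubP cz; rewrite mv_decomp // /fanVol size_nseq finset.cards0 add0n.
apply: eq_big => [s|s /andP[sC]].
  by rewrite finset.sub0set andbT; case: (boolP (s \in cones F)) => // /C_indep/cdim_indep->.
rewrite (cdim_indep (C_indep sC)) => /eqP sd.
by rewrite cvol_ncone ?sd //; [exact: C_indep | exact: cz].
Qed.

Definition basis_fun (k : I) : I -> R := fun i => (i == k)%:R.

Lemma ell_sum t i z (A : {set I}) : indep F t -> t \subset A -> i \in A ->
  ell F ip t i z = \sum_(k in A) z k * ell F ip t i (basis_fun k).
Proof.
move=> ti tA iA.
have H z' : ell F ip t i z' = z' i - \sum_(j in t) z' j * ip (dual F ip t j) (u i).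
  rewrite /ell cubvecE // ip_suml; congr (_ - _); apply: eq_bigr => j _; exact: ipZl.
rewrite [LHS]H [RHS](eq_bigr (fun k => z k * (basis_fun k i) -
  z k * \sum_(j in t) basis_fun k j * ip (dual F ip t j) (u i))); last first.
  by move=> k _; rewrite H mulrBr.
rewrite sumrB; congr (_ - _).
  rewrite (bigD1 i) //= /basis_fun eqxx mulr1 big1 ?addr0 // => k /andP[_ /negbTE].
  by rewrite eq_sym => ->; rewrite mulr0.
under [RHS]eq_bigr do rewrite mulr_sumr.
rewrite exchange_big /=; apply: eq_bigr => j jt.
rewrite (bigD1 j) /=; last exact: (fintype.subsetP tA).
rewrite /basis_fun eqxx mul1r big1 ?addr0 // => k /andP[_ /negbTE].
by rewrite eq_sym => ->; rewrite mul0r mulr0.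
Qed.

Lemma mv_sum t z zs : t \in cones F ->
  mv t (z :: zs) = \sum_(k in rays F) z k * mv t (basis_fun k :: zs).
Proof.
move=> tC /=; under [RHS]eq_bigr do rewrite mulr_sumr.
rewrite exchange_big /=; apply: eq_bigr => i /andP[_ itC].
rewrite (@ell_sum t i z (rays F)) ?mulr_suml //; first by apply: eq_bigr => k _; rewrite mulrA.
- exact: C_indep.
- by apply/fintype.subsetP => j; exact: mem_rays.
by apply: mem_rays itC _; exact: setU11.
Qed.

Definition mv_mx : 'M[R]_#|rays F| :=
  \matrix_(i, j) mv finset.set0 [:: basis_fun (enum_val i); basis_fun (enum_val j)].

Lemma mv_mxE x y : mv finset.set0 [:: x; y] =
  \sum_i \sum_j mv_mx i j * (x (enum_val i) * y (enum_val j)).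
Proof.
rewrite mv_sum // big_enum_val; apply: eq_bigr => i _.
rewrite mv_swap // mv_sum // big_enum_val mulr_sumr; apply: eq_bigr => j _.
by rewrite mxE mv_swap //; ring.
Qed.

Lemma mv_mx_sym : mv_mx^T = mv_mx.
Proof. by apply/matrixP => i j; rewrite !mxE mv_swap. Qed.

Lemma hessian_fanVol : Cub F ip !=set0 ->
  hessian (fanVol_poly F ip w 2) (fun=> 0) = 2 *: mv_mx.
Proof.
move=> [z0 cz0]; have [e e0 eP] := Cub_open cz0.
have [p ph pE] := quadratic_poly mv_mx.
have [qh qE] : fanVol_poly F ip w 2 \is ishomog1 2 mdeg /\
    forall z, Cub F ip z -> meval (fun j => z (enum_val j)) (fanVol_poly F ip w 2) = fanVol F ip w 2 z.
  rewrite /fanVol_poly; case: xgetP => [q _ //|/(_ p)]; case; split=> // z cz.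
  by rewrite fanVolE // mv_mxE pE.
apply: (quadratic_hessian (x0 := fun j => z0 (enum_val j)) mv_mx_sym e0 qh) => x xP.
pose z k := \sum_j if enum_val j == k then x j else 0.
have zE j : z (enum_val j) = x j.
  rewrite /z (bigD1 j) //= eqxx big1 ?addr0 // => k /negbTE kj.
  by rewrite (inj_eq enum_val_inj) kj.
have cz : Cub F ip z.
  apply: eP => k kr; have [j ->] : exists j : 'I_#|rays F|, k = enum_val j.
    by exists (enum_rank_in kr k); rewrite enum_rankK_in.
  by rewrite zE.
have := qE z cz; rewrite fanVolE // mv_mxE.
have -> : (fun j => z (enum_val j)) = x by apply/funext.
by move=> ->; apply: eq_bigr => i _; apply: eq_bigr => j _; rewrite !zE.
Qed.

Lemma hessian_AF : Cub F ip !=set0 ->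
  one_positive_eigenvalue (hessian (fanVol_poly F ip w 2) (fun=> 0)) ->
  forall x y, 0 < mv finset.set0 [:: x; x] ->
  mv finset.set0 [:: x; x] * mv finset.set0 [:: y; y] <= mv finset.set0 [:: x; y] ^+ 2.
Proof.
move=> cF; rewrite hessian_fanVol // => h x y.
have hs : (2 *: mv_mx)^T = 2 *: mv_mx by rewrite linearZ /= mv_mx_sym.
have [f0 f0P] := one_positive_eigenline hs h.
pose row_of z : 'rV[R]_#|rays F| := \row_j z (enum_val j).
have E x' y' : bform (2 *: mv_mx) (row_of x') (row_of y') = 2 * mv finset.set0 [:: x'; y'].
  rewrite bformE mv_mxE mulr_sumr; apply: eq_bigr => i _.
  by rewrite mulr_sumr; apply: eq_bigr => j _; rewrite /row_of !mxE; ring.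
have := @reverse_CS _ _ _ f0 (row_of x) (row_of y) hs f0P.
rewrite !E => H xx; have /H : 0 < 2 * mv finset.set0 [:: x; x] by rewrite mulr_gt0.
set a := mv _ _; set b := mv _ _; set c := mv _ _; nra.
Qed.

End SimplicialVolume.

Lemma cmv_cons (R : realType) (n : nat) (I : finType) (F : fan_data R n I)
    (ip : {dot 'rV[R]_n for idfun}) C wt (t : {set I}) z zs :
  cmv F ip C wt t (z :: zs) =
  \sum_(i | (i \notin t) && (i |: t \in C)) ell F ip t i z * cmv F ip C wt (i |: t) zs.
Proof. by []. Qed.

Section Star.
Variables (R : realType) (n : nat) (I : finType) (F : fan_data R n I).
Variable ip : {dot 'rV[R]_n for idfun}.
Hypothesis C_sub : forall s t : {set I}, s \in cones F -> t \subset s -> t \in cones F.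
Hypothesis C_indep : forall s : {set I}, s \in cones F -> indep F s.
Variable t : {set I}.
Hypothesis tC : t \in cones F.
Implicit Types (s q : {set I}) (z : I -> R).
Local Notation u := (mark F).
Local Notation S := (star F ip t).

Lemma mem_star q : q \in cones S = (q :&: t == finset.set0) && (q :|: t \in cones F).
Proof.
apply/finset.imsetP/andP => [[p]|[/eqP qt qtC]].
  rewrite inE => /andP[pC /exists_inP[s sC /andP[ts ps]]] ->; split.
    by apply/eqP/setP => i; rewrite !inE; case: (i \in t); rewrite //= andbF.
  apply: C_sub sC _; rewrite finset.subUset ts andbT.
  exact: fintype.subset_trans (finset.subsetDl _ _) ps.
have qD i : i \in q -> i \notin t.
  by move=> iq; apply/negP => it_; have := finset.in_set0 i; rewrite -qt inE iq it_.
exists (q :|: t); last first.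
  apply/setP => i; rewrite !inE; case: (boolP (i \in q)) => [/qD->//|_].
  by case: (i \in t).
rewrite inE qtC; apply/exists_inP; exists (q :|: t) => //.
by rewrite subxx finset.subsetUr.
Qed.

Lemma star_disj q i : q \in cones S -> i \in q -> i \notin t.
Proof.
rewrite mem_star => /andP[/eqP qt _] iq; apply/negP => it_.
by have := finset.in_set0 i; rewrite -qt inE iq it_.
Qed.

Lemma star_cone q : q \in cones S -> q :|: t \in cones F.
Proof. by rewrite mem_star => /andP[]. Qed.

Lemma star_sub q s : q \in cones S -> s \subset q -> s \in cones S.
Proof.
rewrite !mem_star => /andP[/eqP qt qtC] sq; rewrite (C_sub qtC) ?finset.setSU // andbT.
by rewrite -finset.subset0 -qt finset.setSI.
Qed.

Lemma star_set0 : finset.set0 \in cones S.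
Proof. by rewrite mem_star finset.set0I eqxx finset.set0U. Qed.

Lemma star_mem_rays i : (i \in rays S) = (i \notin t) && (i |: t \in cones F).
Proof.
rewrite inE mem_star; congr (_ && _).
by rewrite finset.setI_eq0 finset.disjoints1.
Qed.

Lemma pr_sum q (a : I -> R) : \sum_(i in q) a i *: mark S i = pr F ip t (\sum_(i in q) a i *: u i).
Proof. by rewrite /pr linear_sum; apply: eq_bigr => i _; rewrite linearZ. Qed.

Lemma pr_eq_coef q q' (a b : I -> R) : \sum_(i in q) a i *: mark S i = \sum_(i in q') b i *: mark S i ->
  (exists c e : I -> R, [/\ forall i, 0 <= c i, forall i, 0 <= e i &
    \sum_(i in q) a i *: u i + \sum_(i in t) c i *: u i =
    \sum_(i in q') b i *: u i + \sum_(i in t) e i *: u i]).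
Proof.
rewrite !pr_sum => /eqP; rewrite -subr_eq0 -linearB => /eqP pr0.
have := pr_sub F ip t (\sum_(i in q) a i *: u i - \sum_(i in q') b i *: u i).
rewrite [pr F ip t _]pr0 subr0 => /cspanP[c cE].
exists (fun i => Num.max 0 (- c i)), (fun i => Num.max 0 (c i)); split=> [i|i|]; rewrite ?le_max ?lexx //.
apply/eqP; rewrite -subr_eq0 opprD addrACA cE -sumrB -big_split big1 // => i _ /=.
rewrite -scalerBl -scalerDl; have [ci|ci] := lerP 0 (c i).
  by rewrite max_l ?oppr_le0 // sub0r subrr scale0r.
by rewrite max_r ?oppr_ge0 ?ltW // subr0 subrr scale0r.
Qed.

Lemma star_indep q : q \in cones S -> indep S q.
Proof.
move=> qS a; rewrite pr_sum => pr0.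
have := pr_sub F ip t (\sum_(i in q) a i *: u i); rewrite pr0 subr0 => /cspanP[c cE] i iq.
have := C_indep (star_cone qS) (a := fun i => if i \in q then a i else - c i).
move=> /(_ _ i); rewrite iq inE iq; apply=> //.
rewrite (big_setID q) /= (finset.setIidPr (finset.subsetUl _ _)).
rewrite (eq_bigr (fun i => a i *: u i)) => [|j ->//]; rewrite cE.
rewrite (eq_bigl (mem t)) => [|j]; last first.
  by rewrite !inE; case: (boolP (j \in q)) => //= /(star_disj qS)/negbTE->.
rewrite -big_split big1 // => j jt /=.
by case: (boolP (j \in q)) => [/(star_disj qS)|_]; rewrite ?jt // scaleNr subrr.
Qed.

Lemma ip_mark_star v i : v \in orthov ip (cspan F t) -> ip v (mark S i) = ip v (u i).
Proof.
move=> /mem_orthovP vt; rewrite -[in RHS](subrK (pr F ip t (u i)) (u i)) ipDr.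
by rewrite (vt _ (pr_sub _ _ _ _)) add0r.
Qed.

Lemma orthov_mark v : (forall i, i \in t -> ip v (u i) = 0) -> v \in orthov ip (cspan F t).
Proof. by move=> h; apply/mem_orthovP => x /(cspan_orth h). Qed.

Lemma star_cspan q v : v \in cspan F (q :|: t) -> v \in orthov ip (cspan F t) ->
  v \in cspan S q.
Proof.
move=> vs /mem_orthovP vt; have vE : pr F ip t v = v.
  by apply: pr_uniq => [i it_|]; [exact/vt/mem_cspan | rewrite subrr mem0v].
rewrite -vE; have /cspanP[a ->] := vs.
apply/cspanP; exists (fun i => if i \in q then a i else 0).
rewrite pr_sum; apply/eqP; rewrite -subr_eq0 -linearB /=; apply/eqP/pr_uniq.
  by move=> i _; rewrite ip0l.
rewrite subr0 (big_setID q) /= (finset.setIidPr (finset.subsetUl _ _)).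
rewrite addrAC -sumrB big1 ?add0r => [|i ->]; last by rewrite subrr.
apply: memv_suml => i; rewrite !inE => /andP[/negbTE->] /= it_.
exact/memvZ/mem_cspan.
Qed.

Lemma star_dual q i : q \in cones S -> i \in q -> dual S ip q i = dual F ip (q :|: t) i.
Proof.
move=> qS iq; have qi := C_indep (star_cone qS).
have iqt : i \in q :|: t by rewrite inE iq.
have dt : dual F ip (q :|: t) i \in orthov ip (cspan F t).
  apply: orthov_mark => j jt; rewrite dualE // ?inE ?jt ?orbT //.
  by case: eqP jt => // <-; rewrite (negbTE (star_disj qS iq)).
apply: (@cspan_inj _ _ _ S ip q).
- exact: dual_cspan.
- by apply: star_cspan => //; exact: dual_cspan.
move=> j jq; rewrite (dualE ip (star_indep qS)) // ip_mark_star //.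
by rewrite dualE // inE jq.
Qed.

Lemma star_cubvec q z : q \in cones S ->
  cubvec S ip (fun i => ell F ip t i z) q = cubvec F ip z (q :|: t) - cubvec F ip z t.
Proof.
move=> qS; have qi := C_indep (star_cone qS); have ti := C_indep tC.
have dt : cubvec F ip z (q :|: t) - cubvec F ip z t \in orthov ip (cspan F t).
  by apply: orthov_mark => j jt; rewrite ipBl !cubvec_ip ?subrr // inE jt orbT.
apply: cubvec_uniq; first exact: star_indep.
  apply: star_cspan => //; rewrite memvB ?cubvec_cspan //.
  by apply: (cspanS (finset.subsetUr q t)); exact: cubvec_cspan.
by move=> i iq; rewrite ip_mark_star // ipBl cubvec_ip ?inE ?iq.
Qed.

Lemma star_ell q i z : q \in cones S ->
  ell S ip q i (fun i => ell F ip t i z) = ell F ip (q :|: t) i z.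
Proof.
move=> qS; rewrite {1}/ell star_cubvec // ip_mark_star ?ipBl.
  by rewrite /ell; ring.
have qi := C_indep (star_cone qS); have ti := C_indep tC.
by apply: orthov_mark => j jt; rewrite ipBl !cubvec_ip ?subrr // inE jt orbT.
Qed.

Lemma star_cubical q z : q \in cones S -> cubical F ip (q :|: t) z ->
  cubical S ip q (fun i => ell F ip t i z).
Proof.
move=> qS cz r i rq ir; have rS := star_sub qS rq.
rewrite star_cubvec // star_dual // ipBl.
have -> : ip (cubvec F ip z t) (dual F ip (r :|: t) i) = 0.
  rewrite (@ipC _ _ ip); apply: (@cspan_orth _ _ _ F ip t); last exact/cubvec_cspan/C_indep.
  move=> j jt; rewrite dualE ?inE ?ir ?jt ?orbT //; first last.
    exact/C_indep/star_cone.
  by case: eqP jt => // <-; rewrite (negbTE (star_disj rS ir)).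
by rewrite subr0; apply: cz; rewrite ?finset.setSU // inE ir.
Qed.

Lemma star_Cub z : Cub F ip z -> Cub S ip (fun i => ell F ip t i z).
Proof.
move=> /(CubP _ C_sub C_indep) cz; apply/(CubP _ star_sub star_indep) => q qS.
by apply: star_cubical => //; exact/cz/star_cone.
Qed.

Lemma star_cmv w q zs : q \in cones S ->
  cmv S ip (cones S) (star_weight w t) q [seq (fun i => ell F ip t i z) | z <- zs] =
  cmv F ip (cones F) w (q :|: t) zs.
Proof.
elim: zs q => [//|z zs IH] q qS; rewrite map_cons !cmv_cons.
apply: eq_big => [i|i /andP[iq iqS]].
  rewrite finset.in_setU negb_or mem_star finset.setUA -andbA; congr (_ && _); congr (_ && _).
  have := qS; rewrite mem_star => /andP[/eqP qt _].
  by rewrite finset.setIUl qt finset.setU0 finset.setI_eq0 finset.disjoints1.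
by rewrite star_ell // IH // finset.setUA.
Qed.

Lemma star_AF w : Cub F ip !=set0 ->
  one_positive_eigenvalue (hessian (fanVol_poly S ip (star_weight w t) 2) (fun=> 0)) ->
  let mv := cmv F ip (cones F) w t in
  forall x y, 0 < mv [:: x; x] -> mv [:: x; x] * mv [:: y; y] <= mv [:: x; y] ^+ 2.
Proof.
move=> [z0 cz0] h mv x y.
have H x' y' : mv [:: x'; y'] = cmv S ip (cones S) (star_weight w t) finset.set0
    [:: (fun i => ell F ip t i x'); (fun i => ell F ip t i y')].
  have := star_cmv w [:: x'; y'] star_set0; rewrite finset.set0U => /= ->.
  by rewrite /mv.
rewrite !H; apply: (hessian_AF (star_sub) (star_indep) (star_set0)) => //.
by exists (fun i => ell F ip t i z0); exact: star_Cub.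
Qed.

End Star.

Section ClosedCones.
Variables (R : realType) (n : nat) (I : finType) (F : fan_data R n I).
Variable ip : {dot 'rV[R]_n for idfun}.

Lemma closed_cspan (s : {set I}) : closed [set v : 'rV[R]_n | v \in cspan F s].
Proof.
have -> : [set v : 'rV[R]_n | v \in cspan F s] =
    \bigcap_(x in [set x | forall v, v \in cspan F s -> ip v x = 0]) [set v | ip v x = 0].
  apply/seteqP; split=> v /= vs; first by move=> x /=; apply.
  have : ip v (pr F ip s v) = 0.
    by apply: vs => /= v' v's; rewrite ipC pr_orth.
  rewrite ipC pr_ip => /eqP; rewrite ip_eq0 => /eqP p0.
  by have := pr_sub F ip s v; rewrite p0 subr0.
apply: closed_bigI => x _.
apply: (@preimage_closed _ _ (fun v : 'rV[R]_n => ip v x) [set y : R | y = 0]); last exact: closed_eq.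
by move=> v _; exact: ip_continuous.
Qed.

Lemma closed_cone (s : {set I}) : indep F s -> closed (cone F s).
Proof.
move=> si; have -> : cone F s = [set v | v \in cspan F s] `&`
    \bigcap_(i in [set i | i \in s]) [set v | 0 <= ip v (dual F ip s i)].
  by apply/seteqP; split=> v; [move=> /(coneP ip _ si)[] | move=> vP; apply/(coneP ip _ si)].
apply: closedI; first exact: closed_cspan.
apply: closed_bigI => i _.
apply: (@preimage_closed _ _ (fun v : 'rV[R]_n => ip v (dual F ip s i)) [set y : R | 0 <= y]); last exact: closed_ge.
by move=> v _; exact: ip_continuous.
Qed.

End ClosedCones.

Section Connectivity.
Variables (R : realType) (n d : nat) (I : finType) (F : fan_data R n I).
Variable ip : {dot 'rV[R]_n for idfun}.
Hypothesis (hF : is_dfan F d) (hsimpl : simplicial F).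
Implicit Types (s t q : {set I}).
Local Notation u := (mark F).

(* Two elements of the cones with the same projection differ by elements of the
   cone [t], so that after adding those both lie in the intersection of the
   corresponding cones of [F], which is [t]. *)
Lemma star_cone_disjoint t q q' v : t \in cones F ->
  q \in cones (star F ip t) -> q' \in cones (star F ip t) -> q :&: q' = finset.set0 ->
  cone (star F ip t) q v -> cone (star F ip t) q' v -> v = 0.
Proof.
move=> tC qS q'S qq' [a [a0 vE]] [b [b0 vE']].
have C_sub := cones_sub ip hF hsimpl.
have qt := star_cone C_sub qS; have q't := star_cone C_sub q'S.
have [c [e [c0 e0 ce]]] := pr_eq_coef (etrans (esym vE) vE').
set p := _ + _ in ce.
have H r (x y : I -> R) : r \in cones (star F ip t) -> (forall i, 0 <= x i) -> (forall i, 0 <= y i) ->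
    cone F (r :|: t) (\sum_(i in r) x i *: u i + \sum_(i in t) y i *: u i).
  move=> rS x0 y0; exists (fun i => if i \in r then x i else y i); split; first by move=> i; case: ifP.
  rewrite [RHS](big_setID r) /= (finset.setIidPr (finset.subsetUl _ _)); congr (_ + _).
    by apply: eq_bigr => i ->.
  apply: eq_big => [i|i it_].
    by rewrite !inE; case: (boolP (i \in r)) => //= /(star_disj C_sub rS)/negbTE.
  by case: (boolP (i \in r)) => // /(star_disj C_sub rS); rewrite it_.
have pq : cone F (q :|: t) p by exact: H.
have pq' : cone F (q' :|: t) p by rewrite ce; exact: H.
have := coneI ip hF hsimpl qt q't (conj pq pq').
rewrite -finset.setUIl qq' finset.set0U => -[f [_ pE]].
have /eqP : pr F ip t p = 0.
  apply: pr_uniq => [i _|]; first by rewrite ip0l.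
  by rewrite subr0; apply/cspanP; exists f.
rewrite /p /pr linearD /= -/(pr F ip t _) -pr_sum -vE.
have -> : daddv_pi (orthov ip (cspan F t)) (cspan F t) (\sum_(i in t) c i *: u i) = 0.
  apply: pr_uniq => [i _|]; first by rewrite ip0l.
  by rewrite subr0; apply/cspanP; exists c.
by rewrite addr0 => /eqP.
Qed.

(* Otherwise the cones of the star with rays in [X] and those with rays outside
   [X] would disconnect its punctured support. *)
Lemma link_connected t (X : {set I}) i j : t \in cones F ->
  connected (fan_support (star F ip t) `\ 0) ->
  i \in rays (star F ip t) -> j \in rays (star F ip t) -> i \in X -> j \notin X ->
  exists k l, [/\ k \in X, l \notin X, k \in rays (star F ip t), l \in rays (star F ip t) &
    l |: (k |: t) \in cones F].
Proof.
move=> tC hc iS jS iX jX; set S := star F ip t in hc iS jS *.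
have C_sub := cones_sub ip hF hsimpl; have C_indep := cones_indep hsimpl.
have S_sub := star_sub C_sub; have S_indep := star_indep C_sub C_indep.
apply: contrapT => nkl.
have dich q : q \in cones S -> q \subset X \/ q :&: X = finset.set0.
  move=> qS; have [|/set0Pn[k]] := eqVneq (q :&: X) finset.set0; first by right.
  rewrite inE => /andP[kq kX]; left; apply/fintype.subsetP => l lq.
  apply: contraT => lX; case: nkl; exists k, l; split=> //; try exact: (mem_rays (S_sub ip t) qS).
  apply: C_sub (star_cone C_sub qS) _.
  by rewrite finset.setUA finset.setSU // finset.subUset !finset.sub1set lq.
pose U := \bigcup_(q in [set q : {set I} | q \in cones S /\ q \subset X]) cone S q.
pose V := \bigcup_(q in [set q : {set I} | q \in cones S /\ q :&: X = finset.set0]) cone S q.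
have Ucl : closed U by apply: closed_bigcup => [|q [qS _]]; [exact: finite_finset | exact/(closed_cone ip)/S_indep].
have Vcl : closed V by apply: closed_bigcup => [|q [qS _]]; [exact: finite_finset | exact/(closed_cone ip)/S_indep].
have UV v : U v -> V v -> v = 0.
  move=> [q [qS qX] qv] [q' [q'S q'X] q'v].
  apply: (star_cone_disjoint tC qS q'S) qv q'v; apply/eqP.
  by rewrite -finset.subset0 -q'X finset.setIC finset.setIS.
have AUV v : fan_support S v -> U v \/ V v.
  by move=> [q qS qv]; have [qX|qX] := dich q qS; [left | right]; exists q.
have iC : [set i]%SET \in cones S by move: iS; rewrite inE.
have jC : [set j]%SET \in cones S by move: jS; rewrite inE.
have mark0 k : [set k]%SET \in cones S -> mark S k <> 0.
  move=> kS m0; have /eqP := oner_eq0 R; apply.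
  have := S_indep ip t _ kS (fun=> 1) _ k (finset.set11 _); apply.
  by rewrite big_set1 m0 scaler0.
have Ui : U (mark S i).
  by exists [set i]%SET; [split; rewrite ?finset.sub1set | apply: mark_cone; rewrite inE].
have Vj : V (mark S j).
  exists [set j]%SET; last by apply: mark_cone; rewrite inE.
  by split=> //; apply/eqP; rewrite finset.setI_eq0 finset.disjoints1.
pose A := fan_support S `\ 0.
have Ai : A (mark S i) by split; [exists [set i]%SET => //; apply: mark_cone; rewrite inE | exact: mark0].
have Aj : A (mark S j) by split; [exists [set j]%SET => //; apply: mark_cone; rewrite inE | exact: mark0].
have E : A `&` U = A `&` ~` V.
  apply/seteqP; split=> v [Av]; split=> //.
    by move=> Vv; case: Av => _; apply; exact: UV.
  by case: Av => /AUV[].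
have := hc (A `&` U) (ex_intro _ (mark S i) (conj Ai Ui)).
move=> /(_ (ex_intro2 _ _ (~` V) (closed_openC Vcl) E) (ex_intro2 _ _ U Ucl erefl)).
move=> /seteqP[_ /(_ _ Aj)[_ Uj]]; exact: mark0 jC (UV _ Uj Vj).
Qed.

End Connectivity.

(** * Induction on the dimension of the star *)

Section AlexandrovFenchel.
Variables (R : realType) (n d : nat) (I : finType) (F : fan_data R n I).
Variable ip : {dot 'rV[R]_n for idfun}.
Variable w : {set I} -> R.
Hypothesis (hF : is_dfan F d) (hsimpl : simplicial F).
Hypothesis hw : forall s, s \in cones F -> cdim F s = d -> 0 < w s.
Hypothesis hCub : Cub F ip !=set0.
Hypothesis hconn : forall t, t \in cones F -> (cdim F t + 3 <= d)%N ->
  connected (fan_support (star F ip t) `\ 0).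
Hypothesis hHess : forall t, t \in cones F -> (cdim F t + 2 = d)%N ->
  one_positive_eigenvalue
    (hessian (fanVol_poly (star F ip t) ip (star_weight w t) 2) (fun=> 0)).
Implicit Types (s t : {set I}) (z x y : I -> R).
Local Notation mv := (cmv F ip (cones F) w).
Local Notation ell := (ell F ip).
Let C_sub := cones_sub ip hF hsimpl.
Let C_indep := cones_indep hsimpl.

Lemma Cub_ell_gt0 z t i : Cub F ip z -> i |: t \in cones F -> i \notin t -> 0 < ell t i z.
Proof.
move=> /(CubP _ C_sub C_indep) cz itC nit.
by apply: (ell_gt0 (s := i |: t)) => //; [exact: C_indep | exact: cz].
Qed.

Lemma Cub_mv_gt0 t zs : t \in cones F -> (#|t| + size zs)%N = d ->
  (forall z, z \in zs -> Cub F ip z) -> 0 < mv t zs.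
Proof.
move=> tC td cz; apply: (mv_gt0 (d := d)) => //.
- by move=> s sC sd; apply: hw => //; rewrite hsimpl.
- by move=> s sC sd; exact: (cones_extend ip hF hsimpl).
by move=> s i z /cz; exact: Cub_ell_gt0.
Qed.

Lemma mv_link t y zs : t \in cones F -> mv t (y :: zs) =
  \sum_(j in rays (star F ip t)) ell t j y * mv t (basis_fun R j :: zs).
Proof.
move=> tC; rewrite cmv_cons; apply: eq_big => [j|j /andP[njt jtC]].
  by rewrite (star_mem_rays ip C_sub).
by rewrite mv_ind //; exact: C_indep.
Qed.

Lemma mv_basis0 t i zs : t \in cones F -> i \notin t -> i |: t \notin cones F ->
  mv t (basis_fun R i :: zs) = 0.
Proof.
move=> tC nit itC; rewrite cmv_cons big1 // => k /andP[nkt ktC].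
rewrite /ell /basis_fun cubvecE; last exact: C_indep.
rewrite big1 ?ip0l ?subr0 => [|j jt].
  by case: eqP ktC itC => [->->//|_ _ _]; rewrite mul0r.
by case: eqP nit => [<-|]; rewrite ?jt // scale0r.
Qed.

Lemma AF_step t c rest : t \in cones F -> (#|t| + size rest + 3)%N = d ->
  Cub F ip c -> (forall z, z \in rest -> Cub F ip z) ->
  (forall i y, i \notin t -> i |: t \in cones F ->
    mv (i |: t) [:: c, c & rest] * mv (i |: t) [:: y, y & rest] <=
    mv (i |: t) [:: c, y & rest] ^+ 2) ->
  forall x y, Cub F ip x ->
  mv t [:: x, x, c & rest] * mv t [:: y, y, c & rest] <= mv t [:: x, y, c & rest] ^+ 2.
Proof.
move=> tC td cc crest IH x y cx.
pose L := rays (star F ip t); pose e (i : 'I_#|L|) : I := enum_val i.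
have eL i : (e i \notin t) && (e i |: t \in cones F).
  by rewrite -(star_mem_rays ip C_sub); exact: enum_valP.
pose B : 'M[R]_#|L| := \matrix_(i, j) mv t [:: basis_fun R (e i), basis_fun R (e j), c & rest].
have swap := @mv_swap _ _ _ F ip (cones F) w C_sub C_indep.
have BT : B^T = B by apply/matrixP => i j; rewrite !mxE swap.
have Brow i z : \sum_j B i j * ell t (e j) z = mv t [:: basis_fun R (e i), z, c & rest].
  rewrite swap mv_link // [RHS]big_enum_val; apply: eq_bigr => j _.
  by rewrite mxE mulrC swap.
have BE z z' : bform B (\row_i ell t (e i) z) (\row_i ell t (e i) z') = mv t [:: z, z', c & rest].
  rewrite bformE mv_link // [RHS]big_enum_val; apply: eq_bigr => i _.
  rewrite -/(e i) -Brow mulr_sumr; apply: eq_bigr => j _; rewrite !mxE; ring.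
have ind i zs : mv t (basis_fun R (e i) :: zs) = mv (e i |: t) zs.
  by have /andP[] := eL i => nit itC; rewrite mv_ind //; exact: C_indep.
have pos i j : e j \notin e i |: t -> e j |: (e i |: t) \in cones F -> 0 < B i j.
  move=> nj jC; have /andP[nit itC] := eL i.
  rewrite mxE ind mv_ind //; last exact: C_indep.
  apply: Cub_mv_gt0 => //; last by move=> z; rewrite inE => /orP[/eqP->|/crest].
  by rewrite !cardsU1 nj nit -td /=; lia.
rewrite -!BE; apply: (@bochner _ _ B (fun i => ell t (e i) c) (fun i => mv (e i |: t) [:: c, c & rest])) => //.
- by move=> i; have /andP[nit itC] := eL i; exact: Cub_ell_gt0.
- move=> i; have /andP[nit itC] := eL i; apply: Cub_mv_gt0 => //.
    by rewrite cardsU1 nit -td /=; lia.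
  by move=> z; rewrite !inE => /or3P[/eqP->|/eqP->|/crest].
- by move=> i; rewrite Brow ind.
- move=> i j ij; have [jC|jC] := boolP (e j |: (e i |: t) \in cones F).
    apply/ltW/pos => //; rewrite !inE negb_or (inj_eq enum_val_inj) eq_sym ij /=.
    by have /andP[] := eL j.
  rewrite mxE ind mv_basis0 //; first by have /andP[] := eL i.
  rewrite !inE negb_or (inj_eq enum_val_inj) eq_sym ij /=.
  by have /andP[] := eL j.
- move=> X /set0Pn[i iX]; rewrite -finset.subTset => /subsetPn[j _ jX].
  have mX k : (e k \in [set e a | a in X]%SET) = (k \in X) by rewrite mem_imset //; exact: enum_val_inj.
  have td3 : (cdim F t + 3 <= d)%N by rewrite hsimpl // -td; lia.
  have iX' : e i \in [set e a | a in X]%SET by rewrite mX.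
  have jX' : e j \notin [set e a | a in X]%SET by rewrite mX.
  have [k [l [kX lX kL lL klC]]] :=
    link_connected hF hsimpl tC (hconn tC td3) (enum_valP i) (enum_valP j) iX' jX'.
  exists (enum_rank_in kL k), (enum_rank_in lL l).
  have Ek : e (enum_rank_in kL k) = k by rewrite /e enum_rankK_in.
  have El : e (enum_rank_in lL l) = l by rewrite /e enum_rankK_in.
  rewrite -!mX Ek El; split=> //; rewrite gt_eqF // pos ?Ek ?El //.
  rewrite !inE negb_or; apply/andP; split; first by apply: contraNneq lX => ->.
  by have := lL; rewrite (star_mem_rays ip C_sub) => /andP[].
- move=> y'; pose z : I -> R := fun k => \sum_j if e j == k then y' ord0 j else 0.
  have ze j : z (e j) = y' ord0 j.
    rewrite /z (bigD1 j) //= eqxx big1 ?addr0 // => k /negbTE kj.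
    by rewrite (inj_eq enum_val_inj) kj.
  have zt j : ell t (e j) z = y' ord0 j.
    rewrite /ell cubvecE ?big1 ?ip0l ?subr0 ?ze //; last exact: C_indep.
    move=> k kt; rewrite /z big1 ?scale0r // => l _; case: eqP => // lk.
    by have /andP[] := eL l; rewrite lk kt.
  have -> : y' = \row_i ell t (e i) z by apply/rowP => i; rewrite mxE zt.
  rewrite BE (@mv_swap_cat _ _ _ F ip (cones F) w C_sub C_indep t [:: z] z c) swap.
  rewrite mv_link // [leLHS]big_enum_val; apply: ler_sum => i _.
  have -> : \sum_j B i j * (\row_j ell t (e j) z) ord0 j = mv t [:: basis_fun R (e i), z, c & rest].
    by rewrite -Brow; apply: eq_bigr => j _; rewrite [X in _ * X]mxE.
  rewrite -/(e i) !ind; have /andP[nit itC] := eL i.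
  have ci := Cub_ell_gt0 cc itC nit.
  have pi : 0 < mv (e i |: t) [:: c, c & rest].
    apply: Cub_mv_gt0 => //; first by rewrite cardsU1 nit -td /=; lia.
    by move=> z'; rewrite !inE => /or3P[/eqP->|/eqP->|/crest].
  rewrite -mulrA ler_pM2l // mulrC ler_pdivlMr // mulrC.
  by rewrite swap; exact: IH.
rewrite BE; apply: Cub_mv_gt0 => //; first by rewrite -td /=; lia.
by move=> z'; rewrite !inE => /or4P[/eqP->|/eqP->|/eqP->|/crest].
Qed.

Lemma AF_cones t zs x y : t \in cones F -> (#|t| + size zs + 2)%N = d ->
  (forall z, z \in zs -> Cub F ip z) -> Cub F ip x ->
  mv t [:: x, x & zs] * mv t [:: y, y & zs] <= mv t [:: x, y & zs] ^+ 2.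
Proof.
elim: zs t x y => [|c rest IH] t x y tC td czs cx.
  have td2 : (cdim F t + 2)%N = d by rewrite hsimpl // -td addn0.
  apply: (star_AF C_sub C_indep tC hCub (hHess tC td2)).
  apply: Cub_mv_gt0 => //; first by rewrite -td /= addn0.
  by move=> z; rewrite !inE => /orP[/eqP->|/eqP->].
apply: AF_step => //.
- by rewrite -td /=; lia.
- by apply: czs; exact: mem_head.
- by move=> z zr; apply: czs; rewrite inE zr orbT.
move=> i y' nit itC; apply: IH => //.
- by rewrite cardsU1 nit -td /=; lia.
- by move=> z zr; apply: czs; rewrite inE zr orbT.
by apply: czs; exact: mem_head.
Qed.

End AlexandrovFenchel.

Theorem theorem5p1 (R : realType) (n d : nat) (I : finType)
    (F : fan_data R n I) (w : {set I} -> R) (ip : {dot 'rV[R]_n for idfun})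
    (hd : (2 <= d)%N) (hF : is_dfan F d) (hsimpl : simplicial F)
    (hw : forall s, s \in cones F -> cdim F s = d -> 0 < w s)
    (hCub : Cub F ip !=set0)
    (hconn : forall t, t \in cones F -> (cdim F t + 3 <= d)%N ->
       connected (fan_support (star F ip t) `\ 0))
    (hHess : forall t, t \in cones F -> (cdim F t + 2 = d)%N ->
       one_positive_eigenvalue
         (hessian (fanVol_poly (star F ip t) ip (star_weight w t) 2)
                  (fun=> 0))) :
  is_AF F ip w d.
Proof.
split=> // M hM z1 z2 zs cz1 cz2 czs.
have C_sub := cones_sub ip hF hsimpl; have C_indep := cones_indep hsimpl.
have s0C := set0_cones ip hF hsimpl.
case: d hd hF hw hconn hHess M hM zs czs => [//|[//|m]] _ hF hw hconn hHess M hM zs czs.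
have czs' z : z \in (zs : seq _) -> Cub F ip z by move=> /tnthP[k ->].
have szs : size zs = m by rewrite size_tuple !subSS subn0.
have E x y : Cub F ip x -> Cub F ip y ->
    fanMVol F ip w M (fun k => nth x [:: x, y & zs] k) =
    cmv F ip (cones F) w finset.set0 [:: x, y & zs].
  have sz : size [:: x, y & zs] = m.+2 by rewrite /= szs.
  move=> cx cy; rewrite mv_decomp // finset.cards0 add0n sz /fanMVol.
  apply: eq_big => [s|s /andP[sC /eqP sd]].
    by rewrite finset.sub0set andbT; case: (boolP (s \in cones F)) => // /hsimpl->.
  have sd' : #|s| = m.+2 by rewrite -hsimpl.
  have cub z : z \in [:: x, y & zs] -> cubical F ip s z.
    rewrite !inE => /or3P[/eqP->|/eqP->|/czs' cz].
    - by move: cx => /(CubP _ C_sub C_indep); apply.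
    - by move: cy => /(CubP _ C_sub C_indep); apply.
    by move: cz => /(CubP _ C_sub C_indep); apply.
  rewrite -(mixed_volume_ncone (C_indep _ sC) sd' (hM s sC sd) sz cub).
  congr (_ * M s _); apply/funext => k; congr (ncone F ip _ s).
  by apply: set_nth_default; rewrite sz.
rewrite /= !E //; apply: (AF_cones hF hsimpl hw hCub hconn hHess) => //.
by rewrite finset.cards0 add0n szs addn2.
Qed.
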